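(* Let $\Omega\subseteq\mathbb R^n$ be open. The strict (LB)-topology of the spaces $(L^p_{\mathrm{comp}},\beta(L^p_{\mathrm{comp}},L^q_{\mathrm{loc}}))$, $1\le p\le\infty$, $\frac1p+\frac1q=1$, $(\mathcal M_{\mathrm{comp}},\beta(\mathcal M_{\mathrm{comp}},\mathcal E^0))$, where $\mathcal M_{\mathrm{comp}}\cong\mathcal E'^{\,0}$, and $(\mathcal K,\beta(\mathcal K,\mathcal M))$, $\mathcal K=\mathcal D^0$, is generated by the seminorms $p_\varphi$, $\varphi\in\mathcal E_+$, $$L^p_{\mathrm{comp}}\ni f\mapsto p_\varphi(f)=\|\varphi f\|_p,$$ $$\mathcal M_{\mathrm{comp}}\ni\mu\mapsto p_\varphi(\mu)=\|\varphi\mu\|_1,$$ $$\mathcal K\ni f\mapsto p_\varphi(f)=\|\varphi f\|_\infty,$$ respectively.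
   Context: All spaces are on the open set $\Omega\subseteq\mathbb R^n$, which is omitted from the notation. $\mathcal E_+$ is the set of positive functions in $\mathcal E=C^\infty(\Omega)$. $\mathcal E^0=C(\Omega)$ with the topology of uniform convergence on compact sets, and $\mathcal E'^{\,0}$ is its dual. $\mathcal K=\mathcal D^0$ is the space of continuous functions with compact support, with the strict inductive limit topology $\varinjlim_K\mathcal D^0_K$, where $\mathcal D^0_K$ ($K\subset\Omega$ compact) is the Banach space of continuous functions supported in $K$ with the sup norm. $\mathcal M=\mathcal M(\Omega)=\mathcal K'$ is the space of Radon measures. $L^q_{\mathrm{loc}}$ carries the Fréchet topology given by the seminorms $\|\chi_Kf\|_q$, $K\subset\Omega$ compact, $\chi_K$ being the characteristic function of $K$. $L^p_{\mathrm{comp}}$ is the space of $L^p$-functions with compact support in $\Omega$, and $\mathcal M_{\mathrm{comp}}$ the space of Radon measures with compact support in $\Omega$; their strict (LB)-topologies are the inductive limits over compact $K\subset\Omega$ of the Banach subspaces of elements supported in $K$ (with the $L^p$-norm and the total variation norm $\|\cdot\|_1$, respectively). $\beta(E,F)$ is the topology on $E$ of uniform convergence on the bounded subsets of $F$, with the dual pairings given by integration. *)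

(* Defs.v *)
From HB Require Import structures.
From mathcomp Require Import all_boot all_order all_algebra.
From mathcomp Require Import generic_quotient ring_quotient complex.
From mathcomp Require Import all_classical all_reals all_analysis.
From mathcomp Require Import measurable_realfun ess_sup_inf.
Set Implicit Arguments.
Unset Strict Implicit.
Unset Printing Implicit Defensive.
Import Order.TTheory GRing.Theory Num.Theory.
Import numFieldNormedType.Exports.
Import ComplexField.Normc.
Local Open Scope classical_set_scope.
Local Open Scope ring_scope.
Local Open Scope complex_scope.

(* R[i], presented as a [numFieldType] so that it receives the topology
   defined by its modulus.  The real-valued modulus is [normc]. *)
Definition Cplx (R : realType) : numFieldType := R[i].
Arguments Cplx R : simpl never.

Section modulus.
Variable R : realType.
Local Notation C := (Cplx R).

Lemma normcE (z : C) : `|z| = (normc z)%:C :> R[i].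
Proof. by []. Qed.

Lemma normc_ge0 (z : C) : 0 <= normc z.
Proof. by rewrite -ler0c -normcE normr_ge0. Qed.

Lemma ler_normcD (x y : C) : normc (x + y) <= normc x + normc y.
Proof.
by rewrite -lecR rmorphD /= -!normcE; exact: (@ler_normD _ C).
Qed.

Lemma normcN (x : C) : normc (- x) = normc x.
Proof. by apply: complexI; rewrite -!normcE; exact: (@normrN _ C). Qed.

Lemma normc_real (a : R) : normc (a%:C : C) = `|a|.
Proof. by rewrite /= expr0n addr0 sqrtr_sqr. Qed.

End modulus.

Section locally_convex.
Variables (R : realType) (E : lmodType (Cplx R)).
Local Notation C := (Cplx R).

(* A topology on E is represented by its set of open sets. *)
Definition seminorm_topology (P : set (E -> R)) : set (set E) :=
  [set U | forall x, U x -> exists (m : nat) (s : 'I_m -> E -> R) (e : R),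
    [/\ forall i, P (s i), 0 < e &
        forall y, (forall i, s i (y - x) < e) -> U y]].

Definition vn_bounded (tau : set (set E)) : set (set E) :=
  [set B | forall U, tau U -> U 0 ->
    exists2 r : R, 0 < r &
      forall a : C, r <= normc a -> B `<=` [set a *: u | u in U]].

Definition absolutely_convex : set (set E) :=
  [set V | forall x y, V x -> V y -> forall a b : C,
    normc a + normc b <= 1 -> V (a *: x + b *: y)].

(* The locally convex inductive limit of the normed spaces (S, N), S a
   subspace of E belonging to [steps]: the absolutely convex sets that meet
   every step in a neighbourhood of 0 of that step form a base of
   neighbourhoods of 0. *)
Definition inductive_limit_topology (N : E -> R) (steps : set (set E)) :
    set (set E) :=
  [set U | forall x, U x -> exists V : set E,
    [/\ absolutely_convex V,
        forall S, steps S ->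
          exists2 e : R, 0 < e & forall y, S y -> N y < e -> V y &
        forall y, V y -> U (x + y)]].

Definition continuous_functional (tau : set (set E)) (L : E -> C) :=
  forall W : set C, open W -> tau (L @^-1` W).

Definition topological_dual (tau : set (set E)) : set (E -> C) :=
  [set L | scalar L /\ continuous_functional tau L].

(* The families of sets used below are closed under finite unions, so the
   sets {y | |<y - x, g>| < e for all g in B} form a base of neighbourhoods
   of x. *)
Definition uniform_convergence_topology (F : Type) (pairing : E -> F -> C)
    (Bs : set (set F)) : set (set E) :=
  [set U | forall x, U x -> exists (B : set F) (e : R),
    [/\ Bs B, 0 < e &
        forall y, (forall g, B g -> normc (pairing (y - x) g) < e) -> U y]].

End locally_convex.

Section beta.
Variables (R : realType) (E F : lmodType (Cplx R)).

Definition beta_topology (pairing : E -> F -> Cplx R) (tauF : set (set F)) :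
    set (set E) :=
  uniform_convergence_topology pairing (vn_bounded tauF).

End beta.

Section continuity_of_combinations.
Variables (R : realType) (E : lmodType (Cplx R)).
Variables (N : E -> R) (steps : set (set E)).
Local Notation C := (Cplx R).
Local Notation tau := (inductive_limit_topology N steps).

Lemma inductive_limit_topologyI A B : tau A -> tau B -> tau (A `&` B).
Proof.
move=> tA tB x [/tA[V [cV sV VA]] /tB[W [cW sW WB]]].
exists (V `&` W); split.
- move=> y z [Vy Wy] [Vz Wz] a b ab; split; [exact: cV|exact: cW].
- move=> S sS; have [e e0 eV] := sV _ sS; have [d d0 dW] := sW _ sS.
  exists (Num.min e d); first by rewrite lt_min e0.
  by move=> y Sy; rewrite lt_min => /andP[? ?]; split; [exact: eV|exact: dW].
- by move=> y [Vy Wy]; split; [exact: VA|exact: WB].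
Qed.

Lemma inductive_limit_topology_local A :
  (forall x, A x -> exists B, [/\ tau B, B x & B `<=` A]) -> tau A.
Proof.
move=> h x /h[B [tB Bx BA]]; have [V [cV sV VB]] := tB _ Bx.
by exists V; split => // y /VB /BA.
Qed.

Lemma continuous_functional0 : continuous_functional tau (fun=> 0).
Proof.
move=> W oW x W0; exists setT; split => //.
by move=> S _; exists 1.
Qed.

Lemma continuous_functional_comb (a : C) (L M : E -> C) :
  continuous_functional tau L -> continuous_functional tau M ->
  continuous_functional tau (a *: L + M).
Proof.
move=> cL cM W oW; apply: inductive_limit_topology_local => x Wx.
have : {for (L x, M x), continuous (fun z : C * C => a * z.1 + z.2)}.
  apply: (@continuousD C C^o (C * C)%type (fun z => a * z.1) snd).
    apply: continuousM; first exact: cst_continuous.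
    exact: cvg_fst.
  exact: cvg_snd.
move=> /(_ W) /= /(_ (open_nbhs_nbhs (conj oW Wx))).
case=> -[A B] [LA MB] AB.
exists (L @^-1` (@interior C A) `&` M @^-1` (@interior C B)); split.
- by apply: inductive_limit_topologyI;
    [apply: cL; exact: open_interior|apply: cM; exact: open_interior].
- by split; [exact: LA|exact: MB].
- move=> y [Ay By]; apply: (AB (L y, M y)).
  by split; [exact: (@interior_subset C A)|exact: (@interior_subset C B)].
Qed.

End continuity_of_combinations.

Section supports.
Variables (R : realType) (n : nat).
Local Notation C := (Cplx R).
Local Notation X := 'rV[R]_n.

Definition supp (f : X -> C) : set X := closure [set x | f x != 0].

Lemma supp_notin (f : X -> C) x : ~ supp f x -> f x = 0.
Proof.
by move=> sfx; apply/eqP; apply: contra_notT sfx => fx; exact: subset_closure.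
Qed.

Lemma closed_supp (f : X -> C) : closed (supp f).
Proof. exact: closed_closure. Qed.

Lemma supp_comb (a : C) (f g : X -> C) :
  supp (a *: f + g) `<=` supp f `|` supp g.
Proof.
rewrite /supp -closureU; apply: closure_subset => x /= h.
have [fx0|fx0] := eqVneq (f x) 0; last by left.
right; move: h; rewrite (_ : (a *: f + g) x = a * f x + g x :> C)//.
by rewrite fx0 (@mulr0 C a) (@add0r C (g x)).
Qed.

Lemma supp_mul (h f : X -> C) : supp (h \* f) `<=` supp f.
Proof.
apply: closure_subset => x /=; apply: contra_neq => ->.
exact: (@mulr0 C (h x)).
Qed.

End supports.

(* A function (or class of functions) on Omega is represented throughout by
   its extension by 0 to R^n; scalars are complex.  K = D^0 is [ccType Omega],
   E^0 is [contType Omega] and E_+ is [smooth_pos Omega]. *)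
Section test_functions.
Variables (R : realType) (n : nat) (Omega : set 'rV[R]_n).
Local Notation C := (Cplx R).
Local Notation X := 'rV[R]_n.

Definition compact_in (K : set X) := compact K /\ K `<=` Omega.

Definition is_cc : {pred X -> C} :=
  mem [set f | continuous f /\ compact_in (supp f)].

Fact is_cc_submod_closed : submod_closed is_cc.
Proof.
split=> [|a f g].
  rewrite inE /=; split; first exact: cst_continuous.
  have -> : supp (0 : X -> C) = set0.
    rewrite /supp [X in closure X](_ : _ = set0) ?closure0//.
    by apply/seteqP; split => // x /=; rewrite eqxx.
  by split; [exact: compact0|].
rewrite !inE /= => -[cf [kf fO]] [cg [kg gO]]; split.
  move=> x; apply: (@continuousD C C^o X (a *: f) g x); last exact: cg.
  by apply: continuousM; [exact: cst_continuous|exact: cf].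
split.
  apply: subclosed_compact (@supp_comb _ _ a f g); first exact: closed_supp.
  exact: compactU.
by apply: subset_trans (@supp_comb _ _ a f g) _; rewrite subUset.
Qed.

HB.instance Definition _ := GRing.isSubmodClosed.Build C (X -> C) is_cc
  is_cc_submod_closed.

Record ccType := Cc { cc_fun :> X -> C; cc_funP : cc_fun \in is_cc }.

HB.instance Definition _ := [isSub for cc_fun].
HB.instance Definition _ := [Choice of ccType by <:].
HB.instance Definition _ := [SubChoice_isSubLmodule of ccType by <:].

Definition is_cont : {pred X -> C} :=
  mem [set g | (forall x, Omega x -> {for x, continuous g}) /\
               (forall x, ~ Omega x -> g x = 0)].

Fact is_cont_submod_closed : submod_closed is_cont.
Proof.
split=> [|a f g].
  by rewrite inE /=; split=> // x _; exact: cst_continuous.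
rewrite !inE /= => -[cf f0] [cg g0]; split=> x Ox.
  apply: (@continuousD C C^o X (a *: f) g x); last exact: cg.
  by apply: continuousM; [exact: cst_continuous|exact: cf].
rewrite (_ : (a *: f + g) x = a * f x + g x :> C)// f0// g0//.
by rewrite (@mulr0 C a) (@add0r C 0).
Qed.

HB.instance Definition _ := GRing.isSubmodClosed.Build C (X -> C) is_cont
  is_cont_submod_closed.

Record contType := Cont { cont_fun :> X -> C; cont_funP : cont_fun \in is_cont }.

HB.instance Definition _ := [isSub for cont_fun].
HB.instance Definition _ := [Choice of contType by <:].
HB.instance Definition _ := [SubChoice_isSubLmodule of contType by <:].

Fact cc_mul_subproof (h : contType) (f : ccType) : h \* f \in is_cc.
Proof.
have /[!inE] -[hc h0] := cont_funP h; have /[!inE] -[cf [kf fO]] := cc_funP f.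
split; last first.
  split; last exact: subset_trans (@supp_mul _ _ h f) fO.
  exact: subclosed_compact (@closed_supp _ _ _) kf (@supp_mul _ _ h f).
move=> x; have [Ox|nOx] := pselect (Omega x).
  by apply: continuousM; [exact: hc|exact: cf].
have nx : nbhs x (~` supp f).
  apply: open_nbhs_nbhs; split; last by move=> /fO.
  by apply: closed_openC; exact: closed_supp.
have hf0 : {near x, (fun=> 0 : C) =1 h \* f}.
  by apply: filterS nx => y /supp_notin /= ->; rewrite (@mulr0 C (h y)).
apply: cvg_trans (near_eq_cvg hf0) _.
have -> : (h \* f) x = 0.
  by rewrite /= (_ : f x = 0) ?(@mulr0 C (h x))//; apply: supp_notin => /fO.
exact: cvg_cst.
Qed.

Definition cc_mul (h : contType) (f : ccType) : ccType :=
  Cc (cc_mul_subproof h f).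

Definition partials (js : seq 'I_n) (phi : X -> R) : X -> R :=
  foldr (fun j psi => 'D_(delta_mx ord0 j) psi) phi js.

Definition smooth_in (phi : X -> R) :=
  forall (js : seq 'I_n) x, Omega x ->
    {for x, continuous (partials js phi)} /\
    forall j, derivable (partials js phi) x (delta_mx ord0 j).

Record smooth_pos := SmoothPos {
  smooth_pos_fun :> X -> R;
  smooth_pos_smooth : smooth_in smooth_pos_fun;
  smooth_pos_gt0 : forall x, Omega x -> 0 < smooth_pos_fun x;
  smooth_pos_out : forall x, ~ Omega x -> smooth_pos_fun x = 0 }.

Fact smooth_pos_cont_subproof (phi : smooth_pos) :
  (fun x => (phi x)%:C : C) \in is_cont.
Proof.
rewrite inE; split=> x Ox /=; last by rewrite smooth_pos_out.
have [phic _] := @smooth_pos_smooth phi [::] x Ox.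
apply/(@cvgrPdist_lt C C^o X (nbhs x) (nbhs_filter x)) => e e0.
have e0' : 0 < complex.Re e by move: e0; rewrite ltcE => /andP[].
move/cvgrPdist_lt : phic => /(_ _ e0'); apply: filterS => y.
rewrite -rmorphB normcE normc_real => h.
by move: e0; rewrite !ltcE /= => /andP[/eqP -> _]; rewrite eqxx.
Qed.

Definition smooth_pos_cont (phi : smooth_pos) : contType :=
  Cont (smooth_pos_cont_subproof phi).

End test_functions.
Arguments contType {R n} Omega.
Arguments ccType {R n} Omega.
Arguments smooth_pos {R n} Omega.

Definition rV_display : measure_display -> measure_display.
Proof. exact. Qed.

Section measurable_rV.
Variables (R : realType) (n : nat).

Let coord (i : 'I_n) (x : 'rV[R]_n) : R := x ord0 i.

Let rV_set0 : g_sigma_preimage coord set0.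
Proof. exact: sigma_algebra0. Qed.

Let rV_setC A : g_sigma_preimage coord A -> g_sigma_preimage coord (~` A).
Proof. exact: sigma_algebraC. Qed.

Let rV_bigcup (F : _^nat) : (forall i, g_sigma_preimage coord (F i)) ->
  g_sigma_preimage coord (\bigcup_i F i).
Proof. exact: sigma_algebra_bigcup. Qed.

(* the sigma-algebra generated by the coordinate functions, i.e. the Borel
   sigma-algebra of R^n *)
HB.instance Definition _ := @isMeasurable.Build
  (rV_display (default_measure_display)) 'rV[R]_n (g_sigma_preimage coord)
  rV_set0 rV_setC rV_bigcup.

Lemma measurable_coord (i : 'I_n) :
  measurable_fun [set: 'rV[R]_n] (fun x => x ord0 i).
Proof.
move=> _ Y mY; rewrite setTI; apply: sub_sigma_algebra => /=.
rewrite -bigcup_seq/=; exists i => /=; first by rewrite mem_index_enum.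
by exists Y => //; rewrite setTI.
Qed.

Lemma measurable_rVP d (T : measurableType d) (f : T -> 'rV[R]_n) :
  (forall i, measurable_fun [set: T] (fun x => f x ord0 i)) ->
  measurable_fun [set: T] f.
Proof.
move=> mf; apply: (measurability _ (erefl : measurable = g_sigma_preimage coord)).
move=> _ [A + <-]; rewrite -bigcup_seq/= => -[i _ [B mB <-]].
by rewrite setTI; exact: mf.
Qed.

Lemma open_measurable_rV (U : set 'rV[R]_n) : open U -> measurable U.
Proof.
move=> oU.
pose box (q : 'rV[rat]_n) (k : nat) : set 'rV[R]_n :=
  [set y | forall i, `|y ord0 i - ratr (q ord0 i)| < k.+1%:R^-1].
have mbox q k : measurable (box q k).
  have -> : box q k = \bigcap_(i in [set: 'I_n])
      [set y | `|y ord0 i - ratr (q ord0 i)| < k.+1%:R^-1].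
    by apply/seteqP; split => y /= h i => [_|]; exact: h.
  apply: fin_bigcap_measurable => // i _.
  have := @measurable_coord i measurableT _
    (measurable_ball (ratr (q ord0 i) : R) k.+1%:R^-1).
  rewrite setTI; congr (measurable _).
  by apply/seteqP; split=> y /=; rewrite /ball/= distrC.
pose F (p : 'rV[rat]_n * nat) := if `[< box p.1 p.2 `<=` U >] then box p.1 p.2
  else set0.
have -> : U = \bigcup_p F p.
  apply/seteqP; split=> [x Ux|x [p _]]; last first.
    by rewrite /F; case: asboolP => // pU; exact: pU.
  have /nbhs_ballP[e /= e0 eU] : nbhs x U by exact: open_nbhs_nbhs.
  have [k ke] : exists k, k.+1%:R^-1 < e / 2 :> R.
    have e20 : 0 < e / 2 by rewrite divr_gt0.
    have [k _ /(_ k)] := near_infty_natSinv_lt (PosNum e20).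
    by move=> /(_ (leqnn k)) h; exists k.
  have k0 : 0 < k.+1%:R^-1 :> R by [].
  have hq i : exists q : rat, `|x ord0 i - ratr q| < k.+1%:R^-1.
    have /rat_in_itvoo[q qi] : x ord0 i - k.+1%:R^-1 < x ord0 i + k.+1%:R^-1.
      by rewrite ltrD2l (lt_trans _ k0)// oppr_lt0.
    exists q; move: qi; rewrite inE/= => /itvP qi.
    by rewrite distrC ltr_distl !qi.
  have [q qP] := choice hq.
  exists (\row_i q i, k) => //; rewrite /F; case: asboolP => [_|] /=.
    by move=> i; rewrite mxE; exact: qP.
  case.
  move=> y By; apply: eU; split => // a i; rewrite (ord1 a) /ball/=.
  have := By i; rewrite mxE => yq; rewrite (splitr e).
  rewrite (le_lt_trans (ler_distD (ratr (q i)) _ _))// ltrD//.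
    exact: lt_trans (qP i) ke.
  by rewrite distrC (lt_trans yq).
apply: countable_bigcupT_measurable; first exact: countableP.
by move=> p; rewrite /F; case: asboolP.
Qed.

Lemma compact_measurable_rV (K : set 'rV[R]_n) : compact K -> measurable K.
Proof.
move=> cK; rewrite -(setCK K); apply: measurableC.
apply: open_measurable_rV; apply: closed_openC.
by apply: compact_closed cK; exact: norm_hausdorff.
Qed.

End measurable_rV.

Section lebesgue_rV.
Variables (R : realType).
Local Open Scope ereal_scope.

Definition rV_cons n (p : measurableTypeR R * 'rV[R]_n) : 'rV[R]_n.+1 :=
  \row_i (if unlift ord0 i is Some j then p.2 ord0 j else p.1).

Definition rV_uncons n (v : 'rV[R]_n.+1) : measurableTypeR R * 'rV[R]_n :=
  (v ord0 ord0, \row_j v ord0 (lift ord0 j)).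

Lemma rV_consK n : cancel (@rV_cons n) (@rV_uncons n).
Proof.
case=> x v; rewrite /rV_cons /rV_uncons !mxE unlift_none; congr (_, _).
by apply/rowP => j; rewrite !mxE liftK.
Qed.

Lemma measurable_rV_cons n : measurable_fun setT (@rV_cons n).
Proof.
apply: measurable_rVP => i; case: (unliftP ord0 i) => [j ->|->].
  rewrite (_ : (fun _ => _) = (fun v : 'rV[R]_n => v ord0 j) \o snd).
    by apply: measurableT_comp => //; exact: measurable_coord.
  by apply/funext => p; rewrite /= mxE liftK.
rewrite (_ : (fun _ => _) = fst); first exact: measurable_fst.
by apply/funext => p; rewrite /= mxE unlift_none.
Qed.

Lemma measurable_rV_uncons n : measurable_fun setT (@rV_uncons n).
Proof.
apply/measurable_fun_pairP; split; first exact: measurable_coord.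
apply: measurable_rVP => j.
rewrite (_ : (fun _ => _) = (fun v : 'rV[R]_n.+1 => v ord0 (lift ord0 j))).
  exact: measurable_coord.
by apply/funext => v; rewrite /= mxE.
Qed.

Section step.
Variables (n : nat) (mu : {sigma_finite_measure set 'rV[R]_n -> \bar R}).

Definition lebesgue_rV_step : set 'rV[R]_n.+1 -> \bar R :=
  pushforward (@lebesgue_measure R \x mu) (@rV_cons n).

Let nu : {measure set (measurableTypeR R * 'rV[R]_n)%type -> \bar R} := @lebesgue_measure R \x mu.

Let mcons A : measurable A -> measurable (@rV_cons n @^-1` A).
Proof. by move=> mA; rewrite -[X in measurable X]setTI; exact: measurable_rV_cons. Qed.

Let step0 : lebesgue_rV_step set0 = 0.
Proof. by rewrite /lebesgue_rV_step /pushforward preimage_set0 (measure0 nu). Qed.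

Let step_ge0 A : 0 <= lebesgue_rV_step A.
Proof. exact: (measure_ge0 nu). Qed.

Let step_sigma_additive : semi_sigma_additive lebesgue_rV_step.
Proof.
move=> F mF tF mUF; rewrite /lebesgue_rV_step /pushforward preimage_bigcup.
apply: (@measure_semi_sigma_additive _ _ _ nu).
- by move=> i; exact: mcons.
- apply/trivIsetP => /= i j _ _ ij; rewrite -preimage_setI.
  by move/trivIsetP : tF => /(_ _ _ _ _ ij) ->//; rewrite preimage_set0.
- by rewrite -preimage_bigcup; exact: mcons.
Qed.

HB.instance Definition _ := isMeasure.Build _ _ _ lebesgue_rV_step
  step0 step_ge0 step_sigma_additive.

Fact lebesgue_rV_step_sigma_finite : sigma_finite setT lebesgue_rV_step.
Proof.
have /sigma_finiteP[F [TF ndF Foo]] := sigma_finiteT (@lebesgue_measure R).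
have /sigma_finiteP[G [TG ndG Goo]] := sigma_finiteT mu.
pose H k := F k `*` G k.
have HT : [set: measurableTypeR R * 'rV[R]_n] = \bigcup_k H k.
  rewrite -setXTT TF TG predeqE => -[x y]; split.
    move=> [/= [i _ Fix] [k _ Gky]]; exists (maxn i k) => //; split.
    - by move: x Fix; exact/subsetPset/ndF/leq_maxl.
    - by move: y Gky; exact/subsetPset/ndG/leq_maxr.
  by move=> [i _ []/= ? ?]; split; exists i.
have mH k : measurable (H k) /\ nu (H k) < +oo.
  have [? ?] := Foo k; have [? ?] := Goo k.
  split; first exact: measurableX.
  by rewrite /nu/= product_measure1E// lte_mul_pinfty// ge0_fin_numE.
exists (fun k => @rV_uncons n @^-1` H k).
  by rewrite -preimage_bigcup -HT preimage_setT.
move=> k; have [mHk Hk] := mH k; split.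
  by rewrite -[X in measurable X]setTI; exact: measurable_rV_uncons.
rewrite /lebesgue_rV_step /pushforward -comp_preimage.
by rewrite (_ : _ \o _ = id)//; apply/funext => p; exact: rV_consK.
Qed.

HB.instance Definition _ := @Measure_isSigmaFinite.Build _ _ _ lebesgue_rV_step
  lebesgue_rV_step_sigma_finite.

End step.

Fixpoint lebesgue_rV (n : nat) : {sigma_finite_measure set 'rV[R]_n -> \bar R} :=
  match n with
  | 0 => \d_ (0%R : 'rV[R]_0)
  | m.+1 => lebesgue_rV_step (lebesgue_rV m)
  end.

End lebesgue_rV.
Arguments lebesgue_rV {R} n.

Section measurable_classes.
Variables (R : realType) (n : nat).
Local Notation C := (Cplx R).
Local Notation X := 'rV[R]_n.
Local Notation mu := (lebesgue_rV n).

Definition is_meas : {pred X -> C} :=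
  mem [set f | measurable_fun setT (fun x => complex.Re (f x)) /\
               measurable_fun setT (fun x => complex.Im (f x))].

Fact is_meas_submod_closed : submod_closed is_meas.
Proof.
split=> [|a f g]; first by rewrite inE; split; exact: measurable_cst.
rewrite !inE => -[rf jf] [rg jg]; case: a => a b.
have Re_comb x : complex.Re ((((a +i* b)%C : C) *: f + g) x) =
    a * complex.Re (f x) - b * complex.Im (f x) + complex.Re (g x).
  rewrite (_ : (_ + _) x = (a +i* b)%C * f x + g x :> R[i])//.
  by case: (f x) (g x) => [? ?] [? ?].
have Im_comb x : complex.Im ((((a +i* b)%C : C) *: f + g) x) =
    a * complex.Im (f x) + b * complex.Re (f x) + complex.Im (g x).
  rewrite (_ : (_ + _) x = (a +i* b)%C * f x + g x :> R[i])//.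
  by case: (f x) (g x) => [? ?] [? ?].
split.
  rewrite (_ : (fun x => _) = (fun x => a * complex.Re (f x) -
    b * complex.Im (f x) + complex.Re (g x))); last exact/funext.
  apply: measurable_funD => //; apply: measurable_funB; exact: measurable_funM.
rewrite (_ : (fun x => _) = (fun x => a * complex.Im (f x) +
  b * complex.Re (f x) + complex.Im (g x))); last exact/funext.
apply: measurable_funD => //; apply: measurable_funD; exact: measurable_funM.
Qed.

HB.instance Definition _ := GRing.isSubmodClosed.Build C (X -> C) is_meas
  is_meas_submod_closed.

Record measType := Meas { meas_fun :> X -> C; meas_funP : meas_fun \in is_meas }.

HB.instance Definition _ := [isSub for meas_fun].
HB.instance Definition _ := [Choice of measType by <:].
HB.instance Definition _ := [SubChoice_isSubLmodule of measType by <:].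

Definition ae_zero : {pred measType} :=
  mem [set f : measType | {ae mu, forall x, f x = 0}].

Fact ae_zero_submod_closed : submod_closed ae_zero.
Proof.
split=> [|a f g]; first by rewrite inE; apply: aeW => x.
rewrite !inE => f0 g0; apply: filterS2 f0 g0 => x f0 g0.
rewrite (_ : (a *: f + g) x = a * f x + g x :> C)// f0 g0.
by rewrite (@mulr0 C a) (@add0r C 0).
Qed.

HB.instance Definition _ := GRing.isSubmodClosed.Build C measType ae_zero
  ae_zero_submod_closed.

Definition L0Type : Type := @Quotient.quot measType ae_zero.
HB.instance Definition _ := GRing.Zmodule.on L0Type.
HB.instance Definition _ : EqQuotient measType (Quotient.equiv ae_zero) L0Type :=
  EqQuotient.on L0Type.

Local Open Scope quotient_scope.

Lemma L0_eqP (f g : measType) :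
  reflect (\pi_L0Type f = \pi_L0Type g) (`[< {ae mu, forall x, f x = g x} >]).
Proof.
apply: (iffP idP) => [/asboolP h|/eqP].
  apply/eqP; rewrite -Quotient.idealrBE inE; apply: filterS h => x fg.
  by rewrite (_ : (f - g) x = f x - g x :> C)// fg; exact: (@subrr C).
rewrite -Quotient.idealrBE inE => h; apply/asboolP; apply: filterS h => x.
by move=> /(@subr0_eq C (f x) (g x)).
Qed.

Lemma L0_ind (P : L0Type -> Prop) : (forall f, P (\pi_L0Type f)) -> forall f, P f.
Proof. by move=> h f; rewrite -[f]reprK. Qed.

Definition L0_scale (a : C) (f : L0Type) : L0Type := \pi_L0Type (a *: repr f).

Lemma repr_piE (f : measType) : {ae mu, forall x, repr (\pi_L0Type f) x = f x}.
Proof. by apply/asboolP/L0_eqP; rewrite reprK. Qed.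

Lemma L0_scale_pi a (f : measType) : L0_scale a (\pi_L0Type f) = \pi_L0Type (a *: f).
Proof.
apply/L0_eqP/asboolP; apply: filterS (repr_piE f) => x h.
by change (a * repr (\pi_L0Type f) x = a * f x :> C); rewrite h.
Qed.

Lemma pi_L0D (f g : measType) :
  \pi_L0Type (f + g) = \pi_L0Type f + \pi_L0Type g.
Proof. exact: (Quotient.pi_add ae_zero f g). Qed.

Fact L0_scaleA a b f : L0_scale a (L0_scale b f) = L0_scale (a * b) f.
Proof. by elim/L0_ind: f => f; rewrite !L0_scale_pi scalerA. Qed.

Fact L0_scale1 : left_id 1 L0_scale.
Proof. by elim/L0_ind => f; rewrite L0_scale_pi scale1r. Qed.

Fact L0_scaleDr : right_distributive L0_scale +%R.
Proof.
move=> a; elim/L0_ind => f; elim/L0_ind => g.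
by rewrite -pi_L0D !L0_scale_pi -pi_L0D scalerDr.
Qed.

Fact L0_scaleDl f : {morph L0_scale^~ f : a b / a + b}.
Proof.
by move=> a b; elim/L0_ind: f => f; rewrite !L0_scale_pi -pi_L0D scalerDl.
Qed.

HB.instance Definition _ := GRing.Zmodule_isLmodule.Build C L0Type
  L0_scaleA L0_scale1 L0_scaleDr L0_scaleDl.

Lemma repr_combE a (f g : L0Type) :
  {ae mu, forall x, repr (a *: f + g) x = a * repr f x + repr g x}.
Proof.
have -> : a *: f + g = \pi_L0Type (a *: repr f + repr g).
  by rewrite pi_L0D -L0_scale_pi !reprK.
exact: repr_piE.
Qed.

Lemma repr0E : {ae mu, forall x, repr (0 : L0Type) x = 0}.
Proof.
have -> : (0 : L0Type) = \pi_L0Type (0 : measType).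
  by apply: (@addrI _ (\pi_L0Type (0 : measType))); rewrite -pi_L0D !addr0.
exact: repr_piE.
Qed.

End measurable_classes.

Section Lebesgue_spaces.
Variables (R : realType) (n : nat) (Omega : set 'rV[R]_n).
Variables (p : \bar R) (p1 : (1 <= p)%E).
Local Notation C := (Cplx R).
Local Notation X := 'rV[R]_n.
Local Notation L0 := (L0Type R n).
Local Notation mu := (lebesgue_rV n).

Lemma measurable_normc (f : measType R n) :
  measurable_fun setT (fun x => normc (f x)).
Proof.
have /[!inE] -[rf jf] := meas_funP f.
rewrite (_ : (fun x => _) =
    @Num.sqrt R \o (fun x => complex.Re (f x) ^+ 2 + complex.Im (f x) ^+ 2)).
  apply: measurableT_comp.
    by apply: continuous_measurable_fun; exact: sqrt_continuous.
  by apply: measurable_funD; exact: measurable_funX.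
by apply/funext => x /=; case: (f x).
Qed.

Lemma finite_norm_le (f g : X -> R) :
  measurable_fun setT f -> measurable_fun setT g ->
  {ae mu, forall x, `|f x| <= `|g x|} ->
  finite_norm mu p g -> finite_norm mu p f.
Proof.
move=> mf mg fg; apply: le_lt_trans.
move: p1; rewrite unlock /Lnorm; case: p => [r|_|//].
  rewrite lee_fin => r1; have r0 : 0 < r by rewrite (lt_le_trans ltr01).
  have mpow (h : X -> R) : measurable_fun setT h ->
      measurable_fun setT (fun x => (`|(EFin \o h) x| `^ r)%E).
    move=> mh; apply: (measurableT_comp (measurable_poweR _)).
    by apply: measurableT_comp => //; exact/measurable_EFinP.
  have ge0itv (x : \bar R) : (0 <= x)%E -> x \in `[0%E, +oo%E].
    by move=> x0; rewrite in_itv/= x0 leey.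
  apply: gt0_ler_poweR.
  - by rewrite invr_ge0 ltW.
  - by apply: ge0itv; apply: integral_ge0 => x _; exact: poweR_ge0.
  - by apply: ge0itv; apply: integral_ge0 => x _; exact: poweR_ge0.
  apply: ae_ge0_le_integral => //.
  - by move=> x _; exact: poweR_ge0.
  - exact: mpow.
  - by move=> x _; exact: poweR_ge0.
  - exact: mpow.
  apply: filterS fg => x fgx _; apply: gt0_ler_poweR; first exact: ltW.
  - by apply: ge0itv; exact: abse_ge0.
  - by apply: ge0itv; exact: abse_ge0.
  - by rewrite /= lee_fin.
case: ifPn => // _; apply: le_ess_sup; apply: filterS fg => x.
by rewrite /= lee_fin.
Qed.

Lemma finite_norm_comb (a b c : X -> R) (r : R) :
  measurable_fun setT a -> measurable_fun setT b -> measurable_fun setT c ->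
  {ae mu, forall x, `|c x| <= r * a x + b x} ->
  finite_norm mu p a -> finite_norm mu p b -> finite_norm mu p c.
Proof.
move=> ma mb mc cab na nb.
have Lab : r *: a + b \in Lfun mu p.
  have La : a \in Lfun mu p by rewrite inE/= ; apply/andP; split; rewrite inE.
  have Lb : b \in Lfun mu p by rewrite inE/= ; apply/andP; split; rewrite inE.
  by case: (@Lfun_submod_closed _ _ _ mu p p1) => _; apply.
move: Lab => /andP[]; rewrite !inE/= => mab; apply: finite_norm_le => //.
by apply: filterS cab => x h; rewrite (le_trans h)// ler_norm.
Qed.

Definition vanishes_off (A : set X) (f : L0) :=
  {ae mu, forall x, ~ A x -> repr f x = 0}.

Lemma vanishes_off_comb a A (f g : L0) :
  vanishes_off A f -> vanishes_off A g -> vanishes_off A (a *: f + g).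
Proof.
move=> f0 g0; apply: filterS3 (repr_combE a f g) f0 g0 => x -> f0 g0 nAx.
by rewrite f0// g0// (@mulr0 C a) (@add0r C 0).
Qed.

Lemma vanishes_off0 A : vanishes_off A 0.
Proof. by apply: filterS (repr0E R n) => x ->. Qed.

Lemma vanishes_offS A B (f : L0) :
  A `<=` B -> vanishes_off A f -> vanishes_off B f.
Proof. by move=> AB; apply: filterS => x + nB; apply => /AB. Qed.

Lemma finite_norm_repr0 : finite_norm mu p (fun x => normc (repr (0 : L0) x)).
Proof.
apply: (@finite_norm_le _ (cst 0)); [exact: measurable_normc|by []| |].
  by apply: filterS (repr0E R n) => x ->; rewrite normc0 normr0.
exact: finite_norm_cst0.
Qed.

Lemma normc_repr_comb a (f g : L0) : {ae mu, forall x,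
  normc (repr (a *: f + g) x) <=
    normc a * normc (repr f x) + normc (repr g x)}.
Proof.
apply: filterS (repr_combE a f g) => x ->.
by rewrite -normcM; exact: ler_normcD.
Qed.

(* The proof of 1 <= p is an argument only in order that the module structure
   can be inferred from the type, as for [LfunType]. *)
Definition is_Lpcomp (_ : (1 <= p)%E) : {pred L0} :=
  mem [set f : L0 | finite_norm mu p (fun x => normc (repr f x)) /\
    exists2 K, compact_in Omega K & vanishes_off K f].

Fact is_Lpcomp_submod_closed : submod_closed (is_Lpcomp p1).
Proof.
split=> [|a f g].
  rewrite inE /=; split; first exact: finite_norm_repr0.
  by exists set0; [split; [exact: compact0|]|exact: vanishes_off0].
rewrite !inE /= => -[nf [K [cK KO] fK]] [ng [L [cL LO] gL]]; split.
  apply: (finite_norm_comb _ _ _ _ nf ng); try exact: measurable_normc.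
  apply: filterS (normc_repr_comb a f g) => x h.
  by rewrite ger0_norm ?normc_ge0//; exact: h.
exists (K `|` L); first by split; [exact: compactU|rewrite subUset].
by apply: vanishes_off_comb;
  [apply: vanishes_offS fK; exact: subsetUl
  |apply: vanishes_offS gL; exact: subsetUr].
Qed.

HB.instance Definition _ := GRing.isSubmodClosed.Build C L0 (is_Lpcomp p1)
  is_Lpcomp_submod_closed.

Record Lpcomp := LpComp {
  Lpcomp_val :> L0;
  LpcompP : Lpcomp_val \in is_Lpcomp p1 }.

HB.instance Definition _ := [isSub for Lpcomp_val].
HB.instance Definition _ := [Choice of Lpcomp by <:].
HB.instance Definition _ := [SubChoice_isSubLmodule of Lpcomp by <:].

Definition is_Lploc (_ : (1 <= p)%E) : {pred L0} :=
  mem [set f : L0 | vanishes_off Omega f /\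
    forall K, compact_in Omega K ->
      finite_norm mu p (fun x => \1_K x * normc (repr f x))].

Fact is_Lploc_submod_closed : submod_closed (is_Lploc p1).
Proof.
have mK K (f : L0) : compact_in Omega K ->
    measurable_fun setT (fun x => \1_K x * normc (repr f x) : R).
  move=> [cK _]; apply: measurable_funM; last exact: measurable_normc.
  by apply: measurable_indic; exact: compact_measurable_rV.
split=> [|a f g].
  rewrite inE /=; split; first exact: vanishes_off0.
  move=> K KO; apply: finite_norm_le finite_norm_repr0; first exact: mK.
    exact: measurable_normc.
  apply: aeW => x; rewrite normrM ler_piMl// indicE.
  by case: (_ \in _); rewrite ?normr1 ?normr0.
rewrite !inE /= => -[fO nf] [gO ng]; split; first exact: vanishes_off_comb.
move=> K KO.
apply: (finite_norm_comb _ _ _ _ (nf K KO) (ng K KO)); try exact: mK.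
apply: filterS (normc_repr_comb a f g) => x h.
rewrite ger0_norm ?mulr_ge0 ?normc_ge0 ?indicE// mulrCA -mulrDr.
by rewrite ler_wpM2l//; exact: h.
Qed.

HB.instance Definition _ := GRing.isSubmodClosed.Build C L0 (is_Lploc p1)
  is_Lploc_submod_closed.

Record Lploc := LpLoc {
  Lploc_val :> L0;
  LplocP : Lploc_val \in is_Lploc p1 }.

HB.instance Definition _ := [isSub for Lploc_val].
HB.instance Definition _ := [Choice of Lploc by <:].
HB.instance Definition _ := [SubChoice_isSubLmodule of Lploc by <:].

Definition Lp_norm (f : X -> C) : R :=
  fine ('N[mu]_p[EFin \o (fun x => normc (f x))])%E.

Definition Lpcomp_topology : set (set Lpcomp) :=
  inductive_limit_topology (fun f : Lpcomp => Lp_norm (repr (f : L0)))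
    [set [set f : Lpcomp | vanishes_off K f] | K in compact_in Omega].

Definition Lpcomp_weighted_norm (phi : smooth_pos Omega) (f : Lpcomp) : R :=
  Lp_norm (fun x => (phi x)%:C * repr (f : L0) x).

Definition Lploc_topology : set (set Lploc) :=
  seminorm_topology [set (fun g : Lploc => Lp_norm
    (fun x => (\1_K x)%:C * repr (g : L0) x)) | K in compact_in Omega].

End Lebesgue_spaces.
Arguments Lpcomp {R n} Omega {p} p1.
Arguments Lploc {R n} Omega {p} p1.
Arguments Lpcomp_topology {R n} Omega {p} p1.
Arguments Lploc_topology {R n} Omega {p} p1.
Arguments Lpcomp_weighted_norm {R n Omega p} p1 phi f.

Section Lebesgue_pairing.
Variables (R : realType) (n : nat) (Omega : set 'rV[R]_n).
Variables (p q : \bar R) (p1 : (1 <= p)%E) (q1 : (1 <= q)%E).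
Local Notation C := (Cplx R).
Local Notation mu := (lebesgue_rV n).

Definition Lp_pairing (f : Lpcomp Omega p1) (g : Lploc Omega q1) : C :=
  let h x : R[i] := repr (f : L0Type R n) x * repr (g : L0Type R n) x in
  (\int[mu]_(x in Omega) complex.Re (h x))
    +i* (\int[mu]_(x in Omega) complex.Im (h x)).

End Lebesgue_pairing.
Arguments Lp_pairing {R n} Omega {p q} p1 q1 f g.

Section continuous_functions.
Variables (R : realType) (n : nat) (Omega : set 'rV[R]_n).
Local Notation C := (Cplx R).
Local Notation X := 'rV[R]_n.
Local Notation cc := (ccType Omega).
Local Notation cont := (contType Omega).

Definition sup_norm (A : set X) (f : X -> C) : R :=
  sup [set normc (f x) | x in A].

Definition cc_topology : set (set cc) :=
  inductive_limit_topology (fun f : cc => sup_norm setT f)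
    [set [set f : cc | supp f `<=` K] | K in compact_in Omega].

Definition cont_topology : set (set cont) :=
  seminorm_topology
    [set (fun g : cont => sup_norm K g) | K in compact_in Omega].

Definition cc_weighted_norm (phi : smooth_pos Omega) (f : cc) : R :=
  sup_norm setT (cc_mul (smooth_pos_cont phi) f).

(* Radon measures are the continuous linear functionals on K = ccType Omega;
   their topology is the strong topology of the dual. *)
Definition is_radon : {pred cc -> C} := mem (topological_dual cc_topology).

Fact is_radon_submod_closed : submod_closed is_radon.
Proof.
split=> [|a L M].
  rewrite inE; split; last exact: continuous_functional0.
  by move=> b f g; rewrite /= (@mulr0 C b) (@addr0 C 0).
rewrite !inE => -[lL cL] [lM cM]; split; last first.
  exact: continuous_functional_comb.
move=> b f g; have h u : (a *: L + M) u = a * L u + M u :> C by [].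
rewrite !h lL lM.
rewrite (@mulrDr C a) (@mulrDr C b) (@mulrCA C a b) -!(@addrA C).
by congr (_ + _); rewrite (@addrCA C).
Qed.

HB.instance Definition _ := GRing.isSubmodClosed.Build C (cc -> C) is_radon
  is_radon_submod_closed.

Record radonType := Radon {
  radon_fun :> cc -> C;
  radon_funP : radon_fun \in is_radon }.

HB.instance Definition _ := [isSub for radon_fun].
HB.instance Definition _ := [Choice of radonType by <:].
HB.instance Definition _ := [SubChoice_isSubLmodule of radonType by <:].

Definition radon_topology : set (set radonType) :=
  beta_topology (fun (m : radonType) (f : cc) => m f) cc_topology.

(* For closed A this says that A contains the support of m, i.e. that m vanishes
   on the open set Omega \ A. *)
Definition radon_supported (A : set X) (m : cc -> C) :=
  forall f : cc, supp f `&` A = set0 -> m f = 0.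

Definition is_radon_comp : {pred radonType} :=
  mem [set m : radonType |
    exists2 K, compact_in Omega K & radon_supported K m].

Fact is_radon_comp_submod_closed : submod_closed is_radon_comp.
Proof.
split=> [|a m m'].
  by rewrite inE; exists set0 => //; split; [exact: compact0|].
rewrite !inE => -[K [cK KO] mK] [L [cL LO] m'L].
exists (K `|` L); first by split; [exact: compactU|rewrite subUset].
move=> f; rewrite setIUr setU_eq0 => -[fK fL].
rewrite (_ : (a *: m + m') f = a * m f + m' f :> C)// mK// m'L//.
by rewrite (@mulr0 C a) (@add0r C 0).
Qed.

HB.instance Definition _ := GRing.isSubmodClosed.Build C radonType is_radon_comp
  is_radon_comp_submod_closed.

Record radonComp := RadonComp {
  radon_comp_val :> radonType;
  radon_compP : radon_comp_val \in is_radon_comp }.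

HB.instance Definition _ := [isSub for radon_comp_val].
HB.instance Definition _ := [Choice of radonComp by <:].
HB.instance Definition _ := [SubChoice_isSubLmodule of radonComp by <:].

(* |m|(Omega), which is finite for m in M_comp. *)
Definition total_variation (m : cc -> C) : R :=
  sup [set normc (m f) | f in [set f : cc | sup_norm setT f <= 1]].

Definition radon_comp_topology : set (set radonComp) :=
  inductive_limit_topology (fun m : radonComp => total_variation m)
    [set [set m : radonComp | radon_supported K m] | K in compact_in Omega].

Definition radon_mul (h : cont) (m : cc -> C) : cc -> C :=
  fun f => m (cc_mul h f).

Definition radon_comp_weighted_norm (phi : smooth_pos Omega) (m : radonComp) :
  R := total_variation (radon_mul (smooth_pos_cont phi) m).

(* The integral of g in C(Omega) with respect to m in M_comp is m (g chi), for
   any chi in K equal to 1 in a neighbourhood of the support of m. *)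
Definition cutoff (m : radonType) : set cc :=
  [set chi | exists K U, [/\ compact_in Omega K, radon_supported K m,
    open U, K `<=` U & forall x, U x -> chi x = 1]].

Definition radon_comp_pairing (m : radonComp) (g : cont) : C :=
  (m : radonType) (cc_mul g (xget 0 (cutoff m))).

Definition cc_radon_pairing (f : cc) (m : radonType) : C := m f.

End continuous_functions.
Arguments cc_topology {R n} Omega.
Arguments cont_topology {R n} Omega.
Arguments radon_topology {R n} Omega.
Arguments radonComp {R n} Omega.
Arguments radon_comp_topology {R n} Omega.
Arguments cc_weighted_norm {R n Omega} phi f.
Arguments radon_comp_weighted_norm {R n Omega} phi m.
Arguments radon_comp_pairing {R n} Omega m g.
Arguments cc_radon_pairing {R n} Omega f m.

(* Main.v *)
Require Import Defs.
From HB Require Import structures.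
From mathcomp Require Import all_boot all_order all_algebra.
From mathcomp Require Import finmap complex ring lra.
From mathcomp Require Import all_classical all_reals all_analysis.
From mathcomp Require Import measurable_realfun ess_sup_inf.
Set Implicit Arguments.
Unset Strict Implicit.
Unset Printing Implicit Defensive.
Import Order.TTheory GRing.Theory Num.Theory.
Import numFieldNormedType.Exports.
Import ComplexField.Normc.
Local Open Scope classical_set_scope.
Local Open Scope ring_scope.
Local Open Scope complex_scope.

(** The three spaces are treated alike.  Each is the union of steps indexed by
    the compact sets K of Omega, on which a norm N is given, and each is a module
    over the continuous functions on Omega.  A weight phi in E_+ is bounded on
    every K, so the seminorm p_phi is continuous on every step, hence for the
    inductive limit topology.

    Conversely let V be an absolutely convex neighbourhood of 0.  A partition of
    unity (piece) subordinate to an exhaustion K_0, K_1, ... by compact sets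
    splits an element x into finitely many pieces x_j, the j-th one belonging to
    the step of K_j, where V contains the ball of some radius e_j.  If phi is so
    large that 2^(j+1) <= e_j phi on the support of the j-th piece, then
    p_phi(x) < 1 implies N(2^(j+1) x_j) < e_j, so that 2^(j+1) x_j is in V, and
    x = sum_j 2^-(j+1) (2^(j+1) x_j) is in V as well.  Hence V contains a ball of
    p_phi (weight_absorb).  That smooth functions phi grow as fast as one likes
    along the exhaustion is smooth_majorant; it rests on the function exp(-1/t),
    whose derivatives are computed in the algebra flat_alg.

    For the topology beta, a bounded subset of the dual partner is bounded, by a
    norm estimate, on the unit ball of each step, so that its polar is a
    neighbourhood of 0 for the inductive limit topology.  In the other direction
    p_phi is, up to a constant, the supremum of |<x, g>| over a bounded set of g,
    obtained by multiplying by phi a set that norms N: the point masses phi(x)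
    delta_x for K, the functions phi f with f in K and |f| <= 1 for M_comp, and
    the functions phi h with |h|_q <= 1 for L^p_comp, where the converse of
    Hoelder's inequality (Lnorm_norming) is used.  The properties common to the three
    cases are collected in weight_system, from which weight_topology and
    weight_beta draw the two conclusions.

    The pairing of M_comp with C(Omega) is a linear bijection onto the dual: a
    continuous functional on C(Omega) is bounded by the supremum over one compact
    set and so restricts to a measure supported there (pairing_surj). *)

(** * Seminorms *)

Section seminorms.
Variables (R : realType) (E : lmodType (Cplx R)).
Local Notation C := (Cplx R).

Definition is_seminorm (p : E -> R) :=
  (forall x y, p (x + y) <= p x + p y) /\
  (forall a x, p (a *: x) <= normc a * p x).

Lemma normcV_real (s : R) : 0 < s -> normc ((s%:C : C)^-1) = s^-1.
Proof. by move=> s0; rewrite normcV normc_real gtr0_norm. Qed.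

Lemma seminorm0 p : is_seminorm p -> p 0 = 0.
Proof.
move=> [pD pZ]; apply/eqP; rewrite eq_le; apply/andP; split.
  by have := pZ 0 0; rewrite scale0r normc0 mul0r.
by have := pD 0 0; rewrite addr0 -lerBlDl subrr.
Qed.

Lemma seminormN p x : is_seminorm p -> p (- x) <= p x.
Proof. by move=> [_ pZ]; have := pZ (-1) x;
    rewrite scaleN1r normcN normc1 mul1r. Qed.

Lemma seminorm_ge0 p x : is_seminorm p -> 0 <= p x.
Proof.
move=> sp; have [pD _] := sp; have := pD x (- x).
rewrite subrr (seminorm0 sp) => h.
have := le_trans h (lerD (lexx (p x)) (seminormN x sp)).
by rewrite -mulr2n pmulrn_lge0.
Qed.

Lemma seminorm_ball_convex (p : E -> R) e : is_seminorm p ->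
  absolutely_convex [set y | p y < e].
Proof.
move=> sp x y /= Vx Vy a b ab; have [pD pZ] := sp.
apply: le_lt_trans (pD _ _) _; apply: le_lt_trans (lerD (pZ _ _) (pZ _ _)) _.
have t0 := seminorm_ge0 x sp.
apply: (@le_lt_trans _ _ (Num.max (p x) (p y))); last by rewrite gt_max Vx Vy.
apply: (@le_trans _ _ ((normc a + normc b) * Num.max (p x) (p y))).
  by rewrite mulrDl lerD// ler_wpM2l ?normc_ge0// le_max lexx ?orbT.
by rewrite ler_piMl// le_max t0.
Qed.

(** The polar of a set A is a set of this form, the seminorms being the moduli
    of the pairings with the members of A. *)
Lemma seminorm_closed_ball_convex (I : Type) (A : set I) (p : I -> E -> R) e :
  (forall i, A i -> is_seminorm (p i)) ->
  0 <= e ->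
  absolutely_convex [set y | forall i, A i -> p i y <= e].
Proof.
move=> sp e0 x y /= Vx Vy a b ab i Ai; have [pD pZ] := sp i Ai.
apply: le_trans (pD _ _) _; apply: le_trans (lerD (pZ _ _) (pZ _ _)) _.
apply: (@le_trans _ _ ((normc a + normc b) * e)); last by rewrite ler_piMl.
by rewrite mulrDl lerD// ler_wpM2l ?normc_ge0//; [exact: Vx|exact: Vy].
Qed.

(** Induction on the number of terms.  With s the sum of the moduli of all
    coefficients but the first, the remaining terms are s times a combination
    of the same kind, so that the two-term property applies. *)
Lemma absolutely_convex_sum (V : set E) n (a : 'I_n -> C) (y : 'I_n -> E) :
  absolutely_convex V -> V 0 -> (forall i, V (y i)) ->
  \sum_i normc (a i) <= 1 -> V (\sum_i a i *: y i).
Proof.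
move=> cV V0; elim: n a y => [|n IH] a y Vy sa1; first by rewrite big_ord0.
rewrite big_ord_recl in sa1; rewrite big_ord_recl.
set s := \sum_(i < n) normc (a (lift ord0 i)) in sa1.
have s0 : 0 <= s by apply: sumr_ge0 => i _; exact: normc_ge0.
have [s00|sn0] := eqVneq s 0.
  rewrite big1 ?addr0 => [|i _].
    rewrite -[X in V X]addr0 -[X in V (_ + X)](scale0r (y ord0)).
    by apply: cV => //; rewrite normc0 addr0 (le_trans _ sa1)// lerDl.
  suff -> : a (lift ord0 i) = 0 by rewrite scale0r.
  apply: eq0_normc; apply/eqP; move: s00 => /eqP.
  by rewrite psumr_eq0 => [/allP/(_ i)/=|j _];
      [apply; rewrite mem_index_enum|exact: normc_ge0].
have sc0 : s%:C != 0 :> C by apply: contra_neq sn0 => -[].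
rewrite -[X in _ + X](scale1r) -(divff sc0) -scalerA scaler_sumr.
under eq_bigr => i _ do rewrite scalerA.
apply: cV => //; last by rewrite normc_real ger0_norm.
apply: IH => //; rewrite le_eqVlt; apply/orP; left; apply/eqP.
under eq_bigr => i _ do rewrite normcM.
by rewrite -mulr_sumr normcV_real ?mulVf// lt0r sn0.
Qed.

End seminorms.

Section complex_limits.
Variable R : realType.
Local Notation C := (Cplx R).

Lemma normcB (z w : C) : normc (z - w) = normc (w - z).
Proof. by rewrite -normcN opprB. Qed.

(** The topology of the complex numbers comes from a modulus that is itself
    complex-valued; all estimates below are made with the real modulus. *)
Lemma cvg_normcP (T : Type) (F : set_system T) {FF : Filter F} (f : T -> C)
    (l : C) :
  f @ F --> l <-> forall e : R, 0 < e -> \forall x \near F, normc (l - f x) < e.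
Proof.
rewrite (@cvgrPdist_lt C C^o T F FF); split=> h e e0.
  have e0' : 0 < (e%:C : C) by rewrite -(rmorph0 (real_complex R)) ltcR.
  by apply: filterS (h _ e0') => x hx; rewrite -ltcR -Defs.normcE; exact: hx.
have e0' : 0 < complex.Re e by move: e0; rewrite ltcE => /andP[].
apply: filterS (h _ e0') => x hx; rewrite Defs.normcE.
by move: e0; rewrite !ltcE /= => /andP[/eqP -> _]; rewrite eqxx.
Qed.

Lemma cvg_real_complex (T : Type) (F : set_system T) {FF : Filter F}
    (f : T -> R) (l : R) :
  f @ F --> l -> (fun x => (f x)%:C : C) @ F --> (l%:C : C).
Proof.
move=> /cvgrPdist_lt fl; apply/cvg_normcP => e /fl; apply: filterS => x.
by rewrite -rmorphB normc_real.
Qed.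

Lemma cvg_normc (T : Type) (F : set_system T) {FF : Filter F}
    (f : T -> C) (l : C) :
  f @ F --> l -> (fun x => normc (f x)) @ F --> normc l.
Proof.
move=> /cvg_normcP fl; apply/cvgrPdist_lt => e /fl; apply: filterS => x.
apply: le_lt_trans; rewrite ler_norml lerNl opprB !lerBlDr; apply/andP; split.
  by rewrite -[X in normc X <= _](subrK l) normcB ler_normcD.
by rewrite -[X in normc X <= _](subrK (f x)) ler_normcD.
Qed.

End complex_limits.

(** * Bounded sets and continuous functionals *)

Section functionals.
Variables (R : realType).
Local Notation C := (Cplx R).

Lemma nbhs_normcP (z : C) (W : set C) : nbhs z W <->
  exists2 e : R, 0 < e & forall w, normc (z - w) < e -> W w.
Proof.
split=> [/nbhs_ballP[e e0 eW]|[e e0 eW]].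
  have e0' : 0 < complex.Re e by move: e0; rewrite /= ltcE => /andP[].
  exists (complex.Re e) => // w zw; apply: eW;
      rewrite -ball_normE /= Defs.normcE.
  by move: e0; rewrite /= !ltcE /= => /andP[/eqP -> _]; rewrite eqxx.
apply/nbhs_ballP; exists (e%:C : C).
  by rewrite /= -(rmorph0 (real_complex R)) ltcR.
move=> w; rewrite -ball_normE /= => zw; apply: eW.
by rewrite -ltcR -Defs.normcE.
Qed.

Lemma open_normc_lt (e : R) : open [set w : C | normc w < e].
Proof.
rewrite openE => z /= ze; apply/nbhs_normcP; exists (e - normc z);
    first by rewrite subr_gt0.
move=> w; rewrite ltrBrDr => zw /=; apply: le_lt_trans zw.
by rewrite -[X in normc X <= _](subrK z) (normcB z); exact: ler_normcD.
Qed.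

Variable E : lmodType C.

Lemma vn_bounded_inv (tau : set (set E)) (B : set E) :
  (forall U, tau U -> U 0 -> exists2 r : R, 0 < r &
    forall (a : C) x, r <= normc a -> B x -> U (a^-1 *: x)) ->
  vn_bounded tau B.
Proof.
move=> h U tU U0; have [r r0 rU] := h U tU U0; exists r => // a ra x Bx.
exists (a^-1 *: x); first exact: rU.
rewrite scalerA mulfV ?scale1r//; apply: contraTneq ra => ->.
by rewrite normc0 -ltNge.
Qed.

(** A neighbourhood of 0 involves only finitely many seminorms, so the sum of
    the bounds for these gives one dilation factor that serves all of them. *)
Lemma seminorm_topology_bounded (P : set (E -> R)) (B : set E) :
  (forall s, P s -> is_seminorm s) ->
  (forall s, P s -> exists M : R, forall x, B x -> s x <= M) ->
  vn_bounded (seminorm_topology P) B.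
Proof.
move=> sP PB; apply: vn_bounded_inv => U tU U0.
have [m [s [e [sPi e0 sU]]]] := tU 0 U0.
have /choice[M MP] i := PB _ (sPi i).
pose M1 := 1 + \sum_i `|M i|.
have M1_gt0 : 0 < M1 by rewrite ltr_wpDr// sumr_ge0.
have M1P i : M i < M1.
  rewrite /M1 (bigD1 i)//= addrCA (le_lt_trans (ler_norm _))// ltrDl.
  by rewrite ltr_wpDr// sumr_ge0.
exists (M1 / e); first by rewrite divr_gt0.
move=> a x ha Bx; have na0 :
    0 < normc a by rewrite (lt_le_trans _ ha)// divr_gt0.
apply: sU => i; rewrite subr0; have [_ sZ] := sP _ (sPi i).
apply: le_lt_trans (sZ _ _) _; rewrite normcV mulrC ltr_pdivrMr//.
apply: le_lt_trans (MP i x Bx) _; apply: lt_le_trans (M1P i) _.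
by move: ha; rewrite ler_pdivrMr// mulrC.
Qed.

(** The vector x is divided by N x + e / (M + 1), which is positive even where
    N x = 0; letting e tend to 0 gives the bound. *)
Lemma homogeneous_bound (b N : E -> R) (S : set E) M : is_seminorm b ->
    is_seminorm N ->
  (forall (a : C) x, S x -> S (a *: x)) -> 0 <= M ->
  (forall x, S x -> N x <= 1 -> b x <= M) -> forall x, S x -> b x <= M * N x.
Proof.
move=> [_ bZ] sN SZ M0 h x Sx; apply/ler_addgt0Pr => e e0.
have M1 : 0 < M + 1 by rewrite ltr_wpDl.
set t := N x + e / (M + 1); have d0 : 0 < e / (M + 1) by rewrite divr_gt0.
have t0 : 0 < t by rewrite ltr_wpDl// seminorm_ge0.
have tx : x = t%:C *: ((t%:C : C)^-1 *: x).
  by rewrite scalerA mulfV ?scale1r//; apply: contraTneq t0 => -[->];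
      rewrite ltxx.
rewrite tx; apply: le_trans (bZ _ _) _; rewrite normc_real gtr0_norm//.
have -> : M * N (t%:C *: ((t%:C : C)^-1 *: x)) = M * N x by rewrite -tx.
apply: (@le_trans _ _ (t * M)).
  rewrite ler_pM2l//; apply: h; first exact: SZ.
  case: (sN) => _ /(_ (t%:C : C)^-1 x) /le_trans; apply.
  by rewrite normcV_real// mulrC ler_pdivrMr// mul1r lerDl ltW.
rewrite mulrC mulrDr lerD2l mulrCA -[leRHS]mulr1 ler_pM2l//.
by rewrite ler_pdivrMr// mul1r lerDl.
Qed.

Lemma normc_seminorm (L : E -> C) : scalar L ->
    is_seminorm (fun x => normc (L x)).
Proof.
move=> lL; have L0 : L 0 = 0.
  apply: (@addrI C (L 0)); have := lL 1 0 0.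
  by rewrite scale1r (@mul1r C) addr0 => <-; rewrite (@addr0 C).
split=> [x y|a x].
  by have := lL 1 x y; rewrite scale1r (@mul1r C) => ->; exact: ler_normcD.
by have := lL a x 0; rewrite addr0 L0 (@addr0 C) => ->; rewrite normcM.
Qed.

(** Every measure constructed below is given by such estimates on the steps. *)
Lemma continuous_functional_limit (N : E -> R) steps (L : E -> C) : scalar L ->
  is_seminorm N ->
  (forall S, steps S -> exists M, forall x, S x -> normc (L x) <= M * N x) ->
  continuous_functional (inductive_limit_topology N steps) L.
Proof.
move=> lL sN bL W oW x Wx.
have /nbhs_normcP[e e0 eW] : nbhs (L x) W by exact: open_nbhs_nbhs.
exists [set y | normc (L y) < e]; split.
- exact/seminorm_ball_convex/normc_seminorm.
- move=> S /bL[M LM]; have M0 : 0 < `|M| + 1 by rewrite ltr_wpDl.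
  exists (e / (`|M| + 1)); first by rewrite divr_gt0.
  move=> y Sy; rewrite ltr_pdivlMr// => Ny /=; apply: le_lt_trans (LM _ Sy) _.
  apply: le_lt_trans Ny; rewrite mulrC ler_wpM2l ?seminorm_ge0//.
  by rewrite (le_trans (ler_norm _))// lerDl.
- move=> y /= Ly; apply: eW; rewrite -normcN.
  have := lL 1 x y; rewrite scale1r (@mul1r C) => ->.
  by rewrite opprB addrAC subrr add0r.
Qed.

Lemma normc_scaled_functional (L : E -> C) (e : R) x : scalar L -> 0 < e ->
  normc (L ((e / 2)%:C *: x)) < 1 -> normc (L x) <= 2 / e.
Proof.
move=> lL e0; have L0 : L 0 = 0.
  by apply: eq0_normc; exact: seminorm0 (normc_seminorm lL).
have -> : L ((e / 2)%:C *: x) = (e / 2)%:C * L x.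
  by have := lL (e / 2)%:C x 0; rewrite addr0 L0 (@addr0 C).
rewrite normcM normc_real gtr0_norm ?divr_gt0//.
by rewrite ler_pdivlMr// mulrAC ltr_pdivrMr// mul1r mulrC => /ltW.
Qed.

Lemma seminorm_half_lt (s : E -> R) (e : R) x : is_seminorm s -> 0 < e ->
  s x <= 1 -> s ((e / 2)%:C *: x) < e.
Proof.
move=> [_ sZ] e0 sx; apply: le_lt_trans (sZ _ _) _.
rewrite normc_real gtr0_norm ?divr_gt0// (@le_lt_trans _ _ (e / 2))//.
  by rewrite ler_piMr// divr_ge0// ltW.
by rewrite ltr_pdivrMr// ltr_pMr// ltr1n.
Qed.

(** The preimage of the unit disc meets the step in a neighbourhood of 0, and
    a linear functional that is bounded by 1 on the ball of radius e/2 is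
    bounded by 2/e on the unit ball. *)
Lemma limit_functional_bound (N : E -> R) steps (L : E -> C) S : scalar L ->
  is_seminorm N -> continuous_functional (inductive_limit_topology N steps) L ->
  steps S -> (forall (a : C) x, S x -> S (a *: x)) ->
  exists2 M, 0 <= M & forall x, S x -> normc (L x) <= M * N x.
Proof.
move=> lL sN cL sS SZ.
have sL := normc_seminorm lL.
have [|V [_ sV VU]] := cL _ (@open_normc_lt 1) 0.
  by rewrite /= (seminorm0 sL).
have [e e0 eV] := sV S sS; exists (2 / e); first by rewrite divr_ge0// ltW.
apply: homogeneous_bound => //; first by rewrite divr_ge0// ltW.
move=> x Sx Nx; apply: normc_scaled_functional => //.
rewrite -[_ *: x]add0r; apply: VU; apply: eV; first exact: SZ.
exact: seminorm_half_lt.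
Qed.

(** The preimage of the unit disc contains a ball of finitely many seminorms. *)
Lemma seminorm_functional_bound (P : set (E -> R)) (L : E -> C) : scalar L ->
  (forall s, P s -> is_seminorm s) ->
  continuous_functional (seminorm_topology P) L ->
  exists m (s : 'I_m -> E -> R) (M : R), [/\ forall i, P (s i), 0 < M &
    forall x, (forall i, s i x <= 1) -> normc (L x) <= M].
Proof.
move=> lL sP cL; have sL := normc_seminorm lL.
have [|m [s [e [sPi e0 sU]]]] := cL _ (@open_normc_lt 1) 0.
  by rewrite /= (seminorm0 sL).
exists m, s, (2 / e); split; rewrite ?divr_gt0// => x sx.
apply: normc_scaled_functional => //; apply: sU => i; rewrite subr0.
by apply: seminorm_half_lt => //; exact: sP.
Qed.

Lemma continuous_functional_seminorm (P : set (E -> R)) (L : E -> C) s M :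
    scalar L ->
  P s -> is_seminorm s -> (forall x, normc (L x) <= M * s x) ->
  continuous_functional (seminorm_topology P) L.
Proof.
move=> lL Ps ss bL W oW x Wx.
have /nbhs_normcP[e e0 eW] : nbhs (L x) W by exact: open_nbhs_nbhs.
have M0 : 0 < `|M| + 1 by rewrite ltr_wpDl.
exists 1%N, (fun=> s), (e / (`|M| + 1)); split; rewrite ?divr_gt0//.
move=> y /(_ ord0); rewrite ltr_pdivlMr// => Ny /=; apply: eW.
have := lL (-1) x y; rewrite scaleN1r (@mulN1r C) [_ + y]addrC => Lyx.
rewrite normcB -[L y - L x]/(L y + - L x) (@addrC C) -Lyx.
apply: le_lt_trans (bL _) _.
apply: le_lt_trans Ny; rewrite mulrC ler_wpM2l ?seminorm_ge0//.
by rewrite (le_trans (ler_norm _))// lerDl.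
Qed.

Lemma seminorm_bounded (P : set (E -> R)) (B : set E) s : P s ->
    is_seminorm s ->
  vn_bounded (seminorm_topology P) B -> exists M : R, forall x, B x -> s x <= M.
Proof.
move=> Ps sp bB.
have [||r r0 rB] := bB [set x | s x < 1].
- move=> x /= px.
  exists 1%N, (fun=> s), (1 - s x); split => //.
  + by rewrite subr_gt0.
  + move=> y /(_ ord0); rewrite ltrBrDr => h; apply: le_lt_trans h;
      case: sp => + _.
    by move=> /(_ (y - x) x); rewrite subrK.
- by rewrite /= (seminorm0 sp).
exists r => // x Bx; have [|u pu <-] := rB r%:C _ x Bx.
  by rewrite normc_real ger0_norm// ltW.
case: (sp) => _ /(_ r%:C u) /le_trans; apply.
by rewrite normc_real gtr0_norm// ler_piMr ?(ltW r0) ?(ltW pu).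
Qed.

Variables (F : Type) (b : E -> F -> C).
Hypothesis lb : forall g, scalar (b ^~ g).

Lemma uniform_topology_bounded (Bs : set (set F)) (B : set E) :
  (forall D, Bs D -> exists M : R, forall x g, B x -> D g -> normc (b x g) <= M)
      ->
  vn_bounded (uniform_convergence_topology b Bs) B.
Proof.
move=> bB; apply: vn_bounded_inv => U tU U0.
have [D [e [BD e0 DU]]] := tU 0 U0.
have [M MP] := bB D BD; have M1 : 0 < `|M| + 1 by rewrite ltr_wpDl.
exists ((`|M| + 1) / e); first by rewrite divr_gt0.
move=> a x ha Bx; have na0 :
    0 < normc a by rewrite (lt_le_trans _ ha)// divr_gt0.
apply: DU => g Dg; rewrite subr0.
have [_ bZ] := normc_seminorm (lb g); apply: le_lt_trans (bZ _ _) _.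
rewrite normcV mulrC ltr_pdivrMr//; apply: le_lt_trans (MP x g Bx Dg) _.
apply: (@lt_le_trans _ _ (`|M| + 1));
    first by rewrite (le_lt_trans (ler_norm _))// ltrDl.
by move: ha; rewrite ler_pdivrMr// mulrC.
Qed.

(** The vectors whose pairings with D stay below some s < 1 form an open set,
    because 1 - s leaves room for a perturbation; B lies in a multiple of it. *)
Lemma uniform_topology_bound (Bs : set (set F)) (B : set E) D :
  vn_bounded (uniform_convergence_topology b Bs) B -> Bs D ->
  exists M : R, forall x g, B x -> D g -> normc (b x g) <= M.
Proof.
move=> bB BD.
have [||r r0 rB] :=
    bB [set x | exists2 s : R, s < 1 & forall g, D g -> normc (b x g) <= s].
- move=> x [s s1 xs]; exists D, ((1 - s) / 2); split => //.
    by rewrite divr_gt0// subr_gt0.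
  move=> y yx; exists (s + (1 - s) / 2); first by lra.
  move=> g Dg; have [bD _] := normc_seminorm (lb g).
  have := bD (y - x) x; rewrite subrK addrC => /le_trans; apply.
  by rewrite lerD ?xs// ltW// yx.
- exists 0 => // g _; by rewrite (seminorm0 (normc_seminorm (lb g))).
exists r => x g Bx Dg; have [|u [s s1 us] <-] := rB r%:C _ x Bx.
  by rewrite normc_real ger0_norm// ltW.
have [_ /(_ r%:C u)] := normc_seminorm (lb g) => /le_trans; apply.
rewrite normc_real gtr0_norm// ler_piMr ?(ltW r0)//.
by rewrite (le_trans (us g Dg))// ltW.
Qed.

End functionals.

(** * Weights generating an inductive limit topology *)

Section weight_systems.
Variables (R : realType) (E : lmodType (Cplx R)).
Local Notation C := (Cplx R).

(** The common structure of the three spaces: N is the norm that the steps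
    carry and p the family of weighted norms.  The field ws_split is what a
    partition of unity provides: x is cut into pieces that lie in fixed steps,
    and a large enough weight makes the j-th piece as small in N as the
    prescribed d j asks. *)
Record weight_system (N : E -> R) (steps : set (set E)) (I : Type)
    (p : I -> E -> R) : Prop := WeightSystem {
  ws_norm : is_seminorm N;
  ws_weight : forall i, is_seminorm (p i);
  ws_scale : forall S, steps S -> forall a x, S x -> S (a *: x);
  ws_zero : forall S, steps S -> S 0;
  ws_bound : forall i S, steps S -> exists M, forall x, S x -> p i x <= M * N x;
  ws_split : exists2 S : nat -> set E, forall j, steps (S j) &
    forall d : nat -> R, (forall j, 0 < d j) -> exists i, forall x,
      exists J (y : 'I_J -> E), x = \sum_j y j /\
        forall j : 'I_J, S j (y j) /\ N (y j) <= d j * p i x }.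

Variables (N : E -> R) (steps : set (set E)) (I : Type) (p : I -> E -> R).
Hypothesis W : weight_system N steps p.

(** The set V contains the ball of some radius e j in the j-th step.  For
    d j = e j / 2^(j+1), a vector x with p i x < 1 has pieces y j with
    2^(j+1) y j in V, and x is the combination of these vectors with the
    coefficients 2^-(j+1), whose sum is less than 1. *)
Lemma weight_absorb (V : set E) : absolutely_convex V ->
  (forall S, steps S -> exists2 e : R, 0 < e & forall y, S y -> N y < e -> V y)
      ->
  exists i, forall x, p i x < 1 -> V x.
Proof.
move=> cV sV; have [S sS split] := ws_split W.
have /choice[e eP] j : exists e, 0 < e /\ forall y, S j y -> N y < e -> V y.
  by have [e e0 eV] := sV _ (sS j); exists e.
pose d j : R := e j / 2 ^+ j.+1.
have d0 j : 0 < d j by rewrite divr_gt0// ?exprn_gt0//; case: (eP j).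
have [i iP] := split d d0; exists i => x px.
have [J [y [xE yP]]] := iP x.
have V0 : V 0.
  case: (eP 0%N) => e0; apply; first exact: (ws_zero W).
  by rewrite (seminorm0 (ws_norm W)).
have -> : x =
    \sum_(j < J) (((2^-1 : R) ^+ j.+1)%:C : C) *: (((2 : R) ^+ j.+1)%:C *: y j).
  rewrite xE; apply: eq_bigr => j _; rewrite scalerA -rmorphM/= -exprMn mulVf//.
  by rewrite expr1n scale1r.
apply: absolutely_convex_sum => //.
  move=> j; have [Sy Ny] := yP j; case: (eP j) => ej h; apply: h.
    exact: ws_scale W _ (sS j) _ _ Sy.
  have [_ NZ] := ws_norm W; apply: le_lt_trans (NZ _ _) _.
  rewrite normc_real ger0_norm ?exprn_ge0// -ltr_pdivlMl ?exprn_gt0//.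
  by apply: le_lt_trans Ny _; rewrite [ltRHS]mulrC gtr_pMr.
have -> : \sum_(j < J) normc ((2^-1 ^+ j.+1)%:C : C) = 1 - 2^-1 ^+ J.
  elim: J {y yP xE} => [|J IH]; first by rewrite big_ord0 expr0 subrr.
  rewrite big_ord_recr IH normc_real ger0_norm//= exprS.
  by field.
by rewrite gerBl.
Qed.

(** The ball of a weighted norm is itself one of the absolutely convex sets that
    define the inductive limit topology, since on each step the weight is
    bounded. *)
Lemma weight_open i x e : 0 < e ->
  exists V, [/\ absolutely_convex V,
    forall S, steps S -> exists2 d : R, 0 < d & forall y, S y -> N y < d ->
        V y &
    forall y, V y -> p i (x + y - x) < e].
Proof.
move=> e0; exists [set y | p i y < e]; split.
- exact/seminorm_ball_convex/(ws_weight W).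
- move=> S sS; have [M pM] := ws_bound W i sS.
  have M0 : 0 < `|M| + 1 by rewrite ltr_wpDl.
  exists (e / (`|M| + 1)); first by rewrite divr_gt0.
  move=> y Sy; rewrite ltr_pdivlMr// => Ny /=; apply: le_lt_trans (pM _ Sy) _.
  apply: le_lt_trans Ny;
      rewrite mulrC ler_wpM2l ?(seminorm_ge0 _ (ws_norm W))//.
  by rewrite (le_trans (ler_norm _))// lerDl.
- by move=> y /=; rewrite addrAC subrr add0r.
Qed.

Theorem weight_topology : inductive_limit_topology N steps =
  seminorm_topology [set p i | i in [set: I]].
Proof.
apply/seteqP; split=> U tU x Ux.
  have [V [cV sV VU]] := tU x Ux; have [i iV] := weight_absorb cV sV.
  exists 1%N, (fun=> p i), 1; split => // y /(_ ord0) py.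
  by rewrite -[y](subrK x) addrC; apply: VU; exact: iV.
have [m [s [e [sP e0 sU]]]] := tU x Ux.
have /choice[i iP] j : exists i, s j = p i by have [i _ <-] := sP j; exists i.
have /choice[V VP] j := weight_open (i j) x e0.
exists [set y | forall j, V j y]; split.
- by move=> y z Vy Vz a b ab j; case: (VP j) => cV _ _; apply: cV.
- move=> S sS.
  have /choice[d dP] j : exists d, 0 < d /\ forall y, S y -> N y < d -> V j y.
    by case: (VP j) => _ /(_ S sS)[d d0 dV] _; exists d.
  exists (\big[Num.min/1]_j d j).
    by apply: lt_bigmin => // j _; case: (dP j).
  move=> y Sy Ny j; case: (dP j) => _; apply => //.
  by apply: lt_le_trans Ny _; exact: bigmin_le_cond.
- move=> y Vy; apply: sU => j; rewrite iP; case: (VP j) => _ _; apply.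
  exact: Vy.
Qed.

(** The second premise makes the polar of a bounded set a neighbourhood of 0 in
    every step.  The third one says that the unit ball of a weighted norm
    contains a multiple of the polar of a bounded set, and such balls are small
    enough by weight_absorb. *)
Theorem weight_beta (F : lmodType C) (b : E -> F -> C) (tauF : set (set F)) :
  (forall g, scalar (b ^~ g)) ->
  (forall B S, vn_bounded tauF B -> steps S ->
    exists M, forall x g, S x -> B g -> normc (b x g) <= M * N x) ->
  (forall i, exists2 B, vn_bounded tauF B & exists2 M : R, 0 < M &
    forall x, (forall g, B g -> normc (b x g) < M) -> p i x < 1) ->
  beta_topology b tauF = inductive_limit_topology N steps.
Proof.
move=> lb hB hp.
have bD x y g : b (x + y) g = b x g + b y g.
  by have := lb g 1 x y; rewrite scale1r (@mul1r C).
have bZ a x g : b (a *: x) g = a * b x g.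
  have b0 : b 0 g = 0.
    by apply: (@addrI _ (b 0 g)); rewrite -bD !addr0.
  by have := lb g a x 0; rewrite addr0 b0 => ->; rewrite (@addr0 C).
apply/seteqP; split=> U tU x Ux.
  have [B [e [bB e0 BU]]] := tU x Ux.
  exists [set y | forall g, B g -> normc (b y g) <= e / 2]; split.
  - apply: seminorm_closed_ball_convex; last by rewrite divr_ge0// ltW.
    move=> g _; split=> [y z|a y]; first by rewrite bD; exact: ler_normcD.
    by rewrite bZ normcM.
  - move=> S sS; have [M bM] := hB B S bB sS.
    have M0 : 0 < `|M| + 1 by rewrite ltr_wpDl.
    exists (e / 2 / (`|M| + 1)); first by rewrite !divr_gt0.
    move=> y Sy; rewrite ltr_pdivlMr// => Ny /= g Bg.
    apply: le_trans (bM _ _ Sy Bg) _; apply: le_trans (ltW Ny).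
    rewrite mulrC ler_wpM2l ?(seminorm_ge0 _ (ws_norm W))//.
    by rewrite (le_trans (ler_norm _))// lerDl.
  - move=> y Vy; apply: BU => g Bg; rewrite addrAC subrr add0r.
    by apply: le_lt_trans (Vy g Bg) _;
        rewrite ltr_pdivrMr// mulr_natr mulr2n ltrDl.
have [V [cV sV VU]] := tU x Ux; have [i iV] := weight_absorb cV sV.
have [B bB [M M0 BM]] := hp i.
exists B, M; split => // y yB; rewrite -[y](subrK x) addrC.
by apply: VU; apply: iV; exact: BM.
Qed.

End weight_systems.

(** * Flat functions and smooth bumps *)

Section flat_functions.
Variable R : realType.
Implicit Types (P : {poly R}) (t : R).

(** The functions P(1/t) exp(-1/t), extended by 0.  The factor P makes the class
    stable under differentiation. *)
Definition flat P t : R := if 0 < t then P.[t^-1] * expR (- t^-1) else 0.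

Lemma flat1_ge0 t : 0 <= flat 1 t.
Proof. by rewrite /flat; case: ifP => // _; rewrite !hornerE expR_ge0. Qed.

Lemma flat1_gt0 t : (0 < flat 1 t) = (0 < t).
Proof. by rewrite /flat; case: ifP => _; rewrite ?ltxx// !hornerE expR_gt0. Qed.

Lemma horner_bound P s : 1 <= s ->
  `|P.[s]| <= (\sum_(i < size P) `|P`_i|) * s ^+ size P.
Proof.
move=> s1; rewrite horner_coef (le_trans (ler_norm_sum _ _ _))// mulr_suml.
apply: ler_sum => i _;
    rewrite normrM ler_wpM2l// normrX ger0_norm ?(le_trans _ s1)//.
by rewrite ler_weXn2l// ltnW.
Qed.

(** With m greater than the degree of P, exp s = exp (s/m) ^ m >= (s/m) ^ m at
    s = 1/t, which beats P s and leaves one factor t. *)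
Lemma flat_le P : exists M, forall t, t <= 1 -> `|flat P t| <= M * `|t|.
Proof.
set m := (size P).+1.
exists ((\sum_(i < size P) `|P`_i|) * m%:R ^+ m) => t t1; rewrite /flat.
case: ifPn => t0; last by rewrite normr0 !mulr_ge0 ?exprn_ge0// sumr_ge0.
have s1 : 1 <= t^-1 by rewrite invf_ge1.
have s0 : 0 < t^-1 by rewrite invr_gt0.
rewrite normrM (ger0_norm (expR_ge0 _)) (gtr0_norm t0).
apply: (le_trans (ler_wpM2r (expR_ge0 _) (horner_bound P s1))).
rewrite -!mulrA ler_wpM2l ?sumr_ge0// expRN ler_pdivrMr ?expR_gt0// -mulrA.
have -> : t^-1 ^+ size P = t * t^-1 ^+ m by rewrite exprS mulrA mulfV ?mul1r
    ?gt_eqF.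
rewrite [leRHS]mulrCA ler_pM2l//.
have -> : t^-1 = m%:R * (t^-1 / m%:R) by field; rewrite ?(gt_eqF t0) ?pnatr_eq0.
rewrite expRM_natl exprMn ler_pM2l ?exprn_gt0//.
rewrite lerXn2r ?nnegrE ?expR_ge0// ?divr_ge0 ?(ltW s0)//.
by rewrite (le_trans _ (expR_ge1Dx _))// lerDr.
Qed.

(** The chain rule for t |-> 1/t contributes the factor X^2 at X = 1/t. *)
Definition flat' P : {poly R} := 'X^2 * (P - P^`()).

Lemma is_derive_flat P t : is_derive t 1 (flat P) (flat (flat' P) t).
Proof.
have [t0|t0|->] := ltgtP t 0.
- apply: (@near_eq_is_derive _ _ _ (cst 0)).
    near=> s; rewrite /flat ifF//; apply: negbTE; rewrite -leNgt ltW//.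
    by near: s; exact: lt_nbhsl.
  by rewrite /flat ifF ?(lt_gtF t0)//; exact: is_derive_cst.
- apply: (@near_eq_is_derive R R^o R^o (fun s : R => P.[s^-1] * expR (- s^-1))).
    near=> s; rewrite /flat ifT//.
    by near: s; exact: lt_nbhsr.
  have dV : is_derive t 1 (fun s : R => s^-1) (- t ^- 2).
    have t1 : (id t : R) != 0 by rewrite gt_eqF.
    apply: is_derive_eq (is_deriveV t1 (is_derive_id t 1)) _.
    by rewrite /GRing.scale/= mulr1.
  have dP := is_derive1_comp (is_derive_poly P t^-1) dV.
  have dN : is_derive t 1 (fun s : R => - s^-1) (t ^- 2).
    by rewrite -[t ^- 2]opprK; exact: is_deriveN.
  have dE := @is_derive1_comp _ expR (fun s : R => - s^-1) _ _ _
      (is_derive_expR (- t^-1)) dN.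
  have := is_deriveM dP dE; rewrite /= => /is_derive_eq; apply.
  rewrite /flat t0 /flat' !hornerE/= /GRing.scale/= exprVn. ring.
(* The difference quotient of flat P at 0 is flat ('X * P). *)
- rewrite {2}/flat ltxx; apply/is_derive1_caratheodory.
  exists (flat ('X * P)); split; last by rewrite /flat ltxx.
    move=> z; rewrite !subr0 {2}/flat ltxx subr0 /flat; case: ifPn => z0.
      by rewrite !hornerE; field; rewrite gt_eqF.
    by rewrite mul0r.
  have [M hM] := flat_le ('X * P); have f0 :
      flat ('X * P) 0 = 0 by rewrite /flat ltxx.
  rewrite /prop_for /continuous_at f0.
  apply/cvgr0Pnorm_lt => e e0; near=> z.
  have z1 : z <= 1 by apply: ltW; near: z; apply: lt_nbhsl; exact: ltr01.
  apply: (le_lt_trans (hM z z1)); apply: (@le_lt_trans _ _ ((`|M| + 1) * `|z|)).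
    by rewrite ler_wpM2r// (le_trans (ler_norm _))// lerDl.
  rewrite -ltr_pdivlMl ?ltr_wpDl// mulrC; near: z.
  have h0 : 0 < e / (`|M| + 1) by rewrite divr_gt0// ltr_wpDl.
  exact: (@nbhs0_lt R R^o _ h0).
Unshelve. all: by end_near. Qed.

Lemma continuous_flat P : continuous (flat P).
Proof.
move=> t; apply: differentiable_continuous; apply/derivable1_diffP.
by case: (is_derive_flat P t).
Qed.

End flat_functions.

Section flat_algebra.
Variables (R : realType) (n : nat).
Local Notation X := 'rV[R]_n.

Lemma is_derive_line (f : X -> R) x v df :
  is_derive (0 : R) 1 (fun h : R => f (h *: v + x)) df -> is_derive x v f df.
Proof.
have E : (fun h :
    R => h^-1 *: (((fun h : R => f (h *: v + x)) \o shift 0) (h *: (1:R)) - f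
    (0 *: v + x))) =
   (fun h : R => h^-1 *: ((f \o shift x) (h *: v) - f x)).
  by apply/funext => h /=; rewrite scale0r add0r addr0 -[h *: 1]/(h * 1) mulr1.
by case; rewrite /derivable /derive E => d1 d2; split.
Qed.

(** The algebra generated by the flat functions of affine functions of one
    coordinate.  Its members are continuous and its partial derivatives stay in
    it, so all of them are smooth; it contains bumps supported in boxes. *)
Inductive flat_alg : (X -> R) -> Prop :=
| flat_coord P a b i : flat_alg (fun x => flat P (a + b * x ord0 i))
| flat_cst c : flat_alg (fun=> c)
| flat_add f g : flat_alg f -> flat_alg g -> flat_alg (f + g)
| flat_mul f g : flat_alg f -> flat_alg g -> flat_alg (f * g).

Lemma continuous_flat_alg f : flat_alg f -> continuous f.
Proof.
elim=> {f} [P a b i|c|f g _ cf _ cg|f g _ cf _ cg] x.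
- apply: (@continuous_comp _ _ _ (fun x : X => a + b * x ord0 i) (flat P)).
    apply: (@continuousD R R^o X (cst a)); first exact: cst_continuous.
    apply: continuousM; first exact: cst_continuous.
    exact: coord_continuous.
  exact: continuous_flat.
- exact: cst_continuous.
- by apply: (@continuousD R R^o X f g); [exact: cf|exact: cg].
- by apply: continuousM; [exact: cf|exact: cg].
Qed.

Lemma is_derive_flat_alg f : flat_alg f -> forall j, exists2 g,
  flat_alg g & forall x, is_derive x (delta_mx ord0 j) f (g x).
Proof.
elim=> {f} [P a b i|c|f g sf IHf sg IHg|f g sf IHf sg IHg] j.
- pose v : X := delta_mx ord0 j.
  exists ((fun=> b * v ord0 i) * (fun x => flat (flat' P) (a + b * x ord0 i))).
    by apply: flat_mul; [exact: flat_cst|exact: flat_coord].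
  move=> x; apply: is_derive_line.
  have d1 : is_derive (0 : R) 1
      (fun h : R => (a + b * x ord0 i) + (b * v ord0 i) * h) (b * v ord0 i).
    have := is_deriveD (is_derive_cst (a + b * x ord0 i) (0 : R) 1)
      (is_deriveZ (b * v ord0 i) (is_derive_id (0 : R) 1)).
    by rewrite add0r -[_ *: 1]/(_ * 1) mulr1.
  have d2 := is_derive1_comp (is_derive_flat P _) d1.
  have -> : (fun h : R => flat P (a + b * (h *: delta_mx ord0 j + x) ord0 i)) =
      flat P \o (fun h : R => (a + b * x ord0 i) + (b * v ord0 i) * h).
    by apply/funext => h /=; rewrite !mxE; congr flat; ring.
  by apply: is_derive_eq d2 _; rewrite /= mulr0 addr0 mulrC.
- exists (fun=> 0); first exact: flat_cst.
  by move=> x; exact: is_derive_cst.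
- have [f' sf' df] := IHf j; have [g' sg' dg] := IHg j.
  exists (f' + g'); first exact: flat_add.
  by move=> x; exact: is_deriveD.
- have [f' sf' df] := IHf j; have [g' sg' dg] := IHg j.
  exists (f * g' + g * f'); first by apply: flat_add; apply: flat_mul.
  by move=> x; exact: is_deriveM.
Qed.

Lemma flat_alg_prod (I : Type) (r : seq I) (f : I -> X -> R) :
  (forall i, flat_alg (f i)) -> flat_alg (fun x => \prod_(i <- r) f i x).
Proof.
move=> sf; elim: r => [|i r IH].
  by under eq_fun do rewrite big_nil; exact: flat_cst.
under eq_fun do rewrite big_cons; exact: (@flat_mul (f i) _ _ IH).
Qed.

Lemma flat_alg_sum (I : Type) (r : seq I) (f : I -> X -> R) :
  (forall i, flat_alg (f i)) -> flat_alg (fun x => \sum_(i <- r) f i x).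
Proof.
move=> sf; elim: r => [|i r IH].
  by under eq_fun do rewrite big_nil; exact: flat_cst.
under eq_fun do rewrite big_cons; exact: (@flat_add (f i) _ _ IH).
Qed.

Lemma partials_flat_alg js f : flat_alg f -> flat_alg (partials js f).
Proof.
move=> sf; elim: js => //= j js IH; have [g sg dg] := is_derive_flat_alg IH j.
suff -> : 'D_(delta_mx ord0 j) (partials js f) = g by [].
by apply/funext => x; case: (dg x).
Qed.

Lemma near_partials js (f g : X -> R) (x : X) : {near x, f =1 g} ->
  {near x, partials js f =1 partials js g}.
Proof.
move=> fg; elim: js => //= j js IH.
apply: filterS (near_join IH) => y IHy; exact: near_eq_derive.
Qed.

(** Iterated partial derivatives at x depend only on the germ at x.  This makes
    locally finite sums of members of the algebra smooth. *)
Lemma smooth_in_near (Omega : set X) (phi : X -> R) :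
  (forall x, Omega x -> exists2 f, flat_alg f & {near x, phi =1 f}) ->
  smooth_in Omega phi.
Proof.
move=> H js x Ox; have [f sf phif] := H x Ox.
have e := near_partials js phif; have sp := partials_flat_alg js sf.
have ex := nbhs_singleton e.
have e' : {near x, partials js f =1 partials js phi} by apply: filterS e.
split.
  rewrite /prop_for /continuous_at ex; apply: cvg_trans (near_eq_cvg e') _.
  exact: continuous_flat_alg.
move=> j; have [g _ dg] := is_derive_flat_alg sp j.
by have [] := near_eq_is_derive e' (dg x).
Qed.

(** Positive exactly on the ball of centre c and radius r, which is a box since
    the norm of row vectors is the maximum norm. *)
Definition box_bump (c : X) (r : R) (x : X) : R :=
  \prod_(i < n) (flat 1 (r - c ord0 i + 1 * x ord0 i) *
                 flat 1 (r + c ord0 i + (-1) * x ord0 i)).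

Lemma flat_alg_box_bump c r : flat_alg (box_bump c r).
Proof. by apply: flat_alg_prod => i; apply: flat_mul; exact: flat_coord. Qed.

Lemma box_bump_ge0 c r x : 0 <= box_bump c r x.
Proof. by apply: prodr_ge0 => i _; rewrite mulr_ge0// flat1_ge0. Qed.

Lemma box_bump_gt0 c r x : 0 < r -> (0 < box_bump c r x) <-> ball c r x.
Proof.
move=> r0; split=> [|[_ cx]].
  move=> b0; split=> // a i; rewrite (ord1 a) /ball/= ltr_norml.
  have : box_bump c r x != 0 by rewrite gt_eqF.
  move/prodf_neq0 => /(_ i isT); rewrite mulf_eq0 negb_or.
  have flat0 t : flat (1 : {poly R}) t != 0 -> 0 < t.
    by move=> h; rewrite -flat1_gt0 lt0r h flat1_ge0.
  move=> /andP[/flat0 + /flat0]; rewrite mul1r mulN1r => h1 h2; apply/andP;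
      split; lra.
apply: prodr_gt0 => i _; have := cx ord0 i;
    rewrite /ball/= ltr_norml => /andP[h1 h2].
by rewrite mulr_gt0// flat1_gt0; lra.
Qed.

End flat_algebra.

(** * Exhaustion by compact sets and smooth majorants *)

Section exhaustion.
Variables (R : realType) (n : nat) (Omega : set 'rV[R]_n).
Local Notation X := 'rV[R]_n.

(** The distance to the complement of Omega, truncated at 1 so that it is also
    meaningful when Omega is the whole space. *)
Definition gap (x : X) : R :=
  inf ([set 1] `|` [set `|x - y| | y in ~` Omega]).

Lemma gap_has_lbound x : lbound ([set 1] `|` [set `|x - y| | y in ~` Omega]) 0.
Proof. by move=> _ [->|[y _ <-]]. Qed.

Lemma gap_ge0 x : 0 <= gap x.
Proof. by apply: lb_le_inf; [exists 1; left|exact: gap_has_lbound]. Qed.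

Lemma gap_le_dist x y : ~ Omega y -> gap x <= `|x - y|.
Proof. by move=> Oy; apply: ge_inf;
    [exists 0; exact: gap_has_lbound|right; exists y]. Qed.

Lemma gap_le1 x : gap x <= 1.
Proof. by apply: ge_inf; [exists 0; exact: gap_has_lbound|left]. Qed.

Lemma gap_lip x y : gap x <= gap y + `|x - y|.
Proof.
rewrite -lerBlDr; apply: lb_le_inf; first by exists 1; left.
move=> _ [->|[z Oz <-]]; rewrite lerBlDr.
  by rewrite (le_trans (gap_le1 _))// lerDl.
by rewrite addrC (le_trans (gap_le_dist x Oz))// ler_distD.
Qed.

Lemma continuous_gap : continuous gap.
Proof.
move=> x; apply/(@cvgrPdist_lt R R^o X (nbhs x) (nbhs_filter x)) => e e0.
apply: filterS (nbhsx_ballx x e e0) => y; rewrite -ball_normE /= => xy.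
rewrite (le_lt_trans _ xy)// ler_norml lerNl opprB !lerBlDr.
by rewrite [_ + gap y]addrC [_ + gap x]addrC gap_lip andbT distrC gap_lip.
Qed.

Hypothesis Omega_open : open Omega.

Lemma gap_gt0 x : Omega x -> 0 < gap x.
Proof.
move=> Ox; have /nbhs_ballP[e /= e0 eO] : nbhs x Omega by exact: open_nbhs_nbhs.
apply: (@lt_le_trans _ _ (Num.min 1 e)); first by rewrite lt_min ltr01.
apply: lb_le_inf; first by exists 1; left.
move=> _ [->|[y Oy <-]]; rewrite ge_min ?lexx//; apply/orP; right.
rewrite leNgt; apply/negP => xy; apply: Oy; apply: eO.
by rewrite -ball_normE.
Qed.

(** A continuous function on Omega with compact sublevel sets. *)
Definition depth (x : X) : R := `|x| + (gap x)^-1.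

Lemma depth_ge0 x : 0 <= depth x.
Proof. by rewrite addr_ge0// invr_ge0 gap_ge0. Qed.

Lemma continuous_depth x : Omega x -> {for x, continuous depth}.
Proof.
move=> Ox; apply:
    (@cvgD R R^o X (nbhs x) _ (fun x => `|x|) (fun x => (gap x)^-1));
    first exact: (@norm_continuous R X x).
by apply: cvgV; [rewrite gt_eqF// gap_gt0|exact: continuous_gap].
Qed.

(** After multiplication by gap x, the inequality depth x <= t reads
    1 <= (t - |x|) gap x.  Both sides are continuous on the whole space, and the
    inequality fails off Omega, where gap vanishes; so the set is closed. *)
Lemma compact_sublevel t : compact_in Omega [set x | Omega x /\ depth x <= t].
Proof.
split; last by move=> x [].
have -> : [set x | Omega x /\ depth x <= t] =
    (fun x => t * gap x - `|x| * gap x) @^-1` [set y | 1 <= y].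
  apply/seteqP; split=> x /=; rewrite -mulrBl.
    move=> [Ox]; rewrite /depth -lerBrDl => h.
    by rewrite -ler_pdivrMr ?gap_gt0// div1r.
  move=> h.
  have g0 : 0 < gap x.
    by rewrite lt_neqAle gap_ge0 andbT; apply: contraTneq h => <-;
        rewrite mulr0 -ltNge ltr01.
  split; last by rewrite /depth -lerBrDl -div1r ler_pdivrMr.
  apply: contrapT => nOx; have := gap_le_dist x nOx.
  by rewrite subrr normr0 leNgt g0.
apply: bounded_closed_compact.
  exists t; split; first by rewrite num_real.
  move=> M tM x /=; rewrite -mulrBl => h; apply: ltW; apply: le_lt_trans tM.
  rewrite leNgt; apply/negP => tx; move: h.
  apply/negP; rewrite -ltNge (@le_lt_trans _ _ 0)//.
  by rewrite mulr_le0_ge0 ?gap_ge0// subr_le0 ltW.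
apply: preimage_closed; last exact: closed_ge.
move=> x _; apply:
    (@cvgB R R^o X (nbhs x) _ (fun x => t * gap x) (fun x => `|x| * gap x)).
  by apply: cvgM; [exact: cvg_cst|exact: continuous_gap].
by apply: cvgM; [exact: (@norm_continuous R X)|exact: continuous_gap].
Qed.

Lemma compact_bound K (f : X -> R) : compact_in Omega K ->
  (forall x, Omega x -> {for x, continuous f}) ->
  exists J : nat, forall x, K x -> f x <= J%:R.
Proof.
move=> [cK KO] cf; have [->|K0] := eqVneq K set0; first by exists 0%N.
have cKf : {within K, continuous f}.
  by apply: continuous_in_subspaceT => x /[!inE] /KO; exact: cf.
have /set0P {}K0 := K0.
have [c _ fc] := EVT_max_rV K0 cK cKf.
exists (Num.trunc `|f c|).+1 => x Kx; apply: le_trans (fc x _) _;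
    first by rewrite inE.
by rewrite (le_trans (ler_norm _))// ltW// truncnS_gt.
Qed.

Lemma compact_lower_bound K (f : X -> R) : compact K ->
  continuous f -> (forall x, K x -> 0 < f x) ->
  exists2 d : R, 0 < d & forall x, K x -> d <= f x.
Proof.
move=> cK cf f0; have [->|K0] := eqVneq K set0; first by exists 1.
have cKf : {within K, continuous f} by apply: continuous_subspaceT.
have /set0P {}K0 := K0.
have [c /set_mem Kc fc] := EVT_min_rV K0 cK cKf.
by exists (f c); [exact: f0|move=> x Kx; apply: fc; rewrite inE].
Qed.

Lemma compact_in_depth K : compact_in Omega K ->
  exists J : nat, K `<=` [set x | Omega x /\ depth x <= J%:R].
Proof.
move=> KO; have [J HJ] := compact_bound KO continuous_depth.
by exists J => x Kx; split; [case: KO => _; apply|exact: HJ].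
Qed.

Definition shell (j : nat) : set X :=
    [set x | Omega x /\ j%:R <= depth x <= j.+1%:R].

Lemma compact_shell j : compact (shell j).
Proof.
have [cL _] := compact_sublevel j.+1%:R.
have [cM _] := compact_sublevel j%:R.
apply: (subclosed_compact _ cL) => [|x [Ox /andP[_ ?]]//].
have -> : shell j = [set x | Omega x /\ depth x <= j.+1%:R] `&`
    ~` [set x | Omega x /\ depth x < j%:R].
  apply/seteqP; split=> x /=.
    by move=> [Ox /andP[h1 h2]]; split => // -[_]; rewrite ltNge h1.
  move=> [[Ox h1] h2]; split => //; rewrite h1 andbT leNgt; apply/negP => h.
  exact: h2.
apply: closedI; first by apply: compact_closed cL; exact: norm_hausdorff.
apply: open_closedC; rewrite openE => x [Ox xj].
have nO : nbhs x Omega by exact: open_nbhs_nbhs.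
have := continuous_depth Ox; move/cvgr_lt => /(_ _ xj) h.
by apply: filterS2 nO h.
Qed.

(** Each point x of the shell has a ball on which the depth differs from that of
    x by less than 1; finitely many of these balls cover the compact shell, and
    psi is the sum of their bumps. *)
Lemma shell_bump (j : nat) : exists2 psi : X -> R, flat_alg psi &
  [/\ forall x, 0 <= psi x, forall x, shell j x -> 0 < psi x &
      forall x, Omega x -> psi x != 0 -> j%:R <= depth x + 1].
Proof.
have /choice[r rP] x : exists r : R, Omega x ->
    0 < r /\ forall y, ball x r y -> Omega y /\ `|depth x - depth y| < 1.
  have [Ox|nOx] := pselect (Omega x); last by exists 0.
  have nO : nbhs x Omega by exact: open_nbhs_nbhs.
  have := continuous_depth Ox; move/cvgr_dist_lt => /(_ _ ltr01) h.
  have /nbhs_ballP[e e0 he] :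
      nbhs x [set y | Omega y /\ `|depth x - depth y| < 1].
    by apply: filterS2 nO h.
  by exists e.
have cS := @compact_shell j; rewrite compact_cover in cS.
have [||D DS SD] := cS X (shell j) (fun x => (ball x (r x))°).
  by move=> x _; exact: open_interior.
  move=> x Sx; exists x => //; have [|rx _] := rP x; first by case: Sx.
  by apply: nbhsx_ballx.
have rD x : x \in D -> shell j x by move=> /DS /set_mem.
exists (fun x => \sum_(c <- D) box_bump c (r c) x).
  by apply: flat_alg_sum => c; exact: flat_alg_box_bump.
split.
- by move=> x; apply: sumr_ge0 => c _; exact: box_bump_ge0.
- move=> x /SD[c cD /interior_subset cx].
  have [Oc _] := rD _ cD; have [rc _] := rP c Oc.
  rewrite lt0r sumr_ge0 ?andbT; last by move=> d _; exact: box_bump_ge0.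
  rewrite psumr_neq0; last by move=> d _; exact: box_bump_ge0.
  by apply/hasP; exists c => //=; apply/box_bump_gt0.
- move=> x Ox; rewrite psumr_neq0; last by move=> d _; exact: box_bump_ge0.
  move=> /hasP[c cD /= b0]; have [Oc /andP[jc _]] := rD _ cD.
  have [rc h] := rP c Oc; have [|_] := h x; first exact/box_bump_gt0.
  rewrite ltr_norml => /andP[_]; rewrite ltrBlDr => h'.
  by rewrite (le_trans jc)// addrC ltW.
Qed.

(** The function phi is the sum of a j psi j, with psi j the bump function of
    the j-th shell; near x only the indices below depth x + 2 contribute, so phi
    is smooth.  On the shell k, where psi k has a positive lower bound, the
    coefficient a k makes phi exceed the sum of the moduli of the first k+2
    values of c, and j <= depth x + 1 implies that j is one of these indices. *)
Theorem smooth_majorant (c : nat -> R) : exists phi : smooth_pos Omega,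
  forall x j, Omega x -> j%:R <= depth x + 1 -> c j <= phi x.
Proof.
have /choice[psi psiP] j : exists psi : X -> R, flat_alg psi /\
    [/\ forall x, 0 <= psi x, forall x, shell j x -> 0 < psi x &
        forall x, Omega x -> psi x != 0 -> j%:R <= depth x + 1].
  by have [psi] := shell_bump j; exists psi.
have /choice[d dP] j : exists d : R, 0 < d /\ forall x, shell j x ->
    d <= psi j x.
  have [spsi [_ psi0 _]] := psiP j.
  by have [d d0 dpsi] := compact_lower_bound (@compact_shell j)
    (continuous_flat_alg spsi) psi0; exists d.
pose a j := (1 + \sum_(i < j.+2) `|c i|) / d j.
have a0 j : 0 < a j.
  by case: (dP j) => d0 _; rewrite divr_gt0// ltr_wpDr// sumr_ge0.
pose S m x := \sum_(j < m) a j * psi j x.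
have sS m : flat_alg (S m).
  apply: flat_alg_sum => j; apply: (@flat_mul _ _ (fun=> a j));
      first exact: flat_cst.
  by case: (psiP j).
have S_stable m k x : Omega x -> depth x + 1 < m%:R -> (m <= k)%N ->
    S k x = S m x.
  move=> Ox mx mk; rewrite /S.
  rewrite -!(big_mkord xpredT (fun j => a j * psi j x)) (big_cat_nat _ mk)//=.
  rewrite [X in _ + X](_ : _ = 0) ?addr0// big_nat big1// => j /andP[mj _].
  apply/eqP; rewrite mulf_eq0; apply/orP; right; apply: contraTT mx.
  case: (psiP j) => _ [_ _ h] /(h x Ox) jx; rewrite -leNgt (le_trans _ jx)//.
  by rewrite ler_nat.
pose M x := (Num.trunc (depth x)).+3.
have MP x : depth x + 1 < (M x)%:R.
  apply: (@lt_trans _ _ (Num.trunc (depth x)).+2%:R); last by rewrite ltr_nat.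
  by rewrite -[X in _ < X]natr1 ltrD2r truncnS_gt.
pose phi x := if `[< Omega x >] then S (M x) x else 0.
have phiE x m : Omega x -> depth x + 1 < m%:R -> phi x = S m x.
  move=> Ox mx; rewrite /phi asboolT//; have [le|/ltnW le] := leqP m (M x).
    exact: S_stable.
  by rewrite (S_stable (M x) m).
have phi_smooth : smooth_in Omega phi.
  apply: smooth_in_near => x Ox; exists (S (M x)) => //.
  have nO : nbhs x Omega by exact: open_nbhs_nbhs.
  have := continuous_depth Ox; move/cvgr_lt.
  have h : depth x < (M x)%:R - 1 by rewrite ltrBrDr.
  move=> /(_ _ h); apply: filterS2 nO => y Oy; rewrite ltrBrDr => yM.
  exact: phiE.
have phi_ge x : Omega x -> exists k : nat, depth x + 1 < k.+2%:R /\
    1 + \sum_(i < k.+2) `|c i| <= phi x.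
  move=> Ox; have /andP[k1 k2] := truncn_itv (depth_ge0 x).
  set k := Num.trunc (depth x) in k1 k2.
  exists k; split; first by rewrite -natr1 ltrD2r.
  rewrite (phiE x (M x))// /S /M -/k.
  have kM : (k < k.+3)%N by rewrite !ltnS leqW.
  rewrite (bigD1 (Ordinal kM))//= -[leLHS]addr0 lerD//.
    case: (dP k) => d0 /(_ x) dk;
        rewrite /a -mulrA ler_pMr ?ltr_wpDr ?sumr_ge0//.
    rewrite mulrC ler_pdivlMr// mul1r; apply: dk; split => //.
    by rewrite k1 ltW.
  apply: sumr_ge0 => i _; rewrite mulr_ge0 ?(ltW (a0 _))//.
  by case: (psiP i) => _ [].
have phi_gt0 x : Omega x -> 0 < phi x.
  move=> /phi_ge[k [_]]; apply: lt_le_trans.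
  by rewrite ltr_wpDr// sumr_ge0.
have phi_out x : ~ Omega x -> phi x = 0 by move=> nOx; rewrite /phi asboolF.
exists (SmoothPos phi_smooth phi_gt0 phi_out) => x j Ox jx /=.
have [k [xk]] := phi_ge x Ox; apply: le_trans.
have jk : (j < k.+2)%N by rewrite -(ltr_nat R) (le_lt_trans jx).
rewrite (bigD1 (Ordinal jk))//= addrCA (le_trans (ler_norm _))// lerDl.
by rewrite addr_ge0// sumr_ge0.
Qed.

End exhaustion.

(** * Supremum norms *)

Section sup_norms.
Variables (R : realType) (n : nat).
Local Notation C := (Cplx R).
Local Notation X := 'rV[R]_n.
Implicit Types (A : set X) (f g : X -> C).

Definition bounded_on A f := exists M : R, forall x, A x -> normc (f x) <= M.

Lemma sup_norm_ub A f x : bounded_on A f -> A x -> normc (f x) <= sup_norm A f.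
Proof.
move=> [M fM] Ax; apply: sup_upper_bound; last by exists x.
by split; [exists (normc (f x)), x|exists M => _ [y Ay <-]; exact: fM].
Qed.

Lemma sup_norm_le A f M : 0 <= M -> (forall x, A x -> normc (f x) <= M) ->
  sup_norm A f <= M.
Proof.
move=> M0 fM; have [->|A0] := eqVneq A set0.
  by rewrite /sup_norm image_set0 sup0.
apply: ge_sup; last by move=> _ [y Ay <-]; exact: fM.
by move/set0P : A0 => [x Ax]; exists (normc (f x)), x.
Qed.

Lemma sup_norm_ge0 A f : 0 <= sup_norm A f.
Proof.
have [h|h] := pselect (has_sup [set normc (f x) | x in A]);
    last by rewrite /sup_norm sup_out.
case: (h) => -[y [x Ax _]] _; apply: le_trans (normc_ge0 (f x)) _.
by apply: sup_upper_bound => //; exists x.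
Qed.

Lemma sup_normD A f g : bounded_on A f -> bounded_on A g ->
  sup_norm A (f + g) <= sup_norm A f + sup_norm A g.
Proof.
move=> bf bg; apply: sup_norm_le => [|x Ax];
    first by rewrite addr_ge0// sup_norm_ge0.
by apply: le_trans (ler_normcD _ _) _; apply: lerD; exact: sup_norm_ub.
Qed.

Lemma sup_normZ A (a : C) f : bounded_on A f ->
  sup_norm A (a *: f) <= normc a * sup_norm A f.
Proof.
move=> bf; apply: sup_norm_le => [|x Ax].
  by rewrite mulr_ge0 ?normc_ge0// sup_norm_ge0.
rewrite (_ : (a *: f) x = a * f x :> C)// normcM ler_wpM2l ?normc_ge0//.
exact: sup_norm_ub.
Qed.

End sup_norms.

(** * A continuous partition of unity *)

Section cutoffs.
Variables (R : realType) (n : nat) (Omega : set 'rV[R]_n).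
Hypothesis Omega_open : open Omega.
Local Notation C := (Cplx R).
Local Notation X := 'rV[R]_n.
Local Notation cc := (ccType Omega).
Local Notation cont := (contType Omega).
Local Notation depth := (depth Omega).

Lemma cont_continuous (g : cont) x : Omega x -> {for x, continuous g}.
Proof. by have /[!inE] -[h _] := cont_funP g; exact: h. Qed.

Lemma cont_out (g : cont) x : ~ Omega x -> g x = 0.
Proof. by have /[!inE] -[_ h] := cont_funP g; exact: h. Qed.

Lemma cc_continuous (f : cc) : continuous f.
Proof. by have /[!inE] -[h _] := cc_funP f. Qed.

Lemma cc_supp (f : cc) : compact_in Omega (supp f).
Proof. by have /[!inE] -[_ h] := cc_funP f. Qed.

Fact real_cont_subproof (f : X -> R) :
  (forall x, Omega x -> {for x, continuous f}) ->
  (forall x, ~ Omega x -> f x = 0) ->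
      (fun x => (f x)%:C : C) \in @is_cont R n Omega.
Proof.
move=> cf f0; rewrite inE; split=> x Ox; last by rewrite f0.
exact: (@cvg_real_complex R X (nbhs x) _ f (f x) (cf x Ox)).
Qed.

Definition real_cont (f : X -> R) cf f0 : cont :=
    Cont (@real_cont_subproof f cf f0).

Fact cc_of_cont_subproof (g : cont) K : compact_in Omega K ->
  (forall x, ~ K x -> g x = 0) -> (g : X -> C) \in @is_cc R n Omega.
Proof.
move=> [cK KO] g0; have clK : closed K by apply: compact_closed cK;
    exact: norm_hausdorff.
have sK : supp g `<=` K.
  have /closure_id KE := clK; rewrite [X in _ `<=` X]KE;
      apply: closureS => x /=.
  by apply: contraPP => /g0 ->; rewrite eqxx.
rewrite inE; split; last first.
  split; last exact: subset_trans sK KO.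
  exact: subclosed_compact (@closed_supp _ _ _) cK sK.
move=> x; have [Ox|nOx] := pselect (Omega x); first exact: cont_continuous.
have nx : nbhs x (~` K).
  by apply: open_nbhs_nbhs; split; [exact: closed_openC|move=> /KO].
have hf0 : {near x, (fun=> 0 : C) =1 g}.
  by apply: filterS nx => y /g0 ->.
apply: cvg_trans (near_eq_cvg hf0) _.
by rewrite (cont_out g nOx); exact: cvg_cst.
Qed.

Definition cc_of_cont (g : cont) K KO g0 : cc :=
    Cc (@cc_of_cont_subproof g K KO g0).

Fact cont_of_cc_subproof (f : cc) : (f : X -> C) \in @is_cont R n Omega.
Proof.
rewrite inE; split=> x Ox; first exact: cc_continuous.
by apply: supp_notin => /(proj2 (cc_supp f)).
Qed.

Definition cont_of_cc (f : cc) : cont := Cont (cont_of_cc_subproof f).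

Lemma cont_bounded (g : cont) K : compact_in Omega K -> bounded_on K g.
Proof.
move=> KO; have [J HJ] := compact_bound KO (fun x Ox =>
  cvg_normc (@cont_continuous g x Ox)).
by exists J%:R.
Qed.

Lemma cc_bounded (f : cc) A : bounded_on A f.
Proof.
have [M fM] := cont_bounded (cont_of_cc f) (cc_supp f).
exists `|M| => x _; have [sx|/supp_notin ->] := pselect (supp f x).
  by rewrite (le_trans (fM _ sx))// ler_norm.
by rewrite normc0.
Qed.

(** Equal to 1 where depth <= J - 1 and to 0 where depth >= J. *)
Definition ramp (J : nat) (x : X) : R :=
  if `[< Omega x >] then Num.min 1 (Num.max 0 (J%:R - depth x)) else 0.

Lemma ramp_out J x : ~ Omega x -> ramp J x = 0.
Proof. by move=> nOx; rewrite /ramp asboolF. Qed.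

Lemma ramp_ge0 J x : 0 <= ramp J x.
Proof. by rewrite /ramp; case: ifP => // _; rewrite le_min ler01 le_max lexx.
    Qed.

Lemma ramp_le1 J x : ramp J x <= 1.
Proof. by rewrite /ramp; case: ifP => // _; rewrite ge_min lexx. Qed.

Lemma ramp_eq1 J x : Omega x -> depth x + 1 <= J%:R -> ramp J x = 1.
Proof.
by move=> Ox h; rewrite /ramp asboolT// min_l// le_max lerBrDr addrC h orbT.
Qed.

Lemma ramp_eq0 J x : J%:R <= depth x -> ramp J x = 0.
Proof.
move=> h; rewrite /ramp; case: ifP => // _.
by rewrite max_l ?subr_le0// min_r.
Qed.

Lemma ramp_mono J x : ramp J x <= ramp J.+1 x.
Proof.
rewrite /ramp; case: ifP => // _; rewrite -natr1.
by rewrite !(le_min, ge_min, le_max, ge_max); lra.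
Qed.

Lemma continuous_ramp J x : Omega x -> {for x, continuous (ramp J)}.
Proof.
move=> Ox; pose h x : R := Num.min 1 (Num.max 0 (J%:R - depth x)).
have ch : {for x, continuous h}.
  apply: continuous_min; first exact: cst_continuous.
  apply: continuous_max; first exact: cst_continuous.
  apply: (@cvgB R R^o X (nbhs x) _ (cst J%:R) depth); first exact: cvg_cst.
  exact: continuous_depth.
have e : {near x, h =1 ramp J}.
  have nO : nbhs x Omega by exact: open_nbhs_nbhs.
  by apply: filterS nO => y Oy; rewrite /ramp asboolT.
rewrite /prop_for /continuous_at -(nbhs_singleton e).
exact: cvg_trans (near_eq_cvg e) ch.
Qed.

Definition rampC J : cont := real_cont (@continuous_ramp J) (@ramp_out J).

Lemma sublevel_compl_ramp J x :
  ~ [set x | Omega x /\ depth x <= J%:R] x -> rampC J x = 0.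
Proof.
move=> h; apply: (congr1 (fun a => a%:C)).
have [Ox|] := pselect (Omega x); last exact: ramp_out.
apply: ramp_eq0; rewrite leNgt; apply/negP => xJ; apply: h; split => //.
exact: ltW.
Qed.

Definition ramp_cc J : cc :=
  cc_of_cont (compact_sublevel Omega_open J%:R) (@sublevel_compl_ramp J).

(** A partition of unity: the sums of the pieces telescope to the ramps. *)
Definition piece (j : nat) (x : X) : R := ramp j.+1 x - ramp j x.

Lemma piece_ge0 j x : 0 <= piece j x.
Proof. by rewrite subr_ge0 ramp_mono. Qed.

Lemma piece_out j x : ~ Omega x -> piece j x = 0.
Proof. by move=> nOx; rewrite /piece !ramp_out// subrr. Qed.

Lemma piece_sum J x : \sum_(j < J) piece j x = ramp J x.
Proof.
rewrite -(big_mkord xpredT (fun j => piece j x)) telescope_sumr//.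
by rewrite (@ramp_eq0 0 x) ?subr0// depth_ge0.
Qed.

Lemma piece_neq0 j x : piece j x != 0 ->
  [/\ Omega x, depth x <= j.+1%:R & j%:R <= depth x + 1].
Proof.
move=> h; have Ox : Omega x by apply: contrapT => nOx; move: h;
    rewrite piece_out ?eqxx.
split => //.
  rewrite leNgt; apply/negP => jx; move: h;
      rewrite /piece !ramp_eq0 ?subrr ?eqxx//.
    by rewrite (le_trans _ (ltW jx))// ler_nat.
  exact: ltW.
rewrite leNgt; apply/negP => jx; move: h;
    rewrite /piece !ramp_eq1 ?subrr ?eqxx//.
  exact: ltW.
by rewrite (le_trans (ltW jx))// ler_nat.
Qed.

Lemma continuous_piece j x : Omega x -> {for x, continuous (piece j)}.
Proof.
by move=> Ox; apply: (@cvgB R R^o X (nbhs x) _ (ramp j.+1) (ramp j));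
  exact: continuous_ramp.
Qed.

Definition pieceC j : cont := real_cont (@continuous_piece j) (@piece_out j).

(** smooth_majorant provides phi with 1 <= d j * phi where the j-th piece does
    not vanish, and a piece is at most 1. *)
Lemma dominating_weight (d : nat -> R) : (forall j, 0 < d j) ->
  exists phi : smooth_pos Omega, forall j x, piece j x <= d j * phi x.
Proof.
move=> d0; have [phi phiP] := smooth_majorant Omega_open (fun j => (d j)^-1).
exists phi => j x; have [->|px] := eqVneq (piece j x) 0.
  rewrite mulr_ge0 ?(ltW (d0 j))//; have [Ox|nOx] := pselect (Omega x).
    exact/ltW/smooth_pos_gt0.
  by rewrite smooth_pos_out.
have [Ox _ jx] := piece_neq0 px.
apply: (@le_trans _ _ 1).
  by rewrite (le_trans _ (ramp_le1 j.+1 x))// gerBl ramp_ge0.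
by rewrite -ler_pdivrMl// mulr1; exact: phiP.
Qed.

Lemma smooth_pos_bound (phi : smooth_pos Omega) K : compact_in Omega K ->
  exists J : nat, forall x, K x -> phi x <= J%:R.
Proof.
move=> KO; apply: (compact_bound KO) => x Ox.
by case: (@smooth_pos_smooth _ _ _ phi [::] x Ox).
Qed.

Lemma smooth_pos_ge0 (phi : smooth_pos Omega) x : 0 <= phi x.
Proof.
have [Ox|nOx] := pselect (Omega x); first exact/ltW/smooth_pos_gt0.
by rewrite smooth_pos_out.
Qed.

End cutoffs.

(** * Continuous functions with compact support *)

Section cc_weights.
Variables (R : realType) (n : nat) (Omega : set 'rV[R]_n).
Hypothesis Omega_open : open Omega.
Local Notation C := (Cplx R).
Local Notation X := 'rV[R]_n.
Local Notation cc := (ccType Omega).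
Local Notation cont := (contType Omega).
Local Notation depth := (depth Omega).

Lemma cc_sumE m (y : 'I_m -> cc) x : (\sum_i y i) x = \sum_i (y i x : C).
Proof. by apply: (big_morph (fun f : cc => f x : C)). Qed.

Lemma cc_seminorm (F : cc -> X -> C) A :
  (forall f, bounded_on A (F f)) -> (forall f g, F (f + g) = F f + F g) ->
  (forall a f, F (a *: f) = a *: F f) ->
      is_seminorm (fun f => sup_norm A (F f)).
Proof.
move=> bF FD FZ; split=> [f g|a f]; first by rewrite FD; exact: sup_normD.
by rewrite FZ; exact: sup_normZ.
Qed.

Lemma sup_norm_seminorm A : is_seminorm (fun f : cc => sup_norm A f).
Proof. by apply: cc_seminorm => // f; exact: cc_bounded. Qed.

Lemma cc_weighted_seminorm phi : is_seminorm (@cc_weighted_norm R n Omega phi).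
Proof.
apply: (@cc_seminorm (fun f : cc => cc_mul (smooth_pos_cont phi) f)).
- by move=> f; exact: cc_bounded.
- by move=> f g; apply/funext => x /=; exact: (@mulrDr C).
- by move=> a f; apply/funext => x /=; exact: (@mulrCA C).
Qed.

Lemma supp_sub_compact (f : X -> C) K : compact K ->
  (forall x, ~ K x -> f x = 0) -> supp f `<=` K.
Proof.
move=> cK f0; have /closure_id -> : closed K.
  by apply: compact_closed cK; exact: norm_hausdorff.
by apply: closureS => x /=; apply: contraPP => /f0 ->; rewrite eqxx.
Qed.

Lemma normc_ge0_real (a : R) : 0 <= a -> normc (a%:C : C) = a.
Proof. by move=> a0; rewrite normc_real ger0_norm. Qed.

(** Multiplication by the partition of unity cuts f into pieces, and compactness
    of the support of f leaves only finitely many of them.  The j-th piece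
    satisfies |piece j f| <= d j |phi f| pointwise. *)
Lemma cc_weight_system : weight_system (fun f : cc => sup_norm setT f)
  [set [set f : cc | supp f `<=` K] | K in compact_in Omega]
  (@cc_weighted_norm R n Omega).
Proof.
split.
- exact: sup_norm_seminorm.
- exact: cc_weighted_seminorm.
- move=> _ [K [cK _] <-] a f /= fK; apply: supp_sub_compact => // x nKx.
  change (a * f x = 0 :> C); rewrite (_ : f x = 0) ?(@mulr0 C a)//.
  by apply: supp_notin => /fK.
- move=> _ [K [cK _] <-] /=; apply: supp_sub_compact => // x nKx.
- move=> phi _ [K KO <-]; have [J HJ] := smooth_pos_bound phi KO.
  exists J%:R => f /= fK; apply: sup_norm_le => [|x _].
    by rewrite mulr_ge0// sup_norm_ge0.
  rewrite /= normcM normc_ge0_real ?smooth_pos_ge0//.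
  have [Kx|nKx] := pselect (K x).
    apply: ler_pM; rewrite ?smooth_pos_ge0 ?normc_ge0 ?HJ//.
    by apply: sup_norm_ub => //; exact: cc_bounded.
  rewrite (_ : f x = 0) ?normc0 ?mulr0 ?mulr_ge0 ?sup_norm_ge0//.
  by apply: supp_notin => /fK.
- exists (fun j =>
    [set f : cc | supp f `<=` [set x | Omega x /\ depth x <= j.+1%:R]]).
    by move=> j; eexists; [exact: (compact_sublevel Omega_open j.+1%:R)|].
  move=> d d0; have [phi phiP] := dominating_weight Omega_open d0.
  exists phi => f; have [J HJ] := compact_in_depth Omega_open (cc_supp f).
  exists J.+1, (fun j => cc_mul (pieceC Omega_open j) f); split.
    apply: val_inj; apply/funext => x.
    change (f x = (\sum_(j < J.+1) cc_mul (pieceC Omega_open j) f) x).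
    rewrite cc_sumE /= -(@mulr_suml C) -(rmorph_sum (real_complex R)) piece_sum.
    have [sx|/supp_notin ->] := pselect (supp f x); last by rewrite (@mulr0 C).
    have [Ox xJ] := HJ _ sx; rewrite ramp_eq1// -?natr1 ?lerD2r//.
    by rewrite (@mul1r C).
  move=> j; split.
    apply: supp_sub_compact;
        first by case: (compact_sublevel Omega_open j.+1%:R).
    move=> x nKx; rewrite /= (_ : piece Omega j x = 0) ?(@mul0r C)//.
    by apply/eqP; apply: contra_notT nKx => /piece_neq0[].
  apply: sup_norm_le => [|x _].
    by rewrite mulr_ge0// ?(ltW (d0 _))// sup_norm_ge0.
  rewrite /= normcM normc_ge0_real ?piece_ge0//.
  apply: (@le_trans _ _ (d j * (phi x * normc (f x)))).
    by rewrite mulrA ler_wpM2r ?normc_ge0.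
  rewrite ler_pM2l// -[X in X * _](normc_ge0_real (smooth_pos_ge0 phi x))
      -normcM.
  by apply: (@sup_norm_ub _ _ setT (cc_mul (smooth_pos_cont phi) f)) => //;
      exact: cc_bounded.
Qed.

Theorem cc_topologyE : cc_topology Omega =
  seminorm_topology [set cc_weighted_norm phi | phi in [set: smooth_pos Omega]].
Proof. exact: weight_topology cc_weight_system. Qed.

Lemma radon_linear (m : radonType Omega) a f g : m (a *: f + g) = a * m f + m g.
Proof. by have /[!inE] -[lm _] := radon_funP m; exact: lm. Qed.

Lemma radonD (m : radonType Omega) f g : m (f + g) = m f + m g.
Proof. by rewrite -[f]scale1r radon_linear scale1r (@mul1r C). Qed.

Lemma radon0 (m : radonType Omega) : m 0 = 0.
Proof. by apply: (@addrI C (m 0)); rewrite -radonD !addr0. Qed.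

End cc_weights.

(** * Radon measures and the pairing with continuous functions *)

Section radon.
Variables (R : realType) (n : nat) (Omega : set 'rV[R]_n).
Hypothesis Omega_open : open Omega.
Local Notation C := (Cplx R).
Local Notation X := 'rV[R]_n.
Local Notation cc := (ccType Omega).
Local Notation cont := (contType Omega).
Local Notation radon := (radonType Omega).
Local Notation rcomp := (radonComp Omega).
Local Notation depth := (depth Omega).
Implicit Types (f : cc) (g h : cont) (K : set X).

Lemma cc_step_scale K : compact_in Omega K ->
  forall (a : C) f, supp f `<=` K -> supp (a *: f) `<=` K.
Proof.
move=> KO a f fK; have W := cc_weight_system Omega_open.
have sK : [set [set f : cc | supp f `<=` K] | K in compact_in Omega]
    [set f : cc | supp f `<=` K] by exists K.
exact: ws_scale W _ sK a f fK.
Qed.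

Lemma radon_of_bound (L : cc -> C) : scalar L ->
  (forall K, compact_in Omega K -> exists M : R, forall f, supp f `<=` K ->
    normc (L f) <= M * sup_norm setT f) ->
  L \in @is_radon R n Omega.
Proof.
move=> lL bL; rewrite inE; split => //.
apply: continuous_functional_limit => //; first exact: sup_norm_seminorm.
by move=> _ [K KO <-]; exact: bL.
Qed.

Lemma radon_bound (m : radon) K : compact_in Omega K ->
  exists2 M : R, 0 <= M & forall f, supp f `<=` K ->
    normc (m f) <= M * sup_norm setT f.
Proof.
move=> KO; have /[!inE] -[lm cm] := radon_funP m.
apply: (limit_functional_bound lm _ cm); first exact: sup_norm_seminorm.
  by exists K.
exact: cc_step_scale.
Qed.

Fact point_mass_subproof (a : C) (x : X) :
    (fun f => a * f x) \in @is_radon R n Omega.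
Proof.
apply: radon_of_bound.
  by move=> b f g; rewrite (@mulrDr C a); congr (_ + _); exact: (@mulrCA C).
move=> K _; exists (normc a) => f _; rewrite normcM ler_wpM2l ?normc_ge0//.
by apply: sup_norm_ub => //; exact: cc_bounded.
Qed.

Definition point_mass a x : radon := Radon (point_mass_subproof a x).

(** The sup norm of phi f is the supremum of the moduli of the pairings of f
    with the point masses of weight phi x at x.  These form a bounded set of measures
    because p_phi is bounded on the bounded sets of test functions.  Conversely
    the unit ball of a step is bounded, so a set of measures that is bounded for
    the strong topology is bounded on it. *)
Theorem cc_betaE :
    beta_topology (cc_radon_pairing Omega) (radon_topology Omega) =
  cc_topology Omega.
Proof.
apply: (weight_beta (cc_weight_system Omega_open)).
- by move=> m; have /[!inE] -[lm _] := radon_funP m.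
- move=> B _ bB [K KO <-].
  have lp f : scalar ((fun (m : radon) (f : cc) => m f) ^~ f).
    by move=> a m m'.
  have [|M MP] := uniform_topology_bound lp
      (D := [set f : cc | supp f `<=` K /\ sup_norm setT f <= 1]) bB.
    rewrite cc_topologyE//; apply: seminorm_topology_bounded.
      by move=> _ [phi _ <-]; exact: cc_weighted_seminorm.
    move=> _ [phi _ <-]; have W := cc_weight_system Omega_open.
    have [|M MP] := ws_bound W phi (S := [set f : cc | supp f `<=` K]).
      by exists K.
    exists `|M| => f [fK f1]; apply: (le_trans (MP f fK)).
    by rewrite (le_trans (ler_wpM2r (sup_norm_ge0 _ _) (ler_norm M)))//
        ler_piMr.
  exists `|M| => f m fK Bm; have /[!inE] -[lm _] := radon_funP m.
  apply: (@homogeneous_bound R _ (fun f : cc => normc (m f))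
    (fun f : cc => sup_norm setT f) [set f : cc | supp f `<=` K] `|M|) => //.
  + exact: normc_seminorm.
  + exact: sup_norm_seminorm.
  + by move=> a h; exact: cc_step_scale.
  + by move=> h hK h1; rewrite (le_trans (MP m h Bm _))// ler_norm.
- move=> phi; exists [set m | exists x, m = point_mass (phi x)%:C x].
    apply: uniform_topology_bounded; first by move=> f a m m'.
    move=> D; rewrite cc_topologyE// => bD.
    have [||M MP] := @seminorm_bounded _ _ _ D (cc_weighted_norm phi) _ _ bD.
    + by exists phi.
    + exact: cc_weighted_seminorm.
    exists M => m f [x ->] Df /=; apply: le_trans (MP f Df).
    apply: (@sup_norm_ub _ _ setT (cc_mul (smooth_pos_cont phi) f)) => //.
    exact: cc_bounded.
  exists 2^-1; first by rewrite invr_gt0.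
  move=> f fB; apply: (@le_lt_trans _ _ 2^-1); last by rewrite invf_lt1// ltr1n.
  apply: sup_norm_le => [|x _]; first by rewrite invr_ge0.
  by apply: ltW; apply: (fB (point_mass (phi x)%:C x)); exists x.
Qed.

Lemma cc_near_supp_disjoint K (U : set X) f : open U -> K `<=` U ->
  (forall x, U x -> f x = 0) -> supp f `&` K = set0.
Proof.
move=> oU KU f0; apply/seteqP; split => // x [sx /KU Ux].
have : (closure (~` U)) x.
  by move: x sx {Ux}; apply: closureS => x /= fx Ux; move: fx;
      rewrite f0// eqxx.
by move/closure_id : (open_closedC oU) => <-; apply.
Qed.

(** A measure depends only on the values near a set that supports it; this is
    the form in which supports are used. *)
Lemma radon_supp_eq (m : radon) K (U : set X) f f' : radon_supported K m ->
    open U ->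
  K `<=` U -> (forall x, U x -> f x = f' x) -> m f = m f'.
Proof.
move=> mK oU KU ff'; have : m (f - f') = 0.
  apply: mK; apply: (cc_near_supp_disjoint oU KU) => x Ux.
  by change (f x - f' x = 0 :> C); rewrite ff'// (@subrr C).
have -> : f - f' = (-1) *: f' + f by rewrite scaleN1r addrC.
rewrite radon_linear (@mulN1r C) (@addrC C); exact: (@subr0_eq C).
Qed.

(** An open neighbourhood of the sublevel set of J on which the ramp of J + 2 is
    1, which makes this ramp a cutoff function for measures supported in that
    sublevel set. *)
Definition inner (J : nat) : set X := [set x | Omega x /\ depth x < J.+1%:R].

Lemma open_inner J : open (inner J).
Proof.
rewrite openE => x [Ox xj].
have nO : nbhs x Omega by exact: open_nbhs_nbhs.
have := continuous_depth Omega_open Ox; move/cvgr_lt => /(_ _ xj) h.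
by apply: filterS2 nO h.
Qed.

Lemma ramp_cc_inner J x : inner J x -> ramp_cc Omega_open J.+2 x = 1.
Proof.
move=> [Ox xJ]; rewrite /= ramp_eq1//.
by rewrite -natr1 lerD2r ltW.
Qed.

Lemma sub_inner K J : K `<=` [set x | Omega x /\ depth x <= J%:R] ->
    K `<=` inner J.
Proof.
move=> KJ x /KJ[Ox xJ]; split => //; apply: le_lt_trans xJ _;
    by rewrite ltr_nat.
Qed.

Lemma normc_ramp_cc J x : normc (ramp_cc Omega_open J x) <= 1.
Proof.
change (normc ((ramp Omega J x)%:C : C) <= 1).
by rewrite normc_real ger0_norm ?ramp_ge0// ramp_le1.
Qed.

Lemma ramp_cc_cutoff (m : radon) K J : compact_in Omega K ->
  K `<=` [set x | Omega x /\ depth x <= J%:R] ->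
  radon_supported K m -> cutoff m (ramp_cc Omega_open J.+2).
Proof.
move=> KO KJ mK; exists K, (inner J); split => //.
- exact: open_inner.
- exact: sub_inner.
- exact: ramp_cc_inner.
Qed.

(** The chosen cutoff chi' and the ramp chi give the same value: m (g chi) and
    m (g chi') both equal m (g chi chi'), since each of them is 1 near a set
    that supports m. *)
Lemma pairing_ramp (m : rcomp) K J g : compact_in Omega K ->
  K `<=` [set x | Omega x /\ depth x <= J%:R] -> radon_supported K m ->
  radon_comp_pairing Omega m g = m (cc_mul g (ramp_cc Omega_open J.+2)).
Proof.
move=> KO KJ mK; have chiP := ramp_cc_cutoff KO KJ mK.
set chi := ramp_cc _ _ in chiP *; rewrite /radon_comp_pairing.
have := @xgetPex _ 0 _ (ex_intro _ chi chiP : exists x, cutoff m x).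
set chi' := xget _ _ => -[K' [U' [K'O mK' oU' K'U' chi'1]]].
have -> : m (cc_mul g chi) = m (cc_mul (cont_of_cc chi') (cc_mul g chi)).
  apply: (radon_supp_eq mK' oU' K'U') => x /chi'1 chix.
  by rewrite [RHS]/= chix (@mul1r C).
apply: (radon_supp_eq mK (@open_inner J) (sub_inner KJ)) => x xJ.
change (g x * chi' x = chi' x * (g x * chi x) :> C).
have -> : chi x = 1 by exact: ramp_cc_inner.
by rewrite (@mulr1 C) (@mulrC C).
Qed.

Lemma rcomp_supp (m : rcomp) : exists2 K, compact_in Omega K &
    radon_supported K m.
Proof. by have /[!inE] := radon_compP m. Qed.

Lemma radon_supportedS K L (m : radon) : K `<=` L ->
  radon_supported K m -> radon_supported L m.
Proof.
move=> KL mK f fL; apply: mK; apply/seteqP; split => // x [fx /KL Lx].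
by rewrite -fL.
Qed.

Lemma rcomp_depth (m : rcomp) : exists J0 : nat, forall J, (J0 <= J)%N ->
  radon_supported [set x | Omega x /\ depth x <= J%:R] m.
Proof.
have [K KO mK] := rcomp_supp m; have [J0 KJ0] := compact_in_depth Omega_open KO.
exists J0 => J J0J; apply: radon_supportedS mK => x /KJ0[Ox xJ]; split => //.
by rewrite (le_trans xJ)// ler_nat.
Qed.

Lemma pairing_ramp_depth (m : rcomp) J g :
  radon_supported [set x | Omega x /\ depth x <= J%:R] m ->
  radon_comp_pairing Omega m g = m (cc_mul g (ramp_cc Omega_open J.+2)).
Proof. by apply: pairing_ramp => //; exact: compact_sublevel. Qed.

Lemma radon_ramp (m : radon) J f :
  radon_supported [set x | Omega x /\ depth x <= J%:R] m ->
  m f = m (cc_mul (cont_of_cc f) (ramp_cc Omega_open J.+2)).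
Proof.
move=> mJ; apply: (radon_supp_eq mJ (@open_inner J)); first exact: sub_inner.
move=> x xJ; change (f x = f x * ramp_cc Omega_open J.+2 x :> C).
by rewrite ramp_cc_inner// (@mulr1 C).
Qed.

(** One ramp serves as cutoff for m, for m' and for their combination. *)
Theorem radon_comp_pairing_linear : linear (radon_comp_pairing Omega).
Proof.
move=> a m m'; apply/funext => g.
have [J1 h1] := rcomp_depth m; have [J2 h2] := rcomp_depth m'.
have [J3 h3] := rcomp_depth (a *: m + m').
pose J := maxn J1 (maxn J2 J3).
have ? := h1 J (leq_maxl _ _).
have ? := h2 J (leq_trans (leq_maxl _ _) (leq_maxr _ _)).
have ? := h3 J (leq_trans (leq_maxr _ _) (leq_maxr _ _)).
change (radon_comp_pairing Omega (a *: m + m') g =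
  a * radon_comp_pairing Omega m g + radon_comp_pairing Omega m' g :> C).
by rewrite !(@pairing_ramp_depth _ J).
Qed.

Lemma cont_seminorm K : compact_in Omega K ->
    is_seminorm (fun g : cont => sup_norm K g).
Proof.
move=> KO; split=> [g h|a g].
  by apply: sup_normD; exact: cont_bounded.
by apply: sup_normZ; exact: cont_bounded.
Qed.

Lemma pairing_scalar (m : rcomp) : scalar (radon_comp_pairing Omega m).
Proof.
move=> a g h; have [J hJ] := rcomp_depth m.
rewrite !(@pairing_ramp_depth _ J)//; try exact: hJ.
have -> : cc_mul (a *: g + h) (ramp_cc Omega_open J.+2) =
    a *: cc_mul g (ramp_cc Omega_open J.+2) + cc_mul h
        (ramp_cc Omega_open J.+2).
  apply: val_inj; apply/funext => x /=.
  change ((a * g x + h x) * (ramp Omega J.+2 x)%:C =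
    a * (g x * (ramp Omega J.+2 x)%:C) + h x * (ramp Omega J.+2 x)%:C :> C).
  by rewrite (@mulrDl C) (@mulrA C).
exact: radon_linear.
Qed.

Lemma supp_cc_mul_ramp g J : supp (cc_mul g (ramp_cc Omega_open J)) `<=`
  [set x | Omega x /\ depth x <= J%:R].
Proof.
apply: supp_sub_compact; first by case: (compact_sublevel Omega_open J%:R).
move=> x nx; change (g x * rampC Omega_open J x = 0 :> C).
by rewrite (sublevel_compl_ramp Omega_open nx) (@mulr0 C).
Qed.

Lemma sup_norm_cc_mul_ramp g J :
    sup_norm setT (cc_mul g (ramp_cc Omega_open J)) <=
  sup_norm [set x | Omega x /\ depth x <= J%:R] g.
Proof.
have cJ := compact_sublevel Omega_open J%:R.
apply: sup_norm_le => [|x _]; first exact: sup_norm_ge0.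
have [Kx|nKx] := pselect ([set x | Omega x /\ depth x <= J%:R] x).
  rewrite normcM; apply: le_trans (sup_norm_ub (cont_bounded g cJ) Kx).
  by rewrite ler_piMr ?normc_ge0 ?normc_ramp_cc.
change (normc (g x * rampC Omega_open J x : C) <=
  sup_norm [set x | Omega x /\ depth x <= J%:R] g).
by rewrite (sublevel_compl_ramp Omega_open nKx) (@mulr0 C) normc0 sup_norm_ge0.
Qed.

Lemma pairing_dual (m : rcomp) :
  topological_dual (cont_topology Omega) (radon_comp_pairing Omega m).
Proof.
split; first exact: pairing_scalar.
have [J hJ] := rcomp_depth m; pose KJ :=
    [set x | Omega x /\ depth x <= J.+2%:R].
have cKJ : compact_in Omega KJ := compact_sublevel Omega_open _.
have [M M0 MP] := radon_bound m cKJ.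
apply: (@continuous_functional_seminorm _ _ _ _ (fun g : cont => sup_norm KJ g)
    M).
- exact: pairing_scalar.
- by exists KJ.
- exact: cont_seminorm.
- move=> g; rewrite (@pairing_ramp_depth _ J); last exact: hJ.
  apply: le_trans (MP _ (@supp_cc_mul_ramp g _)) _.
  by rewrite ler_wpM2l// sup_norm_cc_mul_ramp.
Qed.

Lemma pairing_cc (m : rcomp) f :
    radon_comp_pairing Omega m (cont_of_cc f) = m f.
Proof.
have [J hJ] := rcomp_depth m; rewrite (@pairing_ramp_depth _ J) -?radon_ramp//;
    exact: hJ.
Qed.

(** The functional L is bounded by the supremum over one compact set KJ.  Hence
    L g depends only on the restriction of g to KJ: the restriction of L to the
    test functions is a measure supported in KJ, and cutting g off does not
    change L g. *)
Lemma pairing_surj (L : cont -> C) : topological_dual (cont_topology Omega) L ->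
  exists m : rcomp, radon_comp_pairing Omega m = L.
Proof.
move=> [lL cL].
have [|k [s [M [sP M0 bL]]]] := seminorm_functional_bound lL _ cL.
  by move=> _ [K KO <-]; exact: cont_seminorm.
have /choice[K KP] i :
    exists K, compact_in Omega K /\ s i = (fun g : cont => sup_norm K g).
  by have [K KO <-] := sP i; exists K.
have /choice[J JP] i := compact_in_depth Omega_open (proj1 (KP i)).
pose J0 := (\max_i J i)%N; pose KJ := [set x | Omega x /\ depth x <= J0%:R].
have KJP i : K i `<=` KJ.
  move=> x /(JP i)[Ox xJ]; split => //; apply: le_trans xJ _.
  by rewrite ler_nat; exact: (leq_bigmax i).
have cKJ : compact_in Omega KJ := compact_sublevel Omega_open _.
have bound g : normc (L g) <= M * sup_norm KJ g.
  apply: (@homogeneous_bound R _ (fun g : cont => normc (L g))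
    (fun g : cont => sup_norm KJ g) setT M) => //.
  - exact: normc_seminorm.
  - exact: cont_seminorm.
  - exact: ltW.
  - move=> h _ h1; apply: bL => i; case: (KP i) => KO ->.
    apply: le_trans h1; apply: sup_norm_le; first exact: sup_norm_ge0.
    move=> x /KJP Kx; apply: sup_norm_ub => //; exact: cont_bounded.
have L_eq g h : (forall x, KJ x -> g x = h x) -> L g = L h.
  move=> gh; have lgh : L (g - h) = L g - L h.
    have -> : g - h = (-1) *: h + g by rewrite scaleN1r addrC.
    by rewrite lL (@mulN1r C) (@addrC C).
  apply: (@subr0_eq C); rewrite -lgh; apply: eq0_normc; apply/eqP.
  rewrite eq_le normc_ge0 andbT (le_trans (bound _))// pmulr_rle0//.
  apply: sup_norm_le => // x Kx; change (normc (g x - h x : C) <= 0).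
  by rewrite gh// (@subrr C) normc0.
have mP : (fun f => L (cont_of_cc f)) \in @is_radon R n Omega.
  apply: radon_of_bound.
    move=> a f f'; rewrite -lL; congr L; exact: val_inj.
  move=> K' K'O; exists M => f _; apply: le_trans (bound _) _.
  rewrite ler_wpM2l ?(ltW M0)//; apply: sup_norm_le; first exact: sup_norm_ge0.
  by move=> x _; apply: (@sup_norm_ub _ _ setT f) => //; exact: cc_bounded.
have mKJ : radon_supported KJ (Radon mP).
  move=> f fK; change (L (cont_of_cc f) = 0).
  suff -> : L (cont_of_cc f) = L 0.
    by apply: eq0_normc; exact: seminorm0 (normc_seminorm lL).
  apply: L_eq => x Kx; apply: supp_notin => sx.
  by have : set0 x by rewrite -fK.
have mC : Radon mP \in @is_radon_comp R n Omega by rewrite inE; exists KJ.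
exists (RadonComp mC); apply/funext => g.
rewrite (@pairing_ramp_depth _ J0)//=; apply: L_eq => x Kx /=.
rewrite ramp_eq1 ?(@mulr1 C)//; first by case: Kx.
by rewrite -natr1 lerD2r; case: Kx => _ /le_trans; apply; rewrite ler_nat.
Qed.

Theorem pairing_bij :
    set_bij [set: rcomp] (topological_dual (cont_topology Omega))
  (radon_comp_pairing Omega).
Proof.
split.
- by move=> m _; exact: pairing_dual.
- move=> m m' _ _ mm'; apply: val_inj; apply: val_inj; apply/funext => f.
  by rewrite -[LHS]pairing_cc -[RHS]pairing_cc mm'.
- by move=> L /pairing_surj[m mL]; exists m.
Qed.

End radon.

(** * Weights on the measures with compact support *)

Section radon_weights.
Variables (R : realType) (n : nat) (Omega : set 'rV[R]_n).
Hypothesis Omega_open : open Omega.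
Local Notation C := (Cplx R).
Local Notation X := 'rV[R]_n.
Local Notation cc := (ccType Omega).
Local Notation cont := (contType Omega).
Local Notation radon := (radonType Omega).
Local Notation rcomp := (radonComp Omega).
Local Notation depth := (depth Omega).
Local Notation total_variation := (@Defs.total_variation R n Omega).
Implicit Types (f : cc) (g h : cont) (K : set X).

Definition finite_variation (L : cc -> C) := exists M : R,
  forall f, sup_norm setT f <= 1 -> normc (L f) <= M.

Lemma sup_norm_cc0 : sup_norm setT (0 : cc) = 0.
Proof. exact: seminorm0 (@sup_norm_seminorm _ _ Omega setT). Qed.

Lemma variation_ub (L : cc -> C) f : finite_variation L ->
  sup_norm setT f <= 1 -> normc (L f) <= total_variation L.
Proof.
move=> [M LM] f1; apply: sup_upper_bound; last by exists f.
by split; [exists (normc (L f)), f|exists M => _ [h h1 <-]; exact: LM].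
Qed.

Lemma variation_le (L : cc -> C) M :
  (forall f, sup_norm setT f <= 1 -> normc (L f) <= M) ->
      total_variation L <= M.
Proof.
move=> LM; apply: ge_sup; last by move=> _ [h h1 <-]; exact: LM.
by exists (normc (L 0)), 0 => //=; rewrite sup_norm_cc0.
Qed.

Lemma variation_ge0 (L : cc -> C) : finite_variation L ->
    0 <= total_variation L.
Proof.
by move=> fL; apply: le_trans (variation_ub (f := 0) fL _);
    rewrite ?normc_ge0// sup_norm_cc0.
Qed.

Lemma variation_bound (L : cc -> C) f : scalar L -> finite_variation L ->
  normc (L f) <= total_variation L * sup_norm setT f.
Proof.
move=> lL fL; apply: (@homogeneous_bound R _ (fun f : cc => normc (L f))
    (fun f : cc => sup_norm setT f) setT (total_variation L)) => //.
- exact: normc_seminorm.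
- exact: sup_norm_seminorm.
- exact: variation_ge0.
- by move=> h _; exact: variation_ub.
Qed.

Lemma variation_seminorm (L : rcomp -> cc -> C) :
  (forall m, finite_variation (L m)) ->
  (forall m m' f, L (m + m') f = L m f + L m' f) ->
  (forall a m f, L (a *: m) f = a * L m f) ->
  is_seminorm (fun m => total_variation (L m)).
Proof.
move=> fL LD LZ; split=> [m m'|a m].
  apply: variation_le => f f1; rewrite LD (le_trans (ler_normcD _ _))// lerD//.
    exact: variation_ub.
  exact: variation_ub.
apply: variation_le => f f1; rewrite LZ normcM ler_wpM2l ?normc_ge0//.
exact: variation_ub.
Qed.

Lemma sup_norm_cc_mul g f (M : R) : 0 <= M -> (forall x, normc (g x) <= M) ->
  sup_norm setT (cc_mul g f) <= M * sup_norm setT f.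
Proof.
move=> M0 gM; apply: sup_norm_le => [|x _].
  by rewrite mulr_ge0// sup_norm_ge0.
rewrite normcM ler_pM ?normc_ge0//.
by apply: sup_norm_ub => //; exact: cc_bounded.
Qed.

Lemma cc_mul_linear g :
    forall a f f', cc_mul g (a *: f + f') = a *: cc_mul g f + cc_mul g f'.
Proof.
move=> a f f'; apply: val_inj; apply/funext => x.
change (g x * (a * f x + f' x) = a * (g x * f x) + g x * f' x :> C).
by rewrite (@mulrDr C) (@mulrCA C).
Qed.

Lemma radon_mul_scalar g (m : radon) : scalar (radon_mul g m).
Proof. by move=> a f f'; rewrite /radon_mul cc_mul_linear radon_linear. Qed.

(** A cutoff for m replaces the continuous function g, which may be unbounded on
    Omega, by a bounded one. *)
Lemma radon_mul_variation g (m : rcomp) : finite_variation (radon_mul g m).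
Proof.
have [J hJ] := rcomp_depth Omega_open m.
have mJ := hJ J (leqnn J).
have [M M0 MP] :=
    radon_bound Omega_open m (compact_sublevel Omega_open J.+2%:R).
have [N gN] := cont_bounded g (compact_sublevel Omega_open J.+2%:R).
exists (M * `|N|) => f f1; rewrite /radon_mul (radon_ramp Omega_open _ mJ).
apply: le_trans (MP _ (@supp_cc_mul_ramp _ _ _ Omega_open _ _)) _;
    rewrite ler_wpM2l//.
apply: le_trans (sup_norm_cc_mul_ramp _ _ _) _.
apply: sup_norm_le => // x Kx; change (normc (g x * f x) <= `|N|).
rewrite normcM -(mulr1 `|N|) ler_pM ?normc_ge0//.
  by rewrite (le_trans (gN _ Kx))// ler_norm.
by apply: le_trans f1; apply: sup_norm_ub => //; exact: cc_bounded.
Qed.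

Lemma rcomp_variation (m : rcomp) : finite_variation (m : radon).
Proof.
have [J hJ] := rcomp_depth Omega_open m.
have mJ := hJ J (leqnn J).
have [M M0 MP] :=
    radon_bound Omega_open m (compact_sublevel Omega_open J.+2%:R).
exists M => f f1; rewrite (radon_ramp Omega_open _ mJ).
apply: le_trans (MP _ (@supp_cc_mul_ramp _ _ _ Omega_open _ _)) _.
rewrite ler_piMr//; apply: le_trans (sup_norm_cc_mul_ramp _ _ _) _.
apply: le_trans f1; apply: sup_norm_le => [|x Kx]; first exact: sup_norm_ge0.
by apply: (@sup_norm_ub _ _ setT f) => //; exact: cc_bounded.
Qed.

Lemma rcomp_scalar (m : rcomp) : scalar (m : radon).
Proof. by move=> a f f'; exact: radon_linear. Qed.

Fact radon_mul_subproof g (m : radon) : radon_mul g m \in @is_radon R n Omega.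
Proof.
apply: radon_of_bound; first exact: radon_mul_scalar.
move=> K KO; have [M M0 MP] := radon_bound Omega_open m KO; have [N gN] :=
    cont_bounded g KO.
exists (M * `|N|) => f fK; rewrite -mulrA.
apply: le_trans (MP _ _) _; first exact: subset_trans (@supp_mul _ _ g f) fK.
rewrite ler_wpM2l//; apply: sup_norm_le => [|x _];
    first by rewrite mulr_ge0// sup_norm_ge0.
have [Kx|nKx] := pselect (K x).
  rewrite normcM ler_pM ?normc_ge0//;
      first by rewrite (le_trans (gN _ Kx))// ler_norm.
  by apply: sup_norm_ub => //; exact: cc_bounded.
change (normc (g x * f x) <= `|N| * sup_norm setT f).
rewrite (_ : f x = 0) ?(@mulr0 C) ?normc0 ?mulr_ge0 ?sup_norm_ge0//.
by apply: supp_notin => /fK.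
Qed.

Lemma piece_supported j (m : radon) : radon_supported
  [set x | Omega x /\ depth x <= j.+1%:R]
  (radon_mul (pieceC Omega_open j) m).
Proof.
move=> f fK; rewrite /radon_mul (_ : cc_mul _ _ = 0) ?radon0//.
apply: val_inj; apply/funext => x; change ((piece Omega j x)%:C * f x = 0 :> C).
have [->|px] := eqVneq (piece Omega j x) 0; first exact: (@mul0r C).
rewrite (_ : f x = 0) ?(@mulr0 C)//; apply: supp_notin => sx.
have [Ox xj _] := piece_neq0 px.
by have : set0 x by rewrite -fK.
Qed.

Fact piece_rcomp_subproof j (m : radon) :
  Radon (radon_mul_subproof (pieceC Omega_open j) m) \in @is_radon_comp R n
      Omega.
Proof.
rewrite inE; exists [set x | Omega x /\ depth x <= j.+1%:R].
  exact: compact_sublevel.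
exact: piece_supported.
Qed.

Definition rcomp_piece j (m : radon) : rcomp :=
    RadonComp (piece_rcomp_subproof j m).

Lemma rcomp_sumE k (y : 'I_k -> rcomp) f :
    (\sum_i y i : rcomp) f = \sum_i (y i f : C).
Proof. by apply: (big_morph (fun m : rcomp => m f : C)). Qed.

Lemma rcomp_piece_sum (m : rcomp) J :
  radon_supported [set x | Omega x /\ depth x <= J%:R] m ->
  m = \sum_(j < J.+2) rcomp_piece j m.
Proof.
move=> mJ; apply: val_inj; apply: val_inj; apply/funext => f.
change (m f = (\sum_(j < J.+2) rcomp_piece j m) f).
rewrite rcomp_sumE.
have -> : \sum_(i < J.+2) (rcomp_piece i m f : C) =
    m (\sum_(i < J.+2) cc_mul (pieceC Omega_open i) f).
  rewrite (big_morph _ (@radonD _ _ _ m) (@radon0 _ _ _ m)).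
  by apply: eq_bigr.
rewrite (radon_ramp Omega_open _ mJ); congr (radon_fun m _).
apply: val_inj; apply/funext => x.
change (f x * (ramp Omega J.+2 x)%:C =
    (\sum_(i < J.+2) cc_mul (pieceC Omega_open i) f) x :> C).
rewrite cc_sumE -(piece_sum Omega) (rmorph_sum (real_complex R)) (@mulr_sumr C).
by apply: eq_bigr => i _; rewrite (@mulrC C).
Qed.

Fact ratio_continuous (phi : smooth_pos Omega) (j : nat) x : Omega x ->
  {for x, continuous (fun x => piece Omega j x / phi x)}.
Proof.
move=> Ox; apply: (@cvgM R X (nbhs x) _ (piece Omega j) (fun x => (phi x)^-1)).
  exact: (continuous_piece Omega_open).
apply: cvgV; first by rewrite gt_eqF// smooth_pos_gt0.
by case: (@smooth_pos_smooth _ _ _ phi [::] x Ox).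
Qed.

Fact ratio_out (phi : smooth_pos Omega) (j : nat) x : ~ Omega x ->
  piece Omega j x / phi x = 0.
Proof. by move=> nOx; rewrite piece_out// mul0r. Qed.

(** Writing piece j f as phi times (piece j / phi) f moves the weight onto the
    measure; the quotient is at most d in modulus. *)
Lemma rcomp_piece_variation (phi : smooth_pos Omega) j (d : R) (m : rcomp) :
  0 <= d -> (forall x, piece Omega j x <= d * phi x) ->
  total_variation (rcomp_piece j m) <= d * radon_comp_weighted_norm phi m.
Proof.
move=> d0 pd; apply: variation_le => f f1.
pose q := real_cont (@ratio_continuous phi j) (@ratio_out phi j).
have -> : rcomp_piece j m f = radon_mul (smooth_pos_cont phi) m (cc_mul q f).
  congr (radon_fun m _); apply: val_inj; apply/funext => x.
  change ((piece Omega j x)%:C * f x =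
    (phi x)%:C * ((piece Omega j x / phi x)%:C * f x) :> C).
  have [Ox|nOx] := pselect (Omega x); last first.
    by rewrite piece_out// smooth_pos_out// !(@mul0r C).
  rewrite (@mulrA C) -(rmorphM (real_complex R)) mulrCA divff ?mulr1//.
  by rewrite gt_eqF// smooth_pos_gt0.
apply: le_trans (variation_bound _ (radon_mul_scalar _ _)
    (radon_mul_variation _ _)) _.
rewrite mulrC ler_wpM2r ?variation_ge0//; first exact: radon_mul_variation.
apply: (@le_trans _ _ (d * sup_norm setT f)); last first.
  by rewrite ler_piMr.
apply: sup_norm_cc_mul => // x;
    change (normc ((piece Omega j x / phi x)%:C : C) <= d).
have [Ox|nOx] := pselect (Omega x); last by rewrite piece_out// mul0r normc0.
rewrite normc_ge0_real ?divr_ge0 ?piece_ge0 ?smooth_pos_ge0//.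
by rewrite ler_pdivrMr// smooth_pos_gt0.
Qed.

(** The same partition of unity, now acting on measures; the sum of the pieces
    is a ramp times m, which is m once the ramp is 1 near a support of m. *)
Lemma radon_weight_system : weight_system (fun m : rcomp => total_variation m)
  [set [set m : rcomp | radon_supported K m] | K in compact_in Omega]
  (@radon_comp_weighted_norm R n Omega).
Proof.
split.
- apply: (@variation_seminorm (fun m : rcomp => (m : radon))) => //.
  exact: rcomp_variation.
- move=> phi; apply:
    (@variation_seminorm (fun m : rcomp => radon_mul (smooth_pos_cont phi) m))
    => //.
  exact: radon_mul_variation.
- move=> _ [K KO <-] a m /= mK f fK; change (a * m f = 0 :> C).
  by rewrite mK// (@mulr0 C).
- by move=> _ [K KO <-].
- move=> phi _ [K KO <-]; have [J KJ] := compact_in_depth Omega_open KO.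
  have cJ := compact_sublevel Omega_open J.+2%:R.
  have [M MP] := smooth_pos_bound phi cJ.
  exists M%:R => m mK; apply: variation_le => f f1.
  have mJ := radon_supportedS KJ mK.
  rewrite /radon_mul (radon_ramp Omega_open _ mJ) mulrC.
  apply: le_trans (variation_bound _ (rcomp_scalar m) (rcomp_variation m)) _.
  rewrite ler_wpM2l ?variation_ge0//; first exact: rcomp_variation.
  apply: le_trans (sup_norm_cc_mul_ramp _ _ _) _.
  apply: sup_norm_le => // x Kx; change (normc ((phi x)%:C * f x) <= M%:R).
  rewrite normcM -[M%:R]mulr1 ler_pM ?normc_ge0//.
    by rewrite normc_ge0_real ?smooth_pos_ge0// MP.
  by apply: le_trans f1; apply: sup_norm_ub => //; exact: cc_bounded.
- exists (fun j =>
    [set m : rcomp | radon_supported [set x | Omega x /\ depth x <= j.+1%:R]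
    m]).
    by move=> j; eexists; [exact: (compact_sublevel Omega_open j.+1%:R)|].
  move=> d d0; have [phi phiP] := dominating_weight Omega_open d0.
  exists phi => m; have [J mJ] := rcomp_depth Omega_open m.
  exists J.+2, (fun j => rcomp_piece j m); split;
      first exact/rcomp_piece_sum/mJ.
  move=> j; split; first exact: piece_supported.
  by apply: rcomp_piece_variation => //; exact: ltW.
Qed.

Theorem radon_comp_topologyE : radon_comp_topology Omega =
  seminorm_topology [set radon_comp_weighted_norm phi |
    phi in [set: smooth_pos Omega]].
Proof. exact: weight_topology radon_weight_system. Qed.

(** The total variation of phi m is the supremum of |<m, phi f>| over the test
    functions f bounded by 1, and these phi f form a bounded subset of C(Omega)
    since phi is bounded on compact sets. *)
Theorem radon_comp_betaE :
  beta_topology (radon_comp_pairing Omega) (cont_topology Omega) =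
  radon_comp_topology Omega.
Proof.
apply: (weight_beta radon_weight_system).
- move=> g a m m'; rewrite radon_comp_pairing_linear//.
- move=> B _ bB [K KO <-]; have [J KJ] := compact_in_depth Omega_open KO.
  have cJ := compact_sublevel Omega_open J.+2%:R.
  have [||M MP] := @seminorm_bounded _ _ _ B
     (fun g : cont => sup_norm [set x | Omega x /\ depth x <= J.+2%:R] g) _ _
         bB.
  + by exists [set x | Omega x /\ depth x <= J.+2%:R].
  + exact: cont_seminorm.
  exists M => m g mK Bg; rewrite (pairing_ramp Omega_open g KO KJ mK) mulrC.
  apply: le_trans (variation_bound _ (rcomp_scalar m) (rcomp_variation m)) _.
  rewrite ler_wpM2l ?variation_ge0//; first exact: rcomp_variation.
  by apply: le_trans (MP g Bg); exact: sup_norm_cc_mul_ramp.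
- move=> phi; exists [set g | exists2 f : cc, sup_norm setT f <= 1 &
      g = cont_of_cc (cc_mul (smooth_pos_cont phi) f)].
    apply: seminorm_topology_bounded.
      by move=> _ [K KO <-]; exact: cont_seminorm.
    move=> _ [K KO <-]; have [M MP] := smooth_pos_bound phi KO.
    exists M%:R => _ [f f1 ->]; apply: sup_norm_le => // x Kx.
    change (normc ((phi x)%:C * f x) <= M%:R).
    rewrite normcM -[M%:R]mulr1 ler_pM ?normc_ge0//.
      by rewrite normc_ge0_real ?smooth_pos_ge0// MP.
    by apply: le_trans f1; apply: sup_norm_ub => //; exact: cc_bounded.
  exists 2^-1; first by rewrite invr_gt0.
  move=> m mB; apply: (@le_lt_trans _ _ 2^-1); last by rewrite invf_lt1// ltr1n.
  apply: variation_le => f f1; rewrite /radon_mul -(pairing_cc Omega_open).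
  by apply: ltW; apply: mB; exists f.
Qed.

End radon_weights.

(** * Hoelder's inequality and its converse *)

Section Lnorm_duality.
Context d (T : measurableType d) (R : realType).
Variable mu : {sigma_finite_measure set T -> \bar R}.
Implicit Types (p q : \bar R) (F G : T -> R).
Local Open Scope ereal_scope.
Local Notation "'N_ p [ F ]" := (Lnorm mu p (EFin \o F)).

Lemma ge0_Lnorm_le p F G : 1 <= p -> measurable_fun setT F ->
    measurable_fun setT G ->
  {ae mu, forall x, `|F x|%:E <= `|G x|%:E} -> 'N_p[F] <= 'N_p[G].
Proof.
move=> + mF mG FG; rewrite unlock /Lnorm; case: p => [r|_|//].
  rewrite lee_fin => r1; have r0 : (0 < r)%R by rewrite (lt_le_trans ltr01).
  have ge0itv (x : \bar R) : 0 <= x -> x \in `[0, +oo].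
    by move=> x0; rewrite in_itv/= x0 leey.
  have mpow (h : T -> R) : measurable_fun setT h ->
      measurable_fun setT (fun x => `|(EFin \o h) x| `^ r).
    move=> mh; apply: (measurableT_comp (measurable_poweR _)).
    by apply: measurableT_comp => //; exact/measurable_EFinP.
  apply: gt0_ler_poweR; rewrite ?invr_ge0 ?(ltW r0)//.
  1,2: by apply: ge0itv; apply: integral_ge0 => x _; exact: poweR_ge0.
  apply: ae_ge0_le_integral => //; try (by move=> x _; exact: poweR_ge0);
      try exact: mpow.
  apply: filterS FG => x FGx _; apply: gt0_ler_poweR => //; first exact: ltW.
  1,2: by apply: ge0itv; exact: abse_ge0.
by case: ifPn => // _; apply: le_ess_sup; apply: filterS FG.
Qed.

Lemma LnormZ_fin p F (c : R) : 1 <= p -> measurable_fun setT F ->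
    'N_p[F] < +oo ->
  'N_p[(fun x => c * F x)%R] = `|c|%:E * 'N_p[F].
Proof.
move=> p1 mF fF.
have LF : F \in Lfun mu p by rewrite inE /=; apply/andP; split; rewrite inE.
exact: (LnormZ (Lfun_Sub p1 LF) c).
Qed.

(** For exponents 1 and +oo the factor with the infinite exponent is bounded
    almost everywhere by its essential supremum; the remaining exponents are
    Hoelder's inequality for real exponents. *)
Lemma Lnorm_conj_hoelder p q F G : 1 <= p -> 1 <= q -> p^-1 + q^-1 = 1 ->
  measurable_fun setT F -> measurable_fun setT G ->
  'N_p[F] < +oo -> 'N_q[G] < +oo ->
  \int[mu]_x (`|F x * G x|%:E) <= 'N_p[F] * 'N_q[G].
Proof.
have endpoint (F' G' : T -> R) : measurable_fun setT F' ->
    measurable_fun setT G' ->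
    'N_1[F'] < +oo -> 'N_+oo[G'] < +oo ->
    \int[mu]_x (`|F' x * G' x|%:E) <= 'N_1[F'] * 'N_+oo[G'].
  move=> mF mG fF fG.
  have Gc : {ae mu, forall x, `|G' x|%:E <= 'N_+oo[G']}.
    rewrite unlock; case: ifPn => [_|]; first exact: ess_sup_ge.
    rewrite -leNgt => mu0; exists setT; split => //.
    by apply/eqP; rewrite eq_le mu0 measure_ge0.
  have c0 : 0 <= 'N_+oo[G'] by exact: Lnorm_ge0.
  have cfin : 'N_+oo[G'] \is a fin_num by rewrite ge0_fin_numE.
  rewrite muleC -(fineK cfin) Lnorm1 -ge0_integralZl_EFin ?fine_ge0//;
      last first.
    by apply: measurableT_comp => //; exact/measurable_EFinP.
  apply: ae_ge0_le_integral => //.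
  - apply/measurable_EFinP; apply: measurableT_comp => //;
      exact: measurable_funM.
  - by move=> x _; rewrite mule_ge0// lee_fin fine_ge0.
  - apply: measurable_funeM; apply: measurableT_comp => //;
      exact/measurable_EFinP.
  - apply: filterS Gc => x Gx _; rewrite normrM EFinM muleC fineK//.
    by rewrite lee_wpmul2r.
move: p q => [p| |] [q| |] // p1 q1.
- rewrite !lee_fin in p1 q1 * => pq mF mG fF fG.
  have p0 : (0 < p)%R by rewrite (lt_le_trans ltr01).
  have q0 : (0 < q)%R by rewrite (lt_le_trans ltr01).
  have -> : \int[mu]_x `|F x * G x|%:E = 'N_1[(F \* G)%R] by rewrite Lnorm1.
  apply: hoelder => //; move: pq; rewrite !inver !gt_eqF// -EFinD => -[].
  by [].
- rewrite invey adde0 => /eqP; rewrite inve_eq1 => /eqP -> *.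
  exact: endpoint.
- rewrite invey add0e => /eqP; rewrite inve_eq1 => /eqP -> mF mG fF fG.
  under eq_integral do rewrite mulrC.
  by rewrite muleC; exact: endpoint.
- by rewrite invey adde0 => /eqP; rewrite eq_sym onee_eq0.
Qed.

End Lnorm_duality.

Section Lnorm_norming.
Context d (T : measurableType d) (R : realType).
Variable mu : {sigma_finite_measure set T -> \bar R}.
Implicit Types (p q : \bar R) (F G : T -> R).
Local Open Scope ereal_scope.
Local Notation "'N_ p [ F ]" := (Lnorm mu p (EFin \o F)).

Let measurable_powR_comp F (r : R) : measurable_fun setT F ->
  measurable_fun setT (fun x => (F x `^ r)%R).
Proof. exact: (@measurableT_comp _ _ _ _ _ _ (@powR R ^~ r)). Qed.

(** The converse of Hoelder's inequality up to the factor 2.  For 1 < p < +oo, H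
    is the multiple of F^(p-1) of norm 1, and for p = 1 it is 1.  For p = +oo, H
    is the normalised indicator function of a set of finite positive measure on
    which F exceeds half of its norm; the measure being sigma-finite, there is
    such a set, and the half accounts for the factor 2. *)
Lemma Lnorm_norming p q F : 1 <= p -> 1 <= q -> p^-1 + q^-1 = 1 ->
  measurable_fun setT F -> (forall x, 0 <= F x)%R -> 0 < 'N_p[F] ->
      'N_p[F] < +oo ->
  exists H : T -> R, [/\ measurable_fun setT H, (forall x, 0 <= H x)%R,
    'N_q[H] <= 1 & 'N_p[F] <= 2%:E * \int[mu]_x (F x * H x)%:E].
Proof.
have twice (x : \bar R) : 0 <= x -> x <= 2%:E * x.
  by move=> x0; rewrite -[leLHS]mul1e lee_wpmul2r// lee_fin ler1n.
move: p q => [p| |] [q| |] // p1 q1.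
- rewrite !lee_fin in p1 q1 * => pq mF F0 NF0 NFoo.
  have p0 : (0 < p)%R by rewrite (lt_le_trans ltr01).
  have q0 : (0 < q)%R by rewrite (lt_le_trans ltr01).
  have {}pq : (p^-1 + q^-1 = 1)%R by move: pq;
      rewrite !inver !gt_eqF// -EFinD => -[].
  pose I := \int[mu]_x (F x `^ p)%:E.
  have mFp : measurable_fun setT (fun x => (F x `^ p)%:E).
    by apply/measurable_EFinP; exact: measurable_powR_comp.
  have NE : 'N_p%:E[F] = I `^ p^-1.
    rewrite unlock; congr (_ `^ _); apply: eq_integral => x _ /=.
    by rewrite ger0_norm.
  have I0 : 0 <= I by apply: integral_ge0 => x _; rewrite lee_fin powR_ge0.
  have Ifin : I \is a fin_num.
    rewrite ge0_fin_numE// ltey; apply: contraTneq NFoo; rewrite NE => ->.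
    by rewrite poweRyr ?ltxx// invr_neq0// gt_eqF.
  pose i := fine I; have IE : I = i%:E by rewrite fineK.
  have i0 : (0 < i)%R.
    rewrite lt_neqAle -lee_fin -IE I0 andbT; apply: contraTneq NF0.
    by rewrite NE IE => <-; rewrite poweR_EFin powR0 ?ltxx// invr_neq0// gt_eqF.
  have iq0 : (0 < i `^ q^-1)%R by rewrite powR_gt0.
  pose H x : R := (F x `^ (p - 1) / i `^ q^-1)%R.
  exists H; split.
  + by apply: measurable_funM => //; exact: measurable_powR_comp.
  + by move=> x; rewrite divr_ge0 ?powR_ge0.
  + suff -> : 'N_q%:E[H] = 1 by [].
    rewrite unlock.
    under eq_integral => x _.
      rewrite /= ger0_norm ?divr_ge0 ?powR_ge0//.
      have -> : (H x `^ q = i^-1 * F x `^ p)%R.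
        rewrite powRM ?powR_ge0 ?invr_ge0 ?powR_ge0// -powRrM.
        have -> : ((p - 1) * q = p)%R.
          have pqE : (p * q = p + q)%R.
            have := congr1 (fun z => z * (p * q))%R pq; rewrite mul1r => <-.
            by field; rewrite !gt_eqF.
          by rewrite mulrBl pqE mul1r addrK.
        rewrite mulrC; congr (_ * _)%R.
        by rewrite -powRN -powRrM mulNr mulVf ?gt_eqF// powRN powRr1 ?(ltW i0).
      rewrite EFinM; over.
    rewrite ge0_integralZl_EFin//; last 2 first.
      by move=> x _; rewrite lee_fin powR_ge0.
      by rewrite invr_ge0 ltW.
    by rewrite -/I IE -EFinM mulVf ?gt_eqF// poweR1r.
  + have -> : \int[mu]_x (F x * H x)%:E = 'N_p%:E[F].
      rewrite NE IE poweR_EFin.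
      under eq_integral => x _.
        rewrite /H mulrA mulr_powRB1// mulrC EFinM; over.
      rewrite ge0_integralZl_EFin//; last 2 first.
        by move=> x _; rewrite lee_fin powR_ge0.
        by rewrite invr_ge0 ltW.
      rewrite -/I IE -EFinM; congr EFin.
      have -> : (p^-1 = 1 - q^-1)%R by rewrite -pq addrK.
      rewrite powRB; last by rewrite (gt_eqF i0) implybT.
      by rewrite powRr1 ?(ltW i0)// mulrC.
    by apply: twice; exact: Lnorm_ge0.
- rewrite invey adde0 => /eqP; rewrite inve_eq1 => /eqP -> mF F0 NF0 NFoo.
  exists (cst 1%R); split => //.
    rewrite unlock; case: ifPn => // _; apply/ess_supP; apply: aeW => x.
    by rewrite /= normr1.
  rewrite Lnorm1; apply: (le_trans (twice _ _)); first exact: integral_ge0.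
  rewrite le_eqVlt; apply/orP; left; apply/eqP; congr (_ * _).
  by apply: eq_integral => x _; rewrite /= mulr1 ger0_norm.
- rewrite invey add0e => /eqP; rewrite inve_eq1 => /eqP -> mF F0 NF0 NFoo.
  have NE : 'N_+oo[F] = ess_sup mu (EFin \o F).
    move: NF0; rewrite unlock; case: ifPn => [_ _|]; last by rewrite ltxx.
    by apply: eq_ess_sup; apply: aeW => x /=; rewrite ger0_norm.
  have Nfin : 'N_+oo[F] \is a fin_num by rewrite ge0_fin_numE// Lnorm_ge0.
  pose c := fine 'N_+oo[F]; have cE : 'N_+oo[F] = c%:E by rewrite fineK.
  have c0 : (0 < c)%R by rewrite -lte_fin -cE.
  pose A := [set x | (c / 2 < F x)%R].
  have mA : measurable A.
    rewrite (_ : A = setT `&` F @^-1` `](c / 2)%R, +oo[%classic);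
        first exact: mF.
    by rewrite setTI; apply/seteqP; split=> x /=; rewrite in_itv/= andbT.
  have [B [mB BA B0 Boo]] :
      exists B, [/\ measurable B, B `<=` A, 0 < mu B & mu B < +oo].
    have [E ET EP] := sigma_finiteT mu.
    apply: contrapT => noB.
    have nA : mu.-negligible A.
      rewrite -[A]setIT ET setI_bigcupr; apply: negligible_bigcup => k.
      have [mEk Ekoo] := EP k; have mAE :
          measurable (A `&` E k) by exact: measurableI.
      apply/negligibleP => //; apply: contrapT => /eqP AE0; apply: noB.
      exists (A `&` E k); split => //.
        by rewrite lt0e AE0 measure_ge0.
      by apply: le_lt_trans Ekoo; apply: le_measure; rewrite ?inE//;
          exact: subIsetr.
    have : ess_sup mu (EFin \o F) <= (c / 2)%:E.
      apply/ess_supP; apply: negligibleS nA => x /=.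
      by rewrite /A /= lee_fin => /negP; rewrite -ltNge.
    rewrite -NE cE lee_fin; apply/negP; rewrite -ltNge.
    by rewrite ltr_pdivrMr// ltr_pMr// ltr1n.
  pose m := fine (mu B).
  have mE : mu B = m%:E by rewrite fineK// ge0_fin_numE.
  have m0 : (0 < m)%R by rewrite -lte_fin -mE.
  exists (fun x => m^-1 * \1_B x)%R; split.
  + by apply: measurable_funM => //; exact: measurable_indic.
  + by move=> x; rewrite mulr_ge0 ?invr_ge0 ?(ltW m0).
  + rewrite Lnorm1.
    under eq_integral => x _ do rewrite /= ger0_norm ?mulr_ge0 ?invr_ge0
        ?(ltW m0)// EFinM.
    rewrite ge0_integralZl_EFin//; last 2 first.
      by apply/measurable_EFinP; exact: measurable_indic.
      by rewrite invr_ge0 ltW.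
    by rewrite integral_indic// setIT [X in _ * X]mE -EFinM mulVf ?gt_eqF.
  + rewrite cE; apply:
      (@le_trans _ _ (2%:E * \int[mu]_x ((c / 2 / m) * \1_B x)%:E)).
      under eq_integral => x _ do rewrite EFinM.
      rewrite ge0_integralZl_EFin//; last 2 first.
        by apply/measurable_EFinP; exact: measurable_indic.
        by rewrite !divr_ge0 ?(ltW m0) ?(ltW c0).
      rewrite integral_indic// setIT [X in _ * (_ * X)]mE -!EFinM lee_fin divfK
          ?gt_eqF//.
      by rewrite mulrC divfK.
    rewrite lee_wpmul2l// ge0_le_integral//.
    - by move=> x _; rewrite lee_fin mulr_ge0// !divr_ge0 ?(ltW m0) ?(ltW c0).
    - by apply/measurable_EFinP; apply: measurable_funM => //;
        exact: measurable_indic.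
    - apply/measurable_EFinP; apply: measurable_funM => //.
      by apply: measurable_funM => //; exact: measurable_indic.
    - move=> x _; rewrite lee_fin mulrA indicE; have [xB|] := boolP (x \in B).
        rewrite !mulr1 ler_wpM2r ?invr_ge0 ?(ltW m0)//; apply: ltW.
        by apply: BA; rewrite inE in xB.
      by rewrite !mulr0.
- by rewrite invey adde0 => /eqP; rewrite eq_sym onee_eq0.
Qed.

End Lnorm_norming.

(** * Weighted norms of classes of measurable functions *)

Section measurable_functions.
Variables (R : realType) (n : nat).
Local Notation C := (Cplx R).
Local Notation X := 'rV[R]_n.
Local Notation mu := (@lebesgue_rV R n).
Local Notation L0 := (L0Type R n).

Lemma measurable_cont_weight (Omega : set X) (w : X -> R) : open Omega ->
  (forall x, Omega x -> {for x, continuous w}) ->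
  (forall x, ~ Omega x -> w x = 0) -> measurable_fun setT w.
Proof.
move=> oO cw w0.
apply: (measurability _ (RGenOInfty.measurableE R)) => //.
move=> _ [_ [a ->] <-]; rewrite setTI.
have oA : open (Omega `&` [set x | a < w x]).
  rewrite openE => x [Ox ax].
  have nO : nbhs x Omega by exact: open_nbhs_nbhs.
  have := cw x Ox; move/cvgr_gt => /(_ _ ax) h.
  by apply: filterS2 nO h.
have mA := open_measurable_rV oA.
have mO := open_measurable_rV oO.
have [a0|a0] := ltP a 0.
  rewrite (_ : _ @^-1` _ = (Omega `&` [set x | a < w x]) `|` ~` Omega).
    by apply: measurableU => //; exact: measurableC.
  apply/seteqP; split=> x /=; rewrite in_itv/= andbT.
    by move=> ax; have [Ox|nOx] := pselect (Omega x); [left|right].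
  by move=> [[]//|nOx]; rewrite w0.
rewrite (_ : _ @^-1` _ = Omega `&` [set x | a < w x])//.
apply/seteqP; split=> x /=; rewrite in_itv/= andbT; last by case.
move=> ax; split => //; apply: contrapT => nOx.
by move: ax; rewrite w0// ltNge a0.
Qed.

Lemma is_meas_mul (u v : X -> C) : u \in @is_meas R n -> v \in @is_meas R n ->
  (fun x => u x * v x) \in @is_meas R n.
Proof.
rewrite !inE => -[ru iu] [rv iv].
have ReE x : complex.Re (u x * v x : R[i]) =
    complex.Re (u x) * complex.Re (v x) - complex.Im (u x) * complex.Im (v x).
  by case: (u x) (v x) => [? ?] [? ?].
have ImE x : complex.Im (u x * v x : R[i]) =
    complex.Re (u x) * complex.Im (v x) + complex.Im (u x) * complex.Re (v x).
  by case: (u x) (v x) => [? ?] [? ?].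
split.
  rewrite (_ : (fun x => _) = (fun x => complex.Re (u x) * complex.Re (v x) -
    complex.Im (u x) * complex.Im (v x))); last by apply/funext => x;
        exact: ReE.
  by apply: measurable_funB; exact: measurable_funM.
rewrite (_ : (fun x => _) = (fun x => complex.Re (u x) * complex.Im (v x) +
    complex.Im (u x) * complex.Re (v x))); last by apply/funext => x;
        exact: ImE.
by apply: measurable_funD; exact: measurable_funM.
Qed.

Lemma is_meas_real (w : X -> R) : measurable_fun setT w ->
  (fun x => (w x)%:C : C) \in @is_meas R n.
Proof. by move=> mw; rewrite inE; split => //=; exact: measurable_cst. Qed.

Lemma repr_is_meas (f : L0) : (repr f : X -> C) \in @is_meas R n.
Proof. exact: meas_funP. Qed.

Lemma normc_le_ReIm (z : C) : normc z <= `|complex.Re z| + `|complex.Im z|.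
Proof.
case: z => a b /=;
    rewrite -[leRHS]ger0_norm ?addr_ge0// -sqrtr_sqr ler_wsqrtr//.
rewrite sqrrD !real_normK ?num_real// -addrA lerD2l addrC lerDl.
by rewrite mulrn_wge0// mulr_ge0.
Qed.

Lemma Re_le_normc (z : C) : `|complex.Re z| <= normc z.
Proof. by case: z => a b /=; rewrite -sqrtr_sqr ler_wsqrtr// lerDl sqr_ge0. Qed.

Lemma Im_le_normc (z : C) : `|complex.Im z| <= normc z.
Proof. by case: z => a b /=; rewrite -sqrtr_sqr ler_wsqrtr// lerDr sqr_ge0. Qed.

Lemma normc_real_mul (a : R) (z : C) : 0 <= a ->
    normc ((a%:C : C) * z) = a * normc z.
Proof. by move=> a0; rewrite normcM normc_real ger0_norm. Qed.

Lemma measurable_normc_meas (u : X -> C) : u \in @is_meas R n ->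
  measurable_fun setT (fun x => normc (u x)).
Proof. by move=> mu_; exact: (measurable_normc (Meas mu_)). Qed.

Definition L0_class (u : X -> C) (mu_ : u \in @is_meas R n) : L0 :=
  (\pi_L0 (Meas mu_))%qT.

Lemma repr_L0_class u mu_ : {ae mu, forall x, repr (@L0_class u mu_) x = u x}.
Proof. exact: (repr_piE (Meas mu_)). Qed.

Lemma L0_ae_eq (f g : L0) : {ae mu, forall x, repr f x = repr g x} -> f = g.
Proof. by move=> h; rewrite -[f]reprK -[g]reprK; apply/L0_eqP/asboolP. Qed.

Lemma repr_sumE k (y : 'I_k -> L0) :
  {ae mu, forall x, repr (\sum_i y i) x = \sum_i (repr (y i) x : C)}.
Proof.
elim: k y => [|k IH] y.
  rewrite big_ord0; apply: filterS (repr0E R n) => x ->.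
  by rewrite big_ord0.
rewrite big_ord_recl; have := repr_combE 1 (y ord0) (\sum_i y (lift ord0 i)).
rewrite scale1r; apply: filterS2 (IH (fun i => y (lift ord0 i))) => x e1 ->.
by rewrite e1 big_ord_recl (@mul1r C).
Qed.

End measurable_functions.

Section weighted_Lp.
Variables (R : realType) (n : nat).
Local Notation C := (Cplx R).
Local Notation X := 'rV[R]_n.
Local Notation mu := (@lebesgue_rV R n).
Local Notation L0 := (L0Type R n).
Variables (p : \bar R) (p1 : (1 <= p)%E).
Local Notation N F := ('N[mu]_p[EFin \o F])%E.
Implicit Types (w v : X -> R) (f g : L0).

Lemma Lnorm_scaled_le (F G : X -> R) c : measurable_fun setT F ->
    measurable_fun setT G ->
  0 <= c -> {ae mu, forall x, `|F x| <= c * `|G x|} -> (N G < +oo)%E ->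
  (N F <= c%:E * N G)%E.
Proof.
move=> mF mG c0 FG fG; rewrite -[c in leRHS]ger0_norm// -LnormZ_fin//.
apply: ge0_Lnorm_le => //; first exact: measurable_funM.
by apply: filterS FG => x; rewrite lee_fin normrM (ger0_norm c0).
Qed.

(** The norm of the class of w f is the norm of this real function, which is the
    form in which the inequalities for real functions apply. *)
Definition wabs (w : X -> R) (f : L0) : X -> R :=
    fun x => w x * normc (repr f x).

Definition wnorm (w : X -> R) (f : L0) : R :=
    Lp_norm p (fun x => (w x)%:C * repr f x).

Lemma measurable_wabs w f : measurable_fun setT w ->
    measurable_fun setT (wabs w f).
Proof. by move=> mw; apply: measurable_funM => //; exact: measurable_normc. Qed.

Lemma wnormE w f : (forall x, 0 <= w x) -> wnorm w f = fine (N (wabs w f)).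
Proof.
move=> w0; rewrite /wnorm /Lp_norm; congr (fine (Lnorm _ _ (EFin \o _))).
by apply/funext => x; rewrite normc_real_mul.
Qed.

Lemma wnorm_fineK w f : (forall x, 0 <= w x) -> (N (wabs w f) < +oo)%E ->
  (wnorm w f)%:E = N (wabs w f).
Proof.
by move=> w0 fw; rewrite wnormE// fineK// ge0_fin_numE// Lnorm_ge0.
Qed.

Lemma wnorm_ge0 w f : 0 <= wnorm w f.
Proof. by rewrite fine_ge0// Lnorm_ge0. Qed.

Lemma wabs_finite_le w v f g c : measurable_fun setT w ->
    measurable_fun setT v ->
  (forall x, 0 <= w x) -> (forall x, 0 <= v x) -> 0 <= c ->
  {ae mu, forall x, wabs w f x <= c * wabs v g x} -> (N (wabs v g) < +oo)%E ->
  (N (wabs w f) < +oo)%E /\ wnorm w f <= c * wnorm v g.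
Proof.
move=> mw mv w0 v0 c0 fg fin.
have h : (N (wabs w f) <= c%:E * N (wabs v g))%E.
  apply: Lnorm_scaled_le => //; try exact: measurable_wabs.
  apply: filterS fg => x; rewrite !ger0_norm ?mulr_ge0 ?normc_ge0//.
have fw : (N (wabs w f) < +oo)%E.
  apply: le_lt_trans h _; rewrite -(wnorm_fineK v0 fin).
  by rewrite -EFinM ltry.
by split => //; rewrite -lee_fin EFinM !wnorm_fineK.
Qed.

Lemma wnorm_comb w (a : C) f g : measurable_fun setT w ->
    (forall x, 0 <= w x) ->
  (N (wabs w f) < +oo)%E -> (N (wabs w g) < +oo)%E ->
  wnorm w (a *: f + g) <= normc a * wnorm w f + wnorm w g.
Proof.
move=> mw w0 ff fg.
have mf := measurable_wabs f mw; have mg := measurable_wabs g mw.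
have h : (N (wabs w (a *: f + g)%R) <= (normc a)%:E * N (wabs w f) + N
    (wabs w g))%E.
  apply: (@le_trans _ _ (N ((fun x => normc a * wabs w f x) \+ wabs w g)%R)).
    apply: ge0_Lnorm_le => //; first exact: measurable_wabs.
      by apply: measurable_funD => //; exact: measurable_funM.
    apply: filterS (normc_repr_comb a f g) => x fgx.
    rewrite lee_fin !ger0_norm ?addr_ge0 ?mulr_ge0 ?normc_ge0//.
    by rewrite /wabs /= mulrCA -mulrDr ler_wpM2l.
  have maf : measurable_fun setT (fun x => normc a * wabs w f x) by exact:
      measurable_funM.
  apply: le_trans (@eminkowski _ _ _ mu _ _ p maf mg p1) _.
  by rewrite LnormZ_fin// ger0_norm ?normc_ge0.
have fin : (N (wabs w (a *: f + g)%R) < +oo)%E.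
  apply: le_lt_trans h _; rewrite -(wnorm_fineK w0 ff) -(wnorm_fineK w0 fg).
  by rewrite -EFinM -EFinD ltry.
by rewrite -lee_fin EFinD EFinM !wnorm_fineK.
Qed.

Lemma wnorm0 w : measurable_fun setT w -> (forall x, 0 <= w x) -> wnorm w 0 = 0.
Proof.
move=> mw w0; apply/eqP; rewrite eq_le wnorm_ge0 andbT.
have [||_] := @wabs_finite_le w (cst 0) 0 0 0 mw (measurable_cst _) w0
    (fun=> lexx 0) (lexx 0).
- apply: filterS (repr0E R n) => x e0; rewrite /wabs e0 normc0 !mulr0.
  by [].
- rewrite (_ : wabs _ _ = cst 0); last by apply/funext => x;
    rewrite /wabs mul0r.
  exact: (@finite_norm_cst0 _ _ _ mu p p1).
by rewrite mul0r.
Qed.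

Lemma wnorm_seminorm (E : lmodType C) (v : E -> L0) (w : X -> R) :
  (forall a x y, v (a *: x + y) = a *: v x + v y) ->
  measurable_fun setT w -> (forall x, 0 <= w x) ->
  (forall x, (N (wabs w (v x)) < +oo)%E) ->
      is_seminorm (fun x => wnorm w (v x)).
Proof.
move=> lv mw w0 fin; split=> [x y|a x].
  have := wnorm_comb 1 mw w0 (fin x) (fin y).
  by rewrite -lv scale1r normc1 mul1r.
have v0 : v 0 = 0.
  by have := lv (-1) 0 0; rewrite !scaleN1r !addNr.
have := wnorm_comb a mw w0 (fin x) (fin 0).
by rewrite -lv v0 wnorm0// !addr0.
Qed.

End weighted_Lp.

(** * Weights on the functions with compact support *)

Section Lpcomp_weights.
Variables (R : realType) (n : nat) (Omega : set 'rV[R]_n).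
Hypothesis Omega_open : open Omega.
Variables (p : \bar R) (p1 : (1 <= p)%E).
Local Notation C := (Cplx R).
Local Notation X := 'rV[R]_n.
Local Notation mu := (@lebesgue_rV R n).
Local Notation L0 := (L0Type R n).
Local Notation Lp := (Lpcomp Omega p1).
Local Notation depth := (depth Omega).
Local Notation N F := ('N[mu]_p[EFin \o F])%E.
Implicit Types (w v : X -> R) (f g : Lp) (K : set X).

Lemma measurable_smooth_pos (phi : smooth_pos Omega) : measurable_fun setT phi.
Proof.
apply: (measurable_cont_weight Omega_open); last exact: smooth_pos_out.
by move=> x Ox; case: (@smooth_pos_smooth _ _ _ phi [::] x Ox).
Qed.

Lemma measurable_piece j : measurable_fun setT (piece Omega j).
Proof.
apply: (measurable_cont_weight Omega_open); last exact: piece_out.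
by move=> x; exact: continuous_piece.
Qed.

Lemma wabs_cst1 (f : L0) : wabs (cst 1) f = (fun x => normc (repr f x)).
Proof. by apply/funext => x; rewrite /wabs mul1r. Qed.

Lemma wnorm_cst1 (f : L0) : wnorm p (cst 1) f = Lp_norm p (repr f).
Proof. by rewrite /wnorm; congr Lp_norm; apply/funext => x; exact: (@mul1r C).
    Qed.

Lemma Lpcomp_finite f : (N (wabs (cst 1%R) f) < +oo)%E.
Proof. by rewrite wabs_cst1; have /[!inE] -[] := LpcompP f. Qed.

Lemma Lpcomp_compact f : exists2 K, compact_in Omega K & vanishes_off K f.
Proof. by have /[!inE] -[] := LpcompP f. Qed.

Lemma wabs_bounded w f K (J : R) : measurable_fun setT w ->
    (forall x, 0 <= w x) ->
  0 <= J -> (forall x, K x -> w x <= J) -> vanishes_off K f ->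
  (N (wabs w f) < +oo)%E /\ wnorm p w f <= J * Lp_norm p (repr (f : L0)).
Proof.
move=> mw w0 J0 wJ fK; rewrite -wnorm_cst1.
apply: (wabs_finite_le p1) => //; last exact: Lpcomp_finite.
apply: filterS fK => x fx; rewrite wabs_cst1 /wabs.
have [Kx|nKx] := pselect (K x); first by rewrite ler_wpM2r ?normc_ge0 ?wJ.
by rewrite fx// normc0 !mulr0.
Qed.

Lemma Lpcomp_weight_finite (phi : smooth_pos Omega) f :
    (N (wabs phi f) < +oo)%E.
Proof.
have [K KO fK] := Lpcomp_compact f; have [J KJ] := smooth_pos_bound phi KO.
have [] // := @wabs_bounded phi f K J%:R (measurable_smooth_pos phi)
    (smooth_pos_ge0 phi) _ KJ fK.
Qed.

Lemma Lpcomp_weighted_seminorm phi :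
    is_seminorm (@Lpcomp_weighted_norm R n Omega p p1 phi).
Proof.
apply: (@wnorm_seminorm _ _ _ p1 _ (fun f : Lp => (f : L0)) phi) => //.
- exact: measurable_smooth_pos.
- exact: smooth_pos_ge0.
- exact: Lpcomp_weight_finite.
Qed.

Lemma Lpcomp_norm_seminorm :
    is_seminorm (fun f : Lp => Lp_norm p (repr (f : L0))).
Proof.
rewrite (_ : (fun _ => _) = fun f : Lp => wnorm p (cst 1) f); last first.
  by apply/funext => f; rewrite wnorm_cst1.
apply: (@wnorm_seminorm _ _ _ p1 _ (fun f : Lp => (f : L0)) (cst 1)) => //.
exact: Lpcomp_finite.
Qed.

Definition L0_weight w (mw : measurable_fun setT w) (f : L0) : L0 :=
  L0_class (is_meas_mul (is_meas_real mw) (repr_is_meas f)).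

Lemma repr_L0_weight w mw (f : L0) :
  {ae mu, forall x, repr (@L0_weight w mw f) x = (w x)%:C * repr f x}.
Proof. exact: repr_L0_class. Qed.

Fact Lpcomp_piece_subproof j f :
  L0_weight (measurable_piece j) f \in @is_Lpcomp R n Omega p p1.
Proof.
rewrite inE; split.
  have := Lpcomp_finite f; rewrite wabs_cst1; apply: (finite_norm_le p1).
  - exact: measurable_normc.
  - exact: measurable_normc.
  - apply: filterS (repr_L0_weight (measurable_piece j) f) => x ->.
    rewrite !ger0_norm ?normc_ge0// normc_real_mul ?piece_ge0//.
    rewrite ler_piMl ?normc_ge0// (le_trans _ (ramp_le1 Omega j.+1 x))//.
    by rewrite gerBl ramp_ge0.
have [K KO fK] := Lpcomp_compact f; exists K => //.
apply: filterS2 (repr_L0_weight (measurable_piece j) f) fK => x -> fx /fx ->.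
exact: (@mulr0 C).
Qed.

Definition Lpcomp_piece j f : Lp := LpComp (Lpcomp_piece_subproof j f).

Lemma Lpcomp_piece_sum f K J : vanishes_off K f ->
  K `<=` [set x | Omega x /\ depth x <= J%:R] ->
  f = \sum_(j < J.+1) Lpcomp_piece j f.
Proof.
move=> fK KJ; apply: val_inj.
have -> : val (\sum_(j < J.+1) Lpcomp_piece j f) =
    \sum_(j < J.+1) (Lpcomp_piece j f : L0).
  by apply: (big_morph (fun f : Lp => f : L0)).
apply: L0_ae_eq.
have hp : {ae mu, forall x, forall j, repr (L0_weight (measurable_piece j) f) x
    =
    (piece Omega j x)%:C * repr (f : L0) x}.
  by apply: ae_foralln => j; exact: repr_L0_weight.
apply: filterS3 hp fK (repr_sumE (fun j : 'I_J.+1 => (Lpcomp_piece j f : L0)))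
    => x px fx ->.
rewrite (eq_bigr
    (fun j : 'I_J.+1 => (piece Omega j x)%:C * repr (f : L0) x : C));
  last by move=> j _; exact: px.
rewrite -(@mulr_suml C) -(rmorph_sum (real_complex R)) piece_sum.
have [Kx|nKx] := pselect (K x); last by rewrite fx// (@mulr0 C).
have [Ox xJ] := KJ _ Kx; rewrite ramp_eq1// -?natr1 ?lerD2r//.
by rewrite (@mul1r C).
Qed.

(** As for continuous functions, with pointwise estimates that hold almost
    everywhere. *)
Lemma Lpcomp_weight_system :
    weight_system (fun f : Lp => Lp_norm p (repr (f : L0)))
  [set [set f : Lp | vanishes_off K f] | K in compact_in Omega]
  (@Lpcomp_weighted_norm R n Omega p p1).
Proof.
split.
- exact: Lpcomp_norm_seminorm.
- exact: Lpcomp_weighted_seminorm.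
- move=> _ [K KO <-] a f fK.
  by have := vanishes_off_comb a fK (@vanishes_off0 R n K); rewrite addr0.
- by move=> _ [K KO <-]; exact: vanishes_off0.
- move=> phi _ [K KO <-]; have [J KJ] := smooth_pos_bound phi KO.
  exists J%:R => f fK.
  by have [] := @wabs_bounded phi f K J%:R (measurable_smooth_pos phi)
      (smooth_pos_ge0 phi) _ KJ fK.
- exists (fun j =>
    [set f : Lp | vanishes_off [set x | Omega x /\ depth x <= j.+1%:R] f]).
    by move=> j; eexists; [exact: (compact_sublevel Omega_open j.+1%:R)|].
  move=> d d0; have [phi phiP] := dominating_weight Omega_open d0.
  exists phi => f; have [K KO fK] := Lpcomp_compact f.
  have [J KJ] := compact_in_depth Omega_open KO.
  exists J.+1, (fun j => Lpcomp_piece j f); split;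
      first exact: Lpcomp_piece_sum fK KJ.
  move=> j; have hp := repr_L0_weight (measurable_piece j) f; split.
    apply: filterS hp => x fx nKx; rewrite [LHS]fx.
    rewrite (_ : piece Omega j x = 0) ?(@mul0r C)//.
    by apply/eqP; apply: contra_notT nKx => /piece_neq0[].
  rewrite -wnorm_cst1.
  apply: (proj2 (@wabs_finite_le _ _ _ p1 (cst 1) phi _ f (d j) _ _ _ _ _ _ _))
      => //.
  + exact: measurable_smooth_pos.
  + exact: smooth_pos_ge0.
  + exact: ltW.
  + apply: filterS hp => x fx; rewrite wabs_cst1 [X in normc X]fx.
    rewrite normc_real_mul ?piece_ge0// /wabs mulrA.
    by rewrite ler_wpM2r ?normc_ge0.
  + exact: Lpcomp_weight_finite.
Qed.

Theorem Lpcomp_topologyE : Lpcomp_topology Omega p1 =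
  seminorm_topology [set Lpcomp_weighted_norm p1 phi |
    phi in [set: smooth_pos Omega]].
Proof. exact: weight_topology Lpcomp_weight_system. Qed.

End Lpcomp_weights.

(** * The duality of Lebesgue spaces *)

Section Lp_duality.
Variables (R : realType) (n : nat) (Omega : set 'rV[R]_n).
Hypothesis Omega_open : open Omega.
Local Notation C := (Cplx R).
Local Notation X := 'rV[R]_n.
Local Notation mu := (@lebesgue_rV R n).
Local Notation L0 := (L0Type R n).
Implicit Types (h : X -> C) (K : set X).

Let mO : measurable Omega := open_measurable_rV Omega_open.

Definition cintegral h : C :=
  (\int[mu]_(x in Omega) complex.Re (h x)) +i*
      (\int[mu]_(x in Omega) complex.Im (h x)).

Definition cintegrable h := h \in @is_meas R n /\
  mu.-integrable Omega (fun x => (normc (h x))%:E).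

Lemma measurable_Re h : h \in @is_meas R n ->
  measurable_fun Omega (fun x => complex.Re (h x)).
Proof. by rewrite inE => -[mR _]; exact: measurable_funS mR. Qed.

Lemma measurable_Im h : h \in @is_meas R n ->
  measurable_fun Omega (fun x => complex.Im (h x)).
Proof. by rewrite inE => -[_ mI]; exact: measurable_funS mI. Qed.

Lemma integrable_Re h : cintegrable h ->
  mu.-integrable Omega (EFin \o (fun x => complex.Re (h x))).
Proof.
move=> [mh ih]; apply: le_integrable ih => //.
  by apply/measurable_EFinP; exact: measurable_Re.
by move=> x _ /=; rewrite lee_fin (ger0_norm (normc_ge0 _)) Re_le_normc.
Qed.

Lemma integrable_Im h : cintegrable h ->
  mu.-integrable Omega (EFin \o (fun x => complex.Im (h x))).
Proof.
move=> [mh ih]; apply: le_integrable ih => //.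
  by apply/measurable_EFinP; exact: measurable_Im.
by move=> x _ /=; rewrite lee_fin (ger0_norm (normc_ge0 _)) Im_le_normc.
Qed.

Lemma ae_eq_Rintegral (u v : X -> R) : measurable_fun Omega u ->
    measurable_fun Omega v ->
  {ae mu, forall x, u x = v x} ->
      \int[mu]_(x in Omega) u x = \int[mu]_(x in Omega) v x.
Proof.
move=> mu_ mv uv; rewrite /Rintegral; congr fine; apply: ae_eq_integral => //.
- exact/measurable_EFinP.
- exact/measurable_EFinP.
- by apply: filterS uv => x /= -> _.
Qed.

Lemma cintegral_comb (a : C) h1 h2 h : cintegrable h1 -> cintegrable h2 ->
  h \in @is_meas R n -> {ae mu, forall x, h x = a * h1 x + h2 x} ->
  cintegral h = a * cintegral h1 + cintegral h2.
Proof.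
move=> i1 i2 mh hE.
have R1 := integrable_Re i1; have I1 := integrable_Im i1.
have R2 := integrable_Re i2; have I2 := integrable_Im i2.
case: i1 i2 => m1 _ [m2 _].
case: a hE => a b hE.
have ReE : \int[mu]_(x in Omega) complex.Re (h x) =
    a * \int[mu]_(x in Omega) complex.Re (h1 x) - b * \int[mu]_(x in Omega)
        complex.Im (h1 x) +
    \int[mu]_(x in Omega) complex.Re (h2 x).
  transitivity (\int[mu]_(x in Omega)
      ((a * complex.Re (h1 x) - b * complex.Im (h1 x)) +
      complex.Re (h2 x))).
    apply: ae_eq_Rintegral; first exact: measurable_Re.
      apply: measurable_funD; last exact: measurable_Re.
      by apply: measurable_funB; apply: measurable_funM => //;
        [exact: measurable_Re|exact: measurable_Im].
    by apply: filterS hE => x ->; case: (h1 x) (h2 x) => [? ?] [? ?].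
  have aR : mu.-integrable Omega (EFin \o (fun x => a * complex.Re (h1 x))).
    exact: (integrableZl mO a R1).
  have bI : mu.-integrable Omega (EFin \o (fun x => b * complex.Im (h1 x))).
    exact: (integrableZl mO b I1).
  rewrite RintegralD//; last exact: (integrableB mO aR bI).
  rewrite RintegralB//.
  by rewrite !RintegralZl.
have ImE : \int[mu]_(x in Omega) complex.Im (h x) =
    a * \int[mu]_(x in Omega) complex.Im (h1 x) + b * \int[mu]_(x in Omega)
        complex.Re (h1 x) +
    \int[mu]_(x in Omega) complex.Im (h2 x).
  transitivity (\int[mu]_(x in Omega)
      ((a * complex.Im (h1 x) + b * complex.Re (h1 x)) +
      complex.Im (h2 x))).
    apply: ae_eq_Rintegral; first exact: measurable_Im.
      apply: measurable_funD; last exact: measurable_Im.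
      by apply: measurable_funD; apply: measurable_funM => //;
        [exact: measurable_Im|exact: measurable_Re].
    by apply: filterS hE => x ->; case: (h1 x) (h2 x) => [? ?] [? ?].
  have aI : mu.-integrable Omega (EFin \o (fun x => a * complex.Im (h1 x))).
    exact: (integrableZl mO a I1).
  have bR : mu.-integrable Omega (EFin \o (fun x => b * complex.Re (h1 x))).
    exact: (integrableZl mO b R1).
  rewrite RintegralD//; last exact: (integrableD mO aI bR).
  rewrite RintegralD//.
  by rewrite !RintegralZl.
by rewrite /cintegral ReE ImE.
Qed.

(** The real and imaginary parts are estimated separately: hence the 2. *)
Lemma normc_cintegral h : cintegrable h ->
  ((normc (cintegral h))%:E <= 2%:E * \int[mu]_(x in Omega) (normc (h x))%:E)%E.
Proof.
move=> ih; have [mh inh] := ih.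
apply: (@le_trans _ _ (`|\int[mu]_(x in Omega) complex.Re (h x)|%:E +
    `|\int[mu]_(x in Omega) complex.Im (h x)|%:E)%E).
  by rewrite -EFinD lee_fin; exact: normc_le_ReIm.
have mn : measurable_fun Omega (fun x => (normc (h x))%:E).
  by case/integrableP : inh.
rewrite [leRHS](_ :
    _ = (\int[mu]_(x in Omega) (normc (h x))%:E + \int[mu]_(x in Omega)
    (normc (h x))%:E)%E); last first.
  by rewrite mule_natl mule2n.
apply: leeD.
  rewrite EFin_normr_Rintegral//; last exact: integrable_Re.
  apply: (le_trans (le_abse_integral _ _ _)) => //.
    by apply/measurable_EFinP; exact: measurable_Re.
  apply: ge0_le_integral => //.
  - apply: measurableT_comp => //; apply/measurable_EFinP; exact: measurable_Re.
  - by move=> x _; rewrite lee_fin Re_le_normc.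
rewrite EFin_normr_Rintegral//; last exact: integrable_Im.
apply: (le_trans (le_abse_integral _ _ _)) => //.
  by apply/measurable_EFinP; exact: measurable_Im.
apply: ge0_le_integral => //.
- apply: measurableT_comp => //; apply/measurable_EFinP; exact: measurable_Im.
- by move=> x _; rewrite lee_fin Im_le_normc.
Qed.

Variables (p q : \bar R) (p1 : (1 <= p)%E) (q1 : (1 <= q)%E).
Hypothesis pq : (p^-1 + q^-1 = 1)%E.
Local Notation Lp := (Lpcomp Omega p1).
Local Notation Lq := (Lploc Omega q1).

Lemma Lploc_finite (g : Lq) K : compact_in Omega K ->
  ('N[mu]_q[EFin \o wabs \1_K g] < +oo)%E.
Proof. by have /[!inE] -[_] := LplocP g; apply. Qed.

Lemma measurable_indic_compact K : compact_in Omega K ->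
  measurable_fun setT (\1_K : X -> R).
Proof. by move=> [cK _]; apply: measurable_indic; exact: compact_measurable_rV.
    Qed.

Lemma indic_ge0 K (x : X) : 0 <= (\1_K x : R).
Proof. by rewrite indicE. Qed.

Lemma Lploc_seminorm K : compact_in Omega K ->
  is_seminorm (fun g : Lq => wnorm q \1_K (g : L0)).
Proof.
move=> KO; apply: (@wnorm_seminorm _ _ _ q1 _ (fun g : Lq => (g : L0)) (\1_K))
    => //.
- exact: measurable_indic_compact.
- by move=> g; exact: Lploc_finite.
Qed.

Definition Lp_product (f : Lp) (g : Lq) : X -> C :=
  fun x => repr (f : L0) x * repr (g : L0) x.

(** As f vanishes off K, g may be replaced by its restriction to K. *)
Lemma Lp_product_hoelder (f : Lp) (g : Lq) K : compact_in Omega K ->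
    vanishes_off K f ->
  cintegrable (Lp_product f g) /\
  (\int[mu]_(x in Omega) (normc (Lp_product f g x))%:E <=
    (Lp_norm p (repr (f : L0)) * wnorm q \1_K (g : L0))%:E)%E.
Proof.
move=> KO fK.
have mh : Lp_product f g \in @is_meas R n.
  by apply: is_meas_mul; exact: repr_is_meas.
have mnh := measurable_normc_meas mh.
have mf := measurable_wabs (f : L0) (measurable_cst (1 : R)).
have mg := measurable_wabs (g : L0) (measurable_indic_compact KO).
have ff := Lpcomp_finite f; have fg := Lploc_finite g KO.
have H := Lnorm_conj_hoelder p1 q1 pq mf mg ff fg.
have le : (\int[mu]_(x in Omega) (normc (Lp_product f g x))%:E <=
    (Lp_norm p (repr (f : L0)) * wnorm q \1_K (g : L0))%:E)%E.
  rewrite EFinM -wnorm_cst1 !wnorm_fineK//.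
  apply: le_trans H.
  apply: (@le_trans _ _ (\int[mu]_x (normc (Lp_product f g x))%:E)%E).
    apply: ge0_subset_integral => //; first exact/measurable_EFinP.
    by move=> x _; rewrite lee_fin normc_ge0.
  apply: ae_ge0_le_integral => //.
  - by move=> x _; rewrite lee_fin normc_ge0.
  - exact/measurable_EFinP.
  - by apply/measurable_EFinP; apply: measurableT_comp => //;
      exact: measurable_funM.
  - apply: filterS fK => x fx _; rewrite lee_fin normcM.
    have [Kx|nKx] := pselect (K x); last by rewrite fx// normc0 mul0r.
    rewrite /wabs indicE mem_set//= !mul1r ger0_norm// mulr_ge0 ?normc_ge0//.
split => //; split => //; apply/integrableP; split.
  by apply/measurable_EFinP; exact: measurable_funS mnh.
under eq_integral => x _ do rewrite gee0_abs ?lee_fin ?normc_ge0//.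
by apply: le_lt_trans le _; rewrite ltry.
Qed.

Lemma Lp_pairingE (f : Lp) (g : Lq) :
    Lp_pairing Omega p1 q1 f g = cintegral (Lp_product f g).
Proof. by []. Qed.

Lemma Lp_pairing_scalar (g : Lq) : scalar ((Lp_pairing Omega p1 q1) ^~ g).
Proof.
move=> a f f'; rewrite !Lp_pairingE.
have [K KO fK] := Lpcomp_compact f; have [K' K'O f'K] := Lpcomp_compact f'.
have [i1 _] := Lp_product_hoelder g KO fK; have [i2 _] :=
    Lp_product_hoelder g K'O f'K.
apply: cintegral_comb => //.
  by apply: is_meas_mul; exact: repr_is_meas.
apply: filterS (repr_combE a (f : L0) (f' : L0)) => x fx.
change (repr (a *: (f : L0) + (f' : L0)) x * repr (g : L0) x =
  a * (repr (f : L0) x * repr (g : L0) x) + repr (f' : L0) x * repr (g : L0) x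
      :> C).
by rewrite fx (@mulrDl C) (@mulrA C).
Qed.

Lemma Lp_pairing_bound (f : Lp) (g : Lq) K : compact_in Omega K ->
    vanishes_off K f ->
  normc (Lp_pairing Omega p1 q1 f g) <= 2 *
      (Lp_norm p (repr (f : L0)) * wnorm q \1_K (g : L0)).
Proof.
move=> KO fK; have [ifg le] := Lp_product_hoelder g KO fK.
rewrite Lp_pairingE -lee_fin EFinM; apply: le_trans (normc_cintegral ifg) _.
by rewrite lee_wpmul2l.
Qed.

(** The function w conj f / |f|, with value 0 where f vanishes; its product with
    f is w |f|. *)
Definition phase (w : X -> R) (f : L0) : X -> C :=
  fun x => (w x / normc (repr f x))%:C *
      (complex.Re (repr f x) -i* complex.Im (repr f x)).

Lemma phase_is_meas (w : X -> R) (f : L0) : measurable_fun setT w ->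
    phase w f \in @is_meas R n.
Proof.
move=> mw; have := repr_is_meas f; rewrite inE => -[mR mI].
apply: is_meas_mul.
  apply: is_meas_real; apply: measurable_funM => //.
  rewrite (_ : (fun x => _) = (@powR R ^~ (-1)) \o (fun x => normc (repr f x))).
    by apply: (@measurableT_comp _ _ _ _ _ _ (@powR R ^~ (-1))) => //;
        exact: measurable_normc.
  by apply/funext => x /=; rewrite powR_inv1// normc_ge0.
by rewrite inE; split => //=; exact: measurable_funN.
Qed.

Lemma phase_mul (w : X -> R) (f : L0) x :
  repr f x * phase w f x = ((w x * normc (repr f x))%:C : C).
Proof.
rewrite /phase; case: (repr f x) => a b.
set r := normc _; have rE : r ^+ 2 = a ^+ 2 + b ^+ 2.
  by rewrite sqr_sqrtr// addr_ge0// sqr_ge0.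
have -> : w x * r = w x / r * (a ^+ 2 + b ^+ 2).
  rewrite -rE; have [->|r0] := eqVneq r 0; first by rewrite expr0n/= !mulr0.
  by field.
by apply/eqP; rewrite eq_complex /=; apply/andP; split; apply/eqP; ring.
Qed.

Lemma normc_phase (w : X -> R) (f : L0) x : 0 <= w x ->
    normc (phase w f x) <= w x.
Proof.
move=> w0; rewrite /phase normc_real_mul ?divr_ge0 ?normc_ge0//.
case: (repr f x) => a b /=; rewrite sqrrN.
set r := Num.sqrt _; have [->|r0] := eqVneq r 0; first by rewrite mulr0.
by rewrite divfK.
Qed.

(** For H norming F = |phi f| in the sense of Lnorm_norming, the pairing of f with
    g = phi H conj f / |f| is the integral of F H. *)
Lemma Lpcomp_norming (phi : smooth_pos Omega) (f : Lp) :
  exists2 g : Lq, (exists H : X ->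
      R, [/\ measurable_fun setT H, forall x, 0 <= H x,
      ('N[mu]_q[EFin \o H] <= 1)%E &
      {ae mu, forall x, normc (repr (g : L0) x) <= phi x * H x}]) &
    Lpcomp_weighted_norm p1 phi f <= 2 * normc (Lp_pairing Omega p1 q1 f g).
Proof.
pose F := wabs phi (f : L0).
have mphi := measurable_smooth_pos Omega_open phi.
have mF : measurable_fun setT F by exact: measurable_wabs.
have F0 x : 0 <= F x by rewrite mulr_ge0 ?smooth_pos_ge0 ?normc_ge0.
have fF : ('N[mu]_p[EFin \o F] < +oo)%E by exact: Lpcomp_weight_finite.
have [H [mH H0 NH FH]] : exists H : X ->
    R, [/\ measurable_fun setT H, forall x, 0 <= H x,
    ('N[mu]_q[EFin \o H] <= 1)%E &
    ('N[mu]_p[EFin \o F] <= 2%:E * \int[mu]_x (F x * H x)%:E)%E].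
  have [F00|F_neq0] := eqVneq ('N[mu]_p[EFin \o F])%E 0%E.
    exists (cst 0); split => //; last first.
      by rewrite F00 mule_ge0// integral_ge0// => x _; rewrite lee_fin mulr0.
    by rewrite Lnorm0// gt_eqF// (lt_le_trans _ q1).
  by apply: Lnorm_norming => //; rewrite lt0e F_neq0 Lnorm_ge0.
pose w x := phi x * H x.
have w0 x : 0 <= w x by rewrite mulr_ge0// smooth_pos_ge0.
have mw : measurable_fun setT w by exact: measurable_funM.
pose G := L0_class (phase_is_meas (f : L0) mw).
have GE : {ae mu, forall x, repr G x = phase w (f : L0) x} := repr_L0_class _.
have Gw : {ae mu, forall x, normc (repr G x) <= phi x * H x}.
  by apply: filterS GE => x ->; exact: normc_phase.
have GP : G \in @is_Lploc R n Omega q q1.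
  rewrite inE; split.
    apply: filterS Gw => x + nOx; rewrite smooth_pos_out// mul0r => Gx.
    by apply: eq0_normc; apply/eqP; rewrite eq_le Gx normc_ge0.
  move=> K KO; have [J KJ] := smooth_pos_bound phi KO.
  apply: (@le_lt_trans _ _ (J%:R%:E * 'N[mu]_q[EFin \o H])%E); last first.
    apply: (@le_lt_trans _ _ J%:R%:E); last exact: ltry.
    by rewrite -[leRHS]mule1 lee_wpmul2l.
  apply: Lnorm_scaled_le => //.
  - by apply: measurable_funM;
      [exact: measurable_indic_compact|exact: measurable_normc].
  - apply: filterS Gw => x Gx;
      rewrite indicE normrM (ger0_norm (normc_ge0 _)) (ger0_norm (H0 x)).
    have [Kx|nKx] := boolP (x \in K); last by rewrite normr0 mul0r mulr_ge0.
    rewrite normr1 mul1r; apply: le_trans Gx _.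
    by rewrite ler_wpM2r// KJ//; rewrite inE in Kx.
  - by apply: le_lt_trans NH _; rewrite ltry.
exists (LpLoc GP); first by exists H.
have [K KO fK] := Lpcomp_compact f; have [ifg _] :=
    Lp_product_hoelder (LpLoc GP) KO fK.
have ReE : \int[mu]_(x in Omega) complex.Re (Lp_product f (LpLoc GP) x) =
    fine (\int[mu]_x (F x * H x)%:E)%E.
  have -> : (\int[mu]_x (F x * H x)%:E = \int[mu]_(x in Omega)
      (F x * H x)%:E)%E.
    rewrite [RHS]integral_mkcond; apply: eq_integral => x _.
    rewrite patchE; case: ifPn => // /negP; rewrite inE => nOx.
    by rewrite /F /wabs smooth_pos_out// !mul0r.
  apply: ae_eq_Rintegral.
  - by case: ifg => mfg _; exact: measurable_Re.
  - by apply: measurable_funTS; exact: measurable_funM.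
  - apply: filterS GE => x Gx.
    rewrite (_ : Lp_product f (LpLoc GP) x =
        (w x * normc (repr (f : L0) x))%:C).
      by rewrite /= /F /wabs /w mulrAC.
    by rewrite -phase_mul -Gx.
have le1 : fine (\int[mu]_x (F x * H x)%:E)%E <= normc
    (Lp_pairing Omega p1 q1 f (LpLoc GP)).
  by rewrite -ReE Lp_pairingE (le_trans (ler_norm _))//;
      exact: Re_le_normc (cintegral _).
have int_fin : (\int[mu]_x (F x * H x)%:E)%E \is a fin_num.
  have I0 : (0 <= \int[mu]_x (F x * H x)%:E)%E.
    by apply: integral_ge0 => x _; rewrite lee_fin mulr_ge0.
  rewrite ge0_fin_numE//.
  have fH : ('N[mu]_q[EFin \o H] < +oo)%E by apply: le_lt_trans NH _;
      rewrite ltry.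
  have := Lnorm_conj_hoelder p1 q1 pq mF mH fF fH.
  under eq_integral => x _ do rewrite (ger0_norm (mulr_ge0 (F0 x) (H0 x))).
  move=> /le_lt_trans; apply;
      rewrite -(wnorm_fineK (@smooth_pos_ge0 _ _ _ phi) fF).
  apply: (@le_lt_trans _ _ ((wnorm p phi (f : L0))%:E * 1)%E);
      last by rewrite mule1 ltry.
  by rewrite lee_wpmul2l// lee_fin wnorm_ge0.
apply: (@le_trans _ _ (2 * fine (\int[mu]_x (F x * H x)%:E)%E));
    last by rewrite ler_pM2l.
rewrite -lee_fin EFinM (fineK int_fin); apply: (le_trans _ FH).
by rewrite -(wnorm_fineK (@smooth_pos_ge0 _ _ _ phi) fF).
Qed.

(** The functions g with |g| <= phi H for some H of norm at most 1 form a
    bounded set, as phi is bounded on compact sets, and they contain those of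
    Lpcomp_norming; the constant 4 absorbs the factor 2 there.  Conversely
    Hoelder's inequality bounds the pairing on each step by the norm of f times a
    seminorm of g. *)
Theorem Lpcomp_betaE :
    beta_topology (Lp_pairing Omega p1 q1) (Lploc_topology Omega q1) =
  Lpcomp_topology Omega p1.
Proof.
apply: (weight_beta (Lpcomp_weight_system Omega_open p1)).
- exact: Lp_pairing_scalar.
- move=> B _ bB [K KO <-].
  have [||M MP] :=
      @seminorm_bounded _ _ _ B (fun g : Lq => wnorm q \1_K (g : L0)) _ _ bB.
  + by exists K.
  + exact: Lploc_seminorm.
  exists (2 * M) => f g fK Bg; apply: le_trans (Lp_pairing_bound g KO fK) _.
  rewrite -mulrA ler_pM2l// mulrC ler_wpM2r ?MP//.
  exact: seminorm_ge0 (Lpcomp_norm_seminorm _ _).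
- move=> phi; exists [set g : Lq | exists H : X -> R,
      [/\ measurable_fun setT H, forall x, 0 <= H x,
          ('N[mu]_q[EFin \o H] <= 1)%E &
      {ae mu, forall x, normc (repr (g : L0) x) <= phi x * H x}]].
    apply: seminorm_topology_bounded.
      by move=> _ [K KO <-]; exact: Lploc_seminorm.
    move=> _ [K KO <-]; have [J KJ] := smooth_pos_bound phi KO.
    exists J%:R => g [H [mH H0 NH gH]].
    rewrite -lee_fin; rewrite (wnorm_fineK (@indic_ge0 K) (Lploc_finite g KO)).
    apply: (@le_trans _ _ (J%:R%:E * 'N[mu]_q[EFin \o H])%E); last first.
      by rewrite -[leRHS]mule1 lee_wpmul2l.
    apply: Lnorm_scaled_le => //.
    + by apply: measurable_wabs; exact: measurable_indic_compact.
    + apply: filterS gH => x Gx;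
        rewrite /wabs indicE normrM (ger0_norm (normc_ge0 _))
        (ger0_norm (H0 x)).
      have [Kx|nKx] := boolP (x \in K); last by rewrite normr0 mul0r mulr_ge0.
      rewrite normr1 mul1r; apply: le_trans Gx _.
      by rewrite ler_wpM2r// KJ//; rewrite inE in Kx.
    + by apply: le_lt_trans NH _; rewrite ltry.
  exists 4^-1; first by rewrite invr_gt0.
  move=> f fB; have [g gB le] := Lpcomp_norming phi f.
  apply: (le_lt_trans le); rewrite -ltr_pdivlMl// mulr1.
  apply: lt_trans (fB g gB) _; rewrite ltf_pV2 ?posrE//.
  by rewrite ltr_nat.
Qed.

End Lp_duality.

(** * The theorem *)

Theorem proposition6p2 (R : realType) (n : nat) (Omega : set 'rV[R]_n)
    (Omega_open : open Omega) :
  (forall (p q : \bar R) (p1 : (1 <= p)%E) (q1 : (1 <= q)%E),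
    (p^-1 + q^-1 = 1)%E ->
    Lpcomp_topology Omega p1 =
      seminorm_topology [set Lpcomp_weighted_norm p1 phi |
        phi in [set: smooth_pos Omega]] /\
    beta_topology (Lp_pairing Omega p1 q1) (Lploc_topology Omega q1) =
      Lpcomp_topology Omega p1) /\
  [/\ linear (radon_comp_pairing Omega),
      set_bij [set: radonComp Omega] (topological_dual (cont_topology Omega))
        (radon_comp_pairing Omega),
      radon_comp_topology Omega =
        seminorm_topology [set radon_comp_weighted_norm phi |
          phi in [set: smooth_pos Omega]] &
      beta_topology (radon_comp_pairing Omega) (cont_topology Omega) =
        radon_comp_topology Omega] /\
  (cc_topology Omega =
     seminorm_topology [set cc_weighted_norm phi |
       phi in [set: smooth_pos Omega]] /\
   beta_topology (cc_radon_pairing Omega) (radon_topology Omega) =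
     cc_topology Omega).
Proof.
split.
  move=> p q p1 q1 pq; split; first exact: Lpcomp_topologyE.
  exact: Lpcomp_betaE.
split; last by split; [exact: cc_topologyE|exact: cc_betaE].
split.
- exact: radon_comp_pairing_linear.
- exact: pairing_bij.
- exact: radon_comp_topologyE.
- exact: radon_comp_betaE.
Qed.
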